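(* Let $E,E_0,E_1$ be r.i. spaces, $b\in SV(0,1)$, $1<p_0<p_1<\infty$ and $\alpha,\beta<1$. Put $$\rho(u)=u^{\frac1{p_0}-\frac1{p_1}}\frac{\ell^{\alpha-1}(u)\,\varphi_{E_0}(\ell(u))}{\ell^{\beta-1}(u)\,\varphi_{E_1}(\ell(u))},\qquad u\in(0,1).$$ (a) If $0<\theta<1$, then $\big(B_{p_0,\alpha,E_0},B_{p_1,\beta,E_1}\big)_{\theta,b,E}=L_{p,B_\theta,E}$, where $\frac1p=\frac{1-\theta}{p_0}+\frac{\theta}{p_1}$ and $B_\theta(u)=\big(\ell^{\alpha-1}(u)\varphi_{E_0}(\ell(u))\big)^{1-\theta}\big(\ell^{\beta-1}(u)\varphi_{E_1}(\ell(u))\big)^{\theta}\,b(\rho(u))$, $u\in(0,1)$. (b) If $\theta=0$, then $$\big(B_{p_0,\alpha,E_0},B_{p_1,\beta,E_1}\big)_{0,b,E}=L^{\mathcal L}_{p_0,B_0,E,\ell^{\alpha-1}(u),L_\infty}\cap L^{\mathcal L,\mathcal L}_{p_0,\,b\circ\rho,\,E,\,1,\,E_0,\,\ell^{\alpha-1}(u),\,L_\infty},$$ where $B_0(u)=\varphi_{E_0}(\ell(u))\,b(\rho(u))$, $u\in(0,1)$. (c) If $\theta=1$ and $\|b\|_{\widetilde E(0,1)}<\infty$, then $\big(B_{p_0,\alpha,E_0},B_{p_1,\beta,E_1}\big)_{1,b,E}=L^{\mathcal L,\mathcal R}_{p_1,\,b\circ\rho,\,E,\,1,\,E_1,\,\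ell^{\beta-1}(u),\,L_\infty}$.
   Context: Notation. $\ell(t)=1+|\log t|$, $\ell^\sigma(t)=(\ell(t))^\sigma$. An r.i. space $E$ is a rearrangement invariant Banach function space on $(0,\infty)$ with the Fatou property; $\varphi_E(s)=\|\chi_{(0,s)}\|_E$, $s>0$, is its fundamental function; $\widetilde E$ is the corresponding space for the measure $dt/t$, with $\|g\|_{\widetilde E}=\|g^\star\|_E$ ($g^\star$ the non-increasing rearrangement with respect to $dt/t$); for an interval $I$, $\|g\|_{\widetilde E(I)}=\|g\chi_I\|_{\widetilde E}$. A positive finite measurable $b$ on $(0,1)$ is in $SV(0,1)$ if for all $\varepsilon>0$, $t^\varepsilon b(t)$ is equivalent to a non-decreasing function and $t^{-\varepsilon}b(t)$ to a non-increasing one on $(0,1)$. In $b(\rho(u))$, $b$ is understood as extended to $[1,\infty)$ by $b(s)=1$ for $s\ge1$ (the choice of slowly varying extension is immaterial up to equivalence of norms). Interpolation spaces: for (quasi-)Banach spaces with $Y_1\hookrightarrow Y_0$, $(Y_0,Y_1)_{\theta,b,E}$ is the set of $f\in Y_0$ with $\|t^{-\theta}b(t)K(t,f;Y_0,Y_1)\|_{\widetilde E(0,1)}<\infty$, $0\le\theta\le1$, where $K$ is Peetre's $K$-functional. Function spaces: functions are measurable on $(0,1)$ with Lebesgue measure; $f^*$ is the non-increasing rearrangement and $f^{**}(t)=\frac1t\int_0^tf^*(s)\,ds$. Each space is the set of measurable $f$ with finite indicated norm (innermost norm in $s$, next in $t$, outermost in $u$), $1<p<\infty$: - $L_{p,b,E}$: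 $\|t^{1/p}b(t)f^*(t)\|_{\widetilde E(0,1)}$; - $L^{\mathcal L}_{p,b,E,a,F}$: $\big\|b(t)\|s^{1/p}a(s)f^*(s)\|_{\widetilde F(0,t)}\big\|_{\widetilde E(0,1)}$; - $L^{\mathcal L,\mathcal L}_{p,c,E,b,F,a,G}$: $\Big\|c(u)\big\|b(t)\|s^{1/p}a(s)f^*(s)\|_{\widetilde G(0,t)}\big\|_{\widetilde F(0,u)}\Big\|_{\widetilde E(0,1)}$; - $L^{\mathcal L,\mathcal R}_{p,c,E,b,F,a,G}$: $\Big\|c(u)\big\|b(t)\|s^{1/p}a(s)f^*(s)\|_{\widetilde G(u,t)}\big\|_{\widetilde F(u,1)}\Big\|_{\widetilde E(0,1)}$; - $B_{p,\alpha,E}$ ($\alpha<1$): $\Big\|\sup_{0<s<t}s^{1/p}\ell^{\alpha-1}(s)f^{**}(s)\Big\|_{\widetilde E(0,1)}$. Equality of spaces means equality as sets with equivalent norms. *)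

(* Defs.v *)
From HB Require Import structures.
From mathcomp Require Import all_boot all_order all_algebra.
From mathcomp Require Import all_classical all_reals all_analysis.
From mathcomp Require Import measurable_realfun ess_sup_inf.

Set Implicit Arguments.
Unset Strict Implicit.
Unset Printing Implicit Defensive.

Import Order.TTheory GRing.Theory Num.Theory.
Import numFieldNormedType.Exports.

Local Open Scope classical_set_scope.
Local Open Scope ring_scope.

Definition pos_itv (R : realType) : set R := `]0, +oo[.
Definition unit_itv (R : realType) : set R := `]0, 1[.
Arguments pos_itv {R}.
Arguments unit_itv {R}.

(* Functions on (0,oo) and on (0,1) are represented by functions on R whose
   values outside the interval are irrelevant. Measurable means Borel, which
   loses nothing since all the norms below only see classes modulo equality
   almost everywhere. *)

Definition mpos (R : realType) (f : R -> \bar R) : Prop :=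
  measurable_fun pos_itv f /\ (forall x, pos_itv x -> (0 <= f x)%E).

(* Banach function norms in the sense of Bennett and Sharpley (which include
   the Fatou property), over (0,oo) with Lebesgue measure, together with
   invariance under equimeasurability. The norm of E is its value on |f|. *)
Record is_ri_norm (R : realType) (N : (R -> \bar R) -> \bar R) : Prop := {
  ri_ge0 : forall f, mpos f -> (0 <= N f)%E;
  ri_eq0 : forall f, mpos f ->
    (N f = 0%E <->
     {ae lebesgue_measure, forall x : R, pos_itv x -> f x = 0%E});
  ri_scale : forall (a : R) f, 0 <= a -> mpos f ->
    N (fun x => a%:E * f x)%E = (a%:E * N f)%E;
  ri_triangle : forall f g, mpos f -> mpos g ->
    (N (fun x => f x + g x) <= N f + N g)%E;
  ri_le : forall f g, mpos f -> mpos g ->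
    {ae lebesgue_measure, forall x : R, pos_itv x -> (f x <= g x)%E} ->
    (N f <= N g)%E;
  ri_fatou : forall (f_ : nat -> R -> \bar R) f,
    (forall n, mpos (f_ n)) -> mpos f ->
    {ae lebesgue_measure, forall x : R, pos_itv x ->
       nondecreasing_seq (fun n => f_ n x) /\ f_ n x @[n --> \oo] --> f x} ->
    N (f_ n) @[n --> \oo] --> N f;
  ri_indic : forall A : set R, measurable A -> A `<=` pos_itv ->
    (lebesgue_measure A < +oo)%E -> (N (fun x => (\1_A x)%:E) < +oo)%E;
  ri_integral : forall A : set R, measurable A -> A `<=` pos_itv ->
    (lebesgue_measure A < +oo)%E ->
    exists2 C : R, 0 < C & forall f, mpos f ->
      (\int[lebesgue_measure]_(x in A) f x <= C%:E * N f)%E;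
  ri_equimeasurable : forall f g, mpos f -> mpos g ->
    (forall s : R, 0 <= s ->
       lebesgue_measure (pos_itv `&` [set x | (s%:E < f x)%E]) =
       lebesgue_measure (pos_itv `&` [set x | (s%:E < g x)%E])) ->
    N f = N g }.

Structure riSpace (R : realType) := RISpace {
  ri_norm :> (R -> \bar R) -> \bar R;
  ri_normP : is_ri_norm ri_norm }.

Definition fundamental (R : realType) (E : riSpace R) (s : R) : R :=
  fine (E (fun x => (\1_(`]0, s[ : set R) x)%:E)).

Definition Linf_norm (R : realType) (f : R -> \bar R) : \bar R :=
  Lnorm (mrestr lebesgue_measure (measurable_itv (`]0, +oo[ : interval R)))
    +oo%E f.

Section Linf.
Context {R : realType}.
Notation leb := (@lebesgue_measure R).
Let mD : measurable (pos_itv : set R) := measurable_itv (`]0, +oo[ : interval R).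
Let mu : {measure set (measurableTypeR R) -> \bar R} := mrestr leb mD.

Let aeS2 (P Q S : R -> Prop) : (forall x, P x -> Q x -> S x) ->
  {ae leb, forall x, P x} -> {ae leb, forall x, Q x} -> {ae leb, forall x, S x}.
Proof. exact: (@filterS2 _ _ (ae_filter_ringOfSetsType leb)). Qed.

Let aeS (P Q : R -> Prop) : (forall x, P x -> Q x) ->
  {ae leb, forall x, P x} -> {ae leb, forall x, Q x}.
Proof. exact: (@filterS _ _ (ae_filter_ringOfSetsType leb)). Qed.

Lemma ae_pos_itv (P : R -> Prop) :
  {ae mu, forall x, P x} <-> {ae leb, forall x, pos_itv x -> P x}.
Proof.
split=> -[N [mN N0 sN]].
- exists (N `&` pos_itv); split; first exact: measurableI.
    exact: N0.
  move=> x /= /not_implyP[px nP]; split => //; exact: sN.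
- exists (N `|` ~` pos_itv); split.
  + by apply: measurableU => //; exact: measurableC.
  + change (leb ((N `|` ~` pos_itv) `&` pos_itv) = 0%E).
    rewrite setIUl setICl setU0; apply/eqP.
    rewrite eq_le measure_ge0 andbT -[leRHS]N0.
    by apply: le_measure; rewrite ?inE//; exact: measurableI.
  + move=> x nP; have [px|] := pselect (pos_itv x); last by right.
    by left; apply: sN => /= h; apply: nP; exact: h.
Qed.

Lemma pos_itv_gt0 : (0 < mu setT)%E.
Proof.
change (0 < leb (setT `&` pos_itv))%E.
by rewrite setTI /pos_itv lebesgue_measure_itv /= ltry oppr0 adde0.
Qed.

Lemma Linf_normE f : Linf_norm f = ess_sup mu (abse \o f).
Proof. by rewrite /Linf_norm unlock pos_itv_gt0. Qed.

Lemma Linf_normP f y : mpos f ->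
  (Linf_norm f <= y)%E <-> {ae leb, forall x, pos_itv x -> (f x <= y)%E}.
Proof.
move=> [_ f0]; rewrite Linf_normE -ae_pos_itv.
have pos : {ae mu, forall x, pos_itv x} by apply/ae_pos_itv; exact: aeW.
split.
- move/ess_supP; move: pos; apply: (@filterS2 _ _ (ae_filter_ringOfSetsType mu)) => x px.
  by rewrite /= gee0_abs//; exact: f0.
- move=> h; apply/ess_supP; move: pos h; apply: (@filterS2 _ _ (ae_filter_ringOfSetsType mu)) => x px.
  by rewrite /= gee0_abs//; exact: f0.
Qed.

Lemma Linf_norm_ge f : mpos f ->
  {ae leb, forall x, pos_itv x -> (f x <= Linf_norm f)%E}.
Proof. by move=> mf; apply/Linf_normP. Qed.

Lemma Linf_norm_ge0 (f : R -> \bar R) : (0 <= Linf_norm f)%E.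
Proof. exact: Lnorm_ge0. Qed.

Lemma Linf_is_ri : is_ri_norm (@Linf_norm R).
Proof.
have le f g : mpos f -> mpos g ->
    {ae leb, forall x : R, pos_itv x -> (f x <= g x)%E} ->
    (Linf_norm f <= Linf_norm g)%E.
  move=> mf mg fg; apply/Linf_normP => //.
  move: fg (Linf_norm_ge mg); apply: aeS2 => x h1 h2 px.
  exact: le_trans (h1 px) (h2 px).
split => //.
- by move=> f _; exact: Linf_norm_ge0.
- move=> f mf; split=> [f0|f0].
  + move: (Linf_norm_ge mf); rewrite f0; apply: aeS => x h px.
    by apply/eqP; rewrite eq_le h//=; exact: mf.2.
  + apply/eqP; rewrite eq_le Linf_norm_ge0 andbT; apply/Linf_normP => //.
    by move: f0; apply: aeS => x h px; rewrite h.
- move=> a f a0 mf; rewrite !Linf_normE -ess_supZl//; last exact: pos_itv_gt0.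
  by apply: eq_ess_sup; apply: aeW => x; rewrite /= abseM/= ger0_norm.
- move=> f g mf mg; apply/Linf_normP.
    split; first exact: emeasurable_funD mf.1 mg.1.
    by move=> x px; apply: adde_ge0; [exact: mf.2|exact: mg.2].
  move: (Linf_norm_ge mf) (Linf_norm_ge mg); apply: aeS2 => x h1 h2 px.
  by apply: leeD; [exact: h1|exact: h2].
- move=> f_ f mf_ mf h.
  set u := fun n => Linf_norm (f_ n).
  have nu : nondecreasing_seq u.
    move=> m n mn; apply: le => //; move: h; apply: aeS => x h px.
    by have [+ _] := h px; apply.
  have cu := ereal_nondecreasing_cvgn nu.
  suff -> : Linf_norm f = ereal_sup (range u) by [].
  apply/eqP; rewrite eq_le; apply/andP; split.
  + apply/Linf_normP => //.
    have : {ae leb, forall x n, pos_itv x -> (f_ n x <= u n)%E}.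
      by apply/ae_foralln => n; exact: Linf_norm_ge.
    move: h; apply: aeS2 => x h1 h2 px.
    have [_ cf] := h1 px.
    rewrite -(cvg_lim _ cf)//; apply: lime_le; first by apply/cvg_ex; exists (f x).
    apply: nearW => n; apply: (le_trans (h2 n px)).
    by apply: ereal_sup_ubound; exists n.
  + apply: ge_ereal_sup => _ [n _ <-]; apply: le => //.
    move: h; apply: aeS => x h px; have [nf cf] := h px.
    rewrite -(cvg_lim _ cf)//; apply: lime_ge; first by apply/cvg_ex; exists (f x).
    by exists n => // m /= nm; exact: nf.
- move=> A mA _ _; apply: le_lt_trans (ltry 1).
  apply/Linf_normP.
    split; last by move=> x _; rewrite lee_fin.
    by apply/measurable_EFinP; exact: measurable_indic.
  by apply: aeW => x _; rewrite lee_fin indicE; case: (_ \in _).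
- move=> A mA Apos Aoo.
  have fA : leb A \is a fin_num by rewrite ge0_fin_numE.
  exists (fine (leb A) + 1) => [|f mf]; first by rewrite ltr_wpDl// fine_ge0.
  have [foo|foo] := eqVneq (Linf_norm f) +oo%E.
    by rewrite foo gt0_muley ?leey// lte_fin ltr_wpDl// fine_ge0.
  have ffin : Linf_norm f \is a fin_num.
    by rewrite ge0_fin_numE ?Linf_norm_ge0// ltey.
  have mfA : measurable_fun A f by apply: measurable_funS mf.1.
  apply: (@le_trans _ _ (\int[leb]_(x in A) cst (Linf_norm f) x)%E).
    apply: ae_ge0_le_integral => //.
    + by move=> x /Apos; exact: mf.2.
    + by move=> x _; exact: Linf_norm_ge0.
    + move: (Linf_norm_ge mf); apply: aeS => x h xA.
      by apply: h; exact: Apos.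
  rewrite integral_cst// muleC; apply: lee_wpmul2r; first exact: Linf_norm_ge0.
  by rewrite -[leLHS]fineK// lee_fin lerDl.
- move=> f g mf mg fg.
  have H f1 g1 : mpos f1 -> mpos g1 -> (forall s : R, 0 <= s ->
       leb (pos_itv `&` [set x | (s%:E < f1 x)%E]) =
       leb (pos_itv `&` [set x | (s%:E < g1 x)%E])) ->
      (Linf_norm f1 <= Linf_norm g1)%E.
    move=> mf1 mg1 e.
    have := Linf_norm_ge0 g1; have := Linf_norm_ge mg1.
    case: (Linf_norm g1) => [r|_ _|_ //]; last by rewrite leey.
    move=> h r0; apply/Linf_normP => //.
    exists (pos_itv `&` [set x | (r%:E < f1 x)%E]); split.
    + by apply: emeasurable_fun_o_infty => //; exact: mf1.1.
    + rewrite e//; case: h => N [mN N0 sN].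
      apply/eqP; rewrite eq_le measure_ge0 andbT -[leRHS]N0.
      apply: le_measure; rewrite ?inE//.
        by apply: emeasurable_fun_o_infty => //; exact: mg1.1.
      move=> x [px /=]; rewrite ltNge => /negP gr; apply: sN => /= k.
      exact/gr/k.
    + move=> x /= /not_implyP[px /negP]; rewrite -ltNge => hx.
      by split.
  by apply/eqP; rewrite eq_le !H// => s s0; rewrite fg.
Qed.

End Linf.

Definition Linf (R : realType) : riSpace R := RISpace (@Linf_is_ri R).

(* The non-increasing rearrangement of f on D with respect to m. *)
Definition rearr (R : realType) (m : set R -> \bar R) (D : set R)
    (f : R -> \bar R) (t : R) : \bar R :=
  ereal_inf [set s%:E | s in [set s : R | 0 <= s /\
    (m (D `&` [set x | (s%:E < `|f x|)%E]) <= t%:E)%E]].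

Definition dt_over_t (R : realType) (A : set R) : \bar R :=
  (\int[lebesgue_measure]_(x in A `&` pos_itv) (x^-1)%:E)%E.

Definition tilde_norm (R : realType) (E : riSpace R) (I : set R)
    (g : R -> \bar R) : \bar R :=
  E (rearr (@dt_over_t R) pos_itv (patch (cst 0%E) I g)).

Definition ell (R : realType) (t : R) : R := 1 + `|ln t|.

Definition ellp (R : realType) (sigma t : R) : R := ell t `^ sigma.

Definition equiv_on (R : realType) (I : set R) (f g : R -> R) : Prop :=
  exists2 C : R, 0 < C &
    forall t, I t -> C^-1 * g t <= f t /\ f t <= C * g t.

Definition SV (R : realType) (b : R -> R) : Prop :=
  [/\ (forall t, unit_itv t -> 0 < b t), measurable_fun unit_itv b &
      forall e : R, 0 < e ->
        (exists2 g : R -> R,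
           (forall x y, unit_itv x -> unit_itv y -> x <= y -> g x <= g y) &
           equiv_on unit_itv (fun t => t `^ e * b t) g) /\
        (exists2 h : R -> R,
           (forall x y, unit_itv x -> unit_itv y -> x <= y -> h y <= h x) &
           equiv_on unit_itv (fun t => t `^ (- e) * b t) h)].

Definition sv_ext (R : realType) (b : R -> R) (s : R) : R :=
  if s < 1 then b s else 1.

(* A space of real functions on (0,1); the norm may be infinite outside the
   carrier. *)
Record fspace (R : realType) := FSpace {
  carrier : set (R -> R);
  fnorm : (R -> R) -> \bar R }.

Definition space_of (R : realType) (N : (R -> R) -> \bar R) : fspace R :=
  FSpace [set f | measurable_fun unit_itv f /\ (N f < +oo)%E] N.

Definition fspaceI (R : realType) (X Y : fspace R) : fspace R :=
  FSpace (carrier X `&` carrier Y) (fun f => maxe (fnorm X f) (fnorm Y f)).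

(* Equality as sets with equivalent norms. *)
Definition same_space (R : realType) (X Y : fspace R) : Prop :=
  carrier X = carrier Y /\
  exists2 C : R, 0 < C & forall f, carrier X f ->
    (fnorm X f <= C%:E * fnorm Y f)%E /\ (fnorm Y f <= C%:E * fnorm X f)%E.

Definition Kfun (R : realType) (Y0 Y1 : fspace R) (t : R) (f : R -> R) :
    \bar R :=
  ereal_inf [set z | exists g0 g1 : R -> R,
    [/\ carrier Y0 g0, carrier Y1 g1,
        (forall x, unit_itv x -> f x = g0 x + g1 x) &
        z = (fnorm Y0 g0 + t%:E * fnorm Y1 g1)%E]].

Definition interp_norm (R : realType) (Y0 Y1 : fspace R) (theta : R)
    (b : R -> R) (E : riSpace R) (f : R -> R) : \bar R :=
  tilde_norm E unit_itv
    (fun t => (t `^ (- theta) * b t)%:E * Kfun Y0 Y1 t f)%E.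

Definition interp (R : realType) (Y0 Y1 : fspace R) (theta : R)
    (b : R -> R) (E : riSpace R) : fspace R :=
  FSpace [set f | carrier Y0 f /\
                  (interp_norm Y0 Y1 theta b E f < +oo)%E]
         (interp_norm Y0 Y1 theta b E).

Definition fstar (R : realType) (f : R -> R) (t : R) : \bar R :=
  rearr lebesgue_measure unit_itv (EFin \o f) t.

Definition fstarstar (R : realType) (f : R -> R) (t : R) : \bar R :=
  ((t^-1)%:E * \int[lebesgue_measure]_(s in `]0%R, t[) fstar f s)%E.

(* s |-> s^(1/p) a(s) f^*(s) *)
Definition wstar (R : realType) (p : R) (a : R -> R) (f : R -> R) (s : R) :
    \bar R :=
  ((s `^ p^-1 * a s)%:E * fstar f s)%E.

(* L_{p,b,E} *)
Definition Lspc (R : realType) (p : R) (b : R -> R) (E : riSpace R) :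
    fspace R :=
  space_of (fun f => tilde_norm E unit_itv (wstar p b f)).

(* L^L_{p,b,E,a,F} *)
Definition LspcL (R : realType) (p : R) (b : R -> R) (E : riSpace R)
    (a : R -> R) (F : riSpace R) : fspace R :=
  space_of (fun f => tilde_norm E unit_itv (fun t =>
    (b t)%:E * tilde_norm F `]0%R, t[ (wstar p a f))%E).

(* L^{L,L}_{p,c,E,b,F,a,G} *)
Definition LspcLL (R : realType) (p : R) (c : R -> R) (E : riSpace R)
    (b : R -> R) (F : riSpace R) (a : R -> R) (G : riSpace R) : fspace R :=
  space_of (fun f => tilde_norm E unit_itv (fun u =>
    (c u)%:E * tilde_norm F `]0%R, u[ (fun t =>
      (b t)%:E * tilde_norm G `]0%R, t[ (wstar p a f)))%E).

(* L^{L,R}_{p,c,E,b,F,a,G} *)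
Definition LspcLR (R : realType) (p : R) (c : R -> R) (E : riSpace R)
    (b : R -> R) (F : riSpace R) (a : R -> R) (G : riSpace R) : fspace R :=
  space_of (fun f => tilde_norm E unit_itv (fun u =>
    (c u)%:E * tilde_norm F `]u, 1%R[ (fun t =>
      (b t)%:E * tilde_norm G `]u, t[ (wstar p a f)))%E).

(* B_{p,alpha,E} *)
Definition Bspc (R : realType) (p alpha : R) (E : riSpace R) : fspace R :=
  space_of (fun f => tilde_norm E unit_itv (fun t =>
    ereal_sup [set ((s `^ p^-1 * ellp (alpha - 1) s)%:E * fstarstar f s)%E
              | s in `]0%R, t[])).

(* Main.v *)
Require Import Defs.
From HB Require Import structures.
From mathcomp Require Import all_boot all_order all_algebra.
From mathcomp Require Import all_classical all_reals all_analysis.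
From mathcomp Require Import measurable_realfun ess_sup_inf.
From mathcomp Require Import ring lra.

Set Implicit Arguments.
Unset Strict Implicit.
Unset Printing Implicit Defensive.

Import Order.TTheory GRing.Theory Num.Theory.
Import numFieldNormedType.Exports.

Local Open Scope classical_set_scope.
Local Open Scope ring_scope.

(** Write [x = - ln t] and [F x = f^*(expR (- x))]. In this variable the measure
    [dt/t] on [`]0, 1[] is Lebesgue measure on the half-line, so every norm of
    the statement becomes the norm of a function of [x] ([tilde_normE]), [F] is
    nondecreasing, and the weights [w0], [w1], with
    [w_i x = t^(1/p_i) ell^(a_i - 1)(t)], and the critical function [rho]
    behave like exponentials up to slowly varying factors ([regvar]). Because
    [p0], [p1 > 1], the norm of the B-spaces is unchanged, up to constants, if
    [f^**] is replaced with [f^*]: it is the norm of the function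
    [M_i x = sup_(z > x) w_i z * F z] ([Bspc_norm]).

    The core of the proof is a Holmstedt-type formula ([Kfun_le_model],
    [Kmodel_le_Kfun]): with [phi_i x] the fundamental function of [E_i] at
    [1 + x], the K-functional of [f] at [rho x] is equivalent to

      [E0 (1_(x,oo) M_0) + phi_0 x * M_0 x
         + rho x * E1 (y in (0,x) |-> sup_(y < z < x) w_1 z * F z)].

    The upper bound truncates [f] at the level [F x]. The lower bound splits
    the three terms along an arbitrary decomposition of [f]; the norms of its
    parts bound their weighted suprema pointwise ([wtail_embedding]). Both rely
    on the identity [rho * w_1 * phi_1 = w_0 * phi_0], which defines [rho].

    The interpolation norm involves the K-functional at [expR (- x)], not at
    [rho x]. But [- ln rho] is at bounded distance from a bi-Lipschitz
    bijection of the half-line, and composition with such a map changes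
    rearrangement invariant norms by a constant factor only
    ([ri_comp_expanding], [log_change_of_variable]). Hence the interpolation
    norm is equivalent to the norm in [E] of the model multiplied by
    [d = rho^(- theta) * b(rho)], a weight with the index
    [theta * (1/p0 - 1/p1)] ([interp_norm_equiv]).

    It remains to compare the three terms, called tail, middle and head, after
    multiplication by [d], with the core [d * phi_0 * w_0 * F]. Discrete Hardy
    inequalities show that the tail is dominated by the middle term and the
    latter by the core if [theta > 0] ([ri_tailpart_le], [ri_midpart_le]), and
    the head by the core if [theta < 1] ([ri_headpart_le]); conversely the core
    is always dominated by the middle term and by the head ([ri_core_mid],
    [ri_core_head]). So the interpolation norm is that of the core if
    [0 < theta < 1], of the tail and the middle term if [theta = 0], and of the
    head if [theta = 1]. These are the norms on the right-hand sides, once the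
    inner [L_oo] norms, which are essential suprema, are compared with suprema
    ([wsup_le_wesssup]). *)

(** * Functions on the half-line and rearrangements *)

Section prelim.
Context {R : realType}.
Notation leb := (@lebesgue_measure R).
Implicit Types (E : riSpace R) (f g : R -> \bar R).

Lemma measurable_pos_itv : measurable (pos_itv : set R).
Proof. exact: measurable_itv. Qed.

Lemma measurable_unit_itv : measurable (unit_itv : set R).
Proof. exact: measurable_itv. Qed.

Lemma pos_itvE (x : R) : pos_itv x = (0 < x).
Proof. by rewrite /pos_itv /= in_itv /= andbT. Qed.

Lemma unit_itvE (x : R) : unit_itv x = (0 < x < 1).
Proof. by rewrite /unit_itv /= in_itv. Qed.

Lemma measurable_fun_nondecreasing (D : set R) f : is_interval D ->
  (forall x y, D x -> D y -> x <= y -> (f x <= f y)%E) -> measurable_fun D f.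
Proof.
move=> iD ndf; apply: (measurability _ (ErealGenOInfty.measurableE R)).
move=> _ [_ [r ->] <-].
apply: is_interval_measurable => x y [Dx /= fx] [Dy /= fy] z /andP[xz zy].
have Dz : D z by apply: (iD x y) => //; rewrite xz zy.
split => //=; move: fx; rewrite !in_itv/= !andbT => fx.
exact: lt_le_trans fx (ndf _ _ _ _ _).
Qed.

Lemma measurable_fun_nonincreasing (D : set R) f : is_interval D ->
  (forall x y, D x -> D y -> x <= y -> (f y <= f x)%E) -> measurable_fun D f.
Proof.
move=> iD nif; apply: (eq_measurable_fun (fun x => - - f x)%E) => [x _|].
  exact: oppeK.
apply: measurableT_comp; first exact: oppe_measurable.
by apply: measurable_fun_nondecreasing => // x y Dx Dy xy; rewrite leeN2 nif.
Qed.

Lemma is_interval_pos_itv : is_interval (pos_itv : set R).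
Proof. exact: interval_is_interval. Qed.

Lemma mpos_nondecreasing f :
  (forall x y, 0 < x -> x <= y -> (f x <= f y)%E) ->
  (forall x, 0 < x -> (0 <= f x)%E) -> mpos f.
Proof.
move=> nf f0; split; last by move=> x; rewrite pos_itvE; exact: f0.
apply: measurable_fun_nondecreasing; first exact: is_interval_pos_itv.
by move=> x y; rewrite !pos_itvE => x0 _; exact: nf.
Qed.

Lemma mpos_nonincreasing f :
  (forall x y, 0 < x -> x <= y -> (f y <= f x)%E) ->
  (forall x, 0 < x -> (0 <= f x)%E) -> mpos f.
Proof.
move=> nf f0; split; last by move=> x; rewrite pos_itvE; exact: f0.
apply: measurable_fun_nonincreasing; first exact: is_interval_pos_itv.
by move=> x y; rewrite !pos_itvE => x0 _; exact: nf.
Qed.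

Lemma mpos_eq f g : mpos f -> (forall x, 0 < x -> g x = f x) -> mpos g.
Proof.
move=> [mf f0] gf; split; last by move=> x px; rewrite gf -?pos_itvE//; exact: f0.
by apply: eq_measurable_fun mf => x; rewrite inE pos_itvE => x0; rewrite gf.
Qed.

Lemma mposD f g : mpos f -> mpos g -> mpos (fun x => f x + g x)%E.
Proof.
move=> [mf f0] [mg g0]; split; first exact: emeasurable_funD.
by move=> x px; rewrite adde_ge0 ?f0 ?g0.
Qed.

Lemma mposM f g : mpos f -> mpos g -> mpos (fun x => f x * g x)%E.
Proof.
move=> [mf f0] [mg g0]; split; first exact: emeasurable_funM.
by move=> x px; rewrite mule_ge0 ?f0 ?g0.
Qed.

Lemma mpos_EFin (v : R -> R) : measurable_fun pos_itv v ->
  (forall x, 0 < x -> 0 <= v x) -> mpos (EFin \o v).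
Proof.
move=> mv v0; split; first exact/measurable_EFinP.
by move=> x; rewrite pos_itvE lee_fin; exact: v0.
Qed.

Lemma mposZ (c : R) f : 0 <= c -> mpos f -> mpos (fun x => c%:E * f x)%E.
Proof.
by move=> c0 mf; apply: mposM => //; apply: (@mpos_EFin (cst c)).
Qed.

Lemma mpos0 : mpos (fun=> 0%E : \bar R).
Proof. by split. Qed.

Definition cut (A : set R) f : R -> \bar R := fun x => if x \in A then f x else 0%E.

Lemma mpos_cut (A : set R) f : measurable A ->
  measurable_fun (pos_itv `&` A) f ->
  (forall x, 0 < x -> A x -> (0 <= f x)%E) -> mpos (cut A f).
Proof.
move=> mA mf f0; split; last first.
  move=> x; rewrite pos_itvE /cut => x0; case: ifPn => //.
  by rewrite inE => Ax; exact: f0.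
rewrite (_ : cut A f = f \_ A); last by apply/funext => x; rewrite /cut patchE.
by apply/measurable_restrict => //; exact: measurable_pos_itv.
Qed.

Lemma mpos_cutT (A : set R) f : measurable A -> mpos f -> mpos (cut A f).
Proof.
move=> mA [mf f0]; apply: mpos_cut => //.
  by apply: measurable_funS mf => //; exact: measurable_pos_itv.
by move=> x x0 _; apply: f0; rewrite pos_itvE.
Qed.

Lemma ri_le_pt E f g : mpos f -> mpos g ->
  (forall x, 0 < x -> (f x <= g x)%E) -> (E f <= E g)%E.
Proof.
move=> mf mg fg; apply: (ri_le (ri_normP E)) => //.
by apply: aeW => x; rewrite pos_itvE; exact: fg.
Qed.

Lemma ri_eq_pt E f g : mpos f ->
  (forall x, 0 < x -> f x = g x) -> E f = E g.
Proof.
move=> mf fg; have mg : mpos g by apply: mpos_eq mf _ => x x0; rewrite fg.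
by apply/eqP; rewrite eq_le !ri_le_pt// => x x0; rewrite fg.
Qed.

Lemma ri_le_scale E (C : R) f g : 0 <= C -> mpos f -> mpos g ->
  (forall x, 0 < x -> (f x <= C%:E * g x)%E) -> (E f <= C%:E * E g)%E.
Proof.
move=> C0 mf mg fg; rewrite -(ri_scale (ri_normP E))//.
by apply: ri_le_pt => //; exact: mposZ.
Qed.

Lemma ri0 E : E (fun=> 0%E) = 0%E.
Proof. by apply/(ri_eq0 (ri_normP E) mpos0); exact: aeW. Qed.

Lemma ri_nneg E f : mpos f -> (0 <= E f)%E.
Proof. exact: (ri_ge0 (ri_normP E)). Qed.

Lemma ri_normD E f g : mpos f -> mpos g ->
  (E (fun x => f x + g x) <= E f + E g)%E.
Proof. exact: (ri_triangle (ri_normP E)). Qed.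

Lemma mpos_nneseries (g_ : nat -> R -> \bar R) : (forall n, mpos (g_ n)) ->
  mpos (fun x => \sum_(0 <= n <oo) g_ n x)%E.
Proof.
move=> mg; split; last by move=> x px; apply: nneseries_ge0 => n _ _; exact: (mg n).2.
apply: (ge0_emeasurable_sum (P := xpredT)).
  by move=> k x px _; exact: (mg k).2.
by move=> k _; exact: (mg k).1.
Qed.

(** The partial sums increase, so the Fatou property passes from finite to
    countable subadditivity. *)
Lemma ri_nneseries E (g_ : nat -> R -> \bar R) : (forall n, mpos (g_ n)) ->
  (E (fun x => \sum_(0 <= n <oo) g_ n x) <= \sum_(0 <= n <oo) E (g_ n))%E.
Proof.
move=> mg; pose S n x := (\sum_(0 <= k < n) g_ k x)%E.
have mS n : mpos (S n).
  elim: n => [|n IH].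
    by apply: mpos_eq mpos0 _ => x _; rewrite /S big_nil.
  apply: mpos_eq (mposD IH (mg n)) _ => x _.
  by rewrite /S big_nat_recr.
have cS : E (S n) @[n --> \oo] --> E (fun x => \sum_(0 <= n <oo) g_ n x)%E.
  apply: (ri_fatou (ri_normP E)) => //; first exact: mpos_nneseries.
  apply: aeW => x px; split.
    apply/nondecreasing_seqP => n.
    rewrite /S big_nat_recr//= leeDl//; exact: (mg n).2.
  by apply: is_cvg_nneseries => n _ _; exact: (mg n).2.
rewrite -(cvg_lim _ cS)//; apply: lime_le; first by apply/cvg_ex; eexists; exact: cS.
apply: nearW => n.
apply: (@le_trans _ _ (\sum_(0 <= k < n) E (g_ k))%E).
  elim: n => [|n IH].
    rewrite big_nil (_ : S 0%N = fun=> 0%E) ?ri0//.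
    by apply/funext => x; rewrite /S big_nil.
  rewrite big_nat_recr//= (_ : S n.+1 = fun x => (S n x + g_ n x)%E); last first.
    by apply/funext => x; rewrite /S big_nat_recr.
  by apply: le_trans (ri_normD _ _ _) _ => //; rewrite leeD2r.
by apply: nneseries_lim_ge => k _ _; exact: ri_nneg.
Qed.

End prelim.

Section rearrangement.
Context {R : realType}.
Notation leb := (@lebesgue_measure R).
Implicit Types (E : riSpace R) (f g : R -> \bar R).

(** The infimum defining the rearrangement behaves as an inverse of the
    distribution function because the latter is right-continuous. *)
Lemma lt_rearr (m : set R -> \bar R)
    (mu : {measure set (measurableTypeR R) -> \bar R})
    (D : set R) f (s t : R) :
  (forall A, measurable A -> m (D `&` A) = mu (D `&` A)) -> measurable D ->
  measurable_fun D f -> 0 <= s ->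
  (s%:E < rearr m D f t)%E <->
  (t%:E < m (D `&` [set x | (s%:E < `|f x|)%E]))%E.
Proof.
move=> mmu mD mf s0; pose L r := D `&` [set x | (r%:E < `|f x|)%E].
have mfa : measurable_fun D (fun x => `|f x|)%E by exact: measurableT_comp.
have mL r : measurable (L r) by apply: emeasurable_fun_o_infty.
have mE r : m (L r) = mu (L r).
  have -> : L r = D `&` L r by rewrite /L setIA setIid.
  exact: mmu.
split.
- apply: contraPT; rewrite -leNgt => h; apply/negP; rewrite -leNgt.
  by apply: ereal_inf_lbound => /=; exists s.
- rewrite -/(L s) mE => h.
  have [n hn] : exists n : nat, (t%:E < mu (L (s + n.+1%:R^-1)%R))%E.
    have cv : (mu \o (fun n : nat => L (s + n.+1%:R^-1)%R)) @ \oo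
        --> mu (\bigcup_n L (s + n.+1%:R^-1)%R).
      have mU : measurable (\bigcup_n L (s + n.+1%:R^-1)%R).
        by apply: bigcupT_measurable => n; exact: mL.
      apply: (@nondecreasing_cvg_mu _ (measurableTypeR R) R mu
        (fun n => L (s + n.+1%:R^-1)%R)) => // [n|]; first exact: mL.
      move=> i j ij; apply/subsetPset => x [Dx /= hx]; split => //=.
      apply: le_lt_trans hx; rewrite lee_fin lerD2l lef_pV2 ?posrE//.
      by rewrite ler_nat ltnS.
    have eL : \bigcup_n L (s + n.+1%:R^-1) = L s.
      apply/seteqP; split=> x.
        move=> [n _ [Dx /= hx]]; split => //=; apply: lt_trans hx.
        by rewrite lte_fin ltrDl.
      move=> [Dx /= hx]; case fx : `|f x|%E hx => [r| |//] hx.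
      + have [n hn] := @ltr_add_invr R s r hx.
        by exists n => //; split => //=; rewrite fx lte_fin.
      + by exists 0%N => //; split => //=; rewrite fx ltry.
    rewrite eL in cv.
    apply: contrapT => /forallNP hn; move: h; apply/negP.
    rewrite -leNgt -(cvg_lim _ cv)//; apply: lime_le.
      by apply/cvg_ex; exists (mu (L s)).
    by apply: nearW => n /=; rewrite leNgt; exact/negP/hn.
  apply: (@lt_le_trans _ _ (s + n.+1%:R^-1)%:E); first by rewrite lte_fin ltrDl.
  apply: le_ereal_inf_tmp => _ [r [r0 hr] <-]; rewrite lee_fin leNgt.
  apply/negP => rs; move: hr; apply/negP; rewrite -ltNge.
  apply: (lt_le_trans hn); rewrite -/(L r) mE.
  apply: le_measure; rewrite ?inE; [exact: mL|exact: mL|].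
  by move=> x [Dx /= hx]; split => //=; apply: lt_trans hx; rewrite lte_fin.
Qed.

Lemma rearr_ge0 (m : set R -> \bar R) (D : set R) f (t : R) :
  (0 <= rearr m D f t)%E.
Proof. by apply: le_ereal_inf_tmp => _ [s [s0 _] <-]; rewrite lee_fin. Qed.

Lemma rearr_nonincreasing (m : set R -> \bar R) (D : set R) f (t u : R) :
  t <= u -> (rearr m D f u <= rearr m D f t)%E.
Proof.
move=> tu; apply: ereal_inf_le_tmp => _ [s [s0 h] <-]; exists s => //; split => //.
by apply: le_trans h _; rewrite lee_fin.
Qed.

Lemma mpos_rearr (m : set R -> \bar R) (D : set R) f : mpos (rearr m D f).
Proof.
by apply: mpos_nonincreasing => [x y _|x _]; [exact: rearr_nonincreasing|exact: rearr_ge0].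
Qed.

Lemma leb_initial (d : \bar R) : (0 <= d)%E ->
  leb (pos_itv `&` [set x | (x%:E < d)%E]) = d.
Proof.
case: d => [r| |//].
- rewrite lee_fin le_eqVlt => /orP[/eqP <-|r0].
    rewrite (_ : _ `&` _ = set0) ?measure0//; apply/seteqP; split=> x //.
    by move=> []; rewrite pos_itvE /= lte_fin => x0 /(lt_trans x0); rewrite ltxx.
  rewrite (_ : _ `&` _ = `]0, r[%classic).
    by rewrite lebesgue_measure_itv/= lte_fin r0 oppr0 adde0.
  apply/seteqP; split=> x; rewrite /pos_itv /= !in_itv/= lte_fin andbT.
    by move=> [-> ->].
  by move=> /andP[].
- move=> _; rewrite (_ : _ `&` _ = `]0, +oo[%classic).
    by rewrite lebesgue_measure_itv/= ltry oppr0 adde0.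
  by apply/seteqP; split=> x /= => [[]//|px]; split => //; rewrite ltry.
Qed.

Lemma ge0_level f (s : R) : (forall x : R, pos_itv x -> (0 <= f x)%E) ->
  pos_itv `&` [set x | (s%:E < `|f x|)%E] = pos_itv `&` [set x | (s%:E < f x)%E].
Proof.
by move=> f0; apply/seteqP; split=> x [px /=]; rewrite gee0_abs ?f0.
Qed.

Definition dist f (s : R) : \bar R := leb (pos_itv `&` [set x | (s%:E < f x)%E]).

(** Whatever the measure [m], the rearrangement lives on the half-line with
    Lebesgue measure and has the same distribution as [f]. *)
Lemma dist_rearr (m : set R -> \bar R)
    (mu : {measure set (measurableTypeR R) -> \bar R})
    (D : set R) f (s : R) :
  (forall A, measurable A -> m (D `&` A) = mu (D `&` A)) -> measurable D ->
  measurable_fun D f -> 0 <= s ->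
  dist (rearr m D f) s = m (D `&` [set x | (s%:E < `|f x|)%E]).
Proof.
move=> mmu mD mf s0; rewrite /dist.
rewrite (_ : [set x | _] = [set x : R | (x%:E <
    m (D `&` [set x | (s%:E < `|f x|)%E]))%E]).
  rewrite leb_initial//.
  have mL : measurable (D `&` [set x | (s%:E < `|f x|)%E]).
    by apply: emeasurable_fun_o_infty => //; exact: measurableT_comp.
  have -> : D `&` [set x | (s%:E < `|f x|)%E] =
            D `&` (D `&` [set x | (s%:E < `|f x|)%E]) by rewrite setIA setIid.
  by rewrite mmu.
by apply/seteqP; split=> x /=; move/(lt_rearr _ mmu mD mf s0).
Qed.

Definition frearr f : R -> \bar R := rearr leb pos_itv f.

Lemma lt_frearr f (s t : R) : mpos f -> 0 <= s ->
  (s%:E < frearr f t)%E <-> (t%:E < dist f s)%E.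
Proof.
move=> [mf f0] s0; rewrite /dist -(ge0_level _ f0).
by apply: (@lt_rearr _ leb) => //; exact: measurable_pos_itv.
Qed.

Lemma dist_frearr f (s : R) : mpos f -> 0 <= s -> dist (frearr f) s = dist f s.
Proof.
move=> [mf f0] s0; rewrite [RHS]/dist -(ge0_level _ f0).
by apply: (@dist_rearr _ leb) => //; exact: measurable_pos_itv.
Qed.

Lemma ri_frearr E f : mpos f -> E (frearr f) = E f.
Proof.
move=> mf; apply: (ri_equimeasurable (ri_normP E)) => //; first exact: mpos_rearr.
by move=> s s0; exact: dist_frearr.
Qed.

(** Both functions may be replaced with their rearrangements, which are
    ordered pointwise when the distribution functions are. *)
Lemma ri_le_dist E f g : mpos f -> mpos g ->
  (forall s, 0 <= s -> (dist f s <= dist g s)%E) -> (E f <= E g)%E.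
Proof.
move=> mf mg fg; rewrite -(ri_frearr _ mf) -(ri_frearr _ mg).
apply: ri_le_pt => [||x x0]; [exact: mpos_rearr|exact: mpos_rearr|].
rewrite leNgt; apply/negP => h.
have [s [s0 h1 h2]] : exists s : R,
    [/\ 0 <= s, (frearr g x <= s%:E)%E & (s%:E < frearr f x)%E].
  have := rearr_ge0 leb pos_itv g x; rewrite -/(frearr g x).
  case: (frearr g x) h => [s h s0| |//]; first by exists s; split.
  by rewrite ltNge leey.
move: h2; rewrite lt_frearr// => h2.
have : (s%:E < frearr g x)%E by rewrite lt_frearr//; apply: lt_le_trans h2 (fg s s0).
by rewrite ltNge h1.
Qed.

End rearrangement.

(** * Dilations, translations and changes of variable *)

Section lebesgue_facts.
Context {R : realType}.
Notation leb := (@lebesgue_measure R).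
Implicit Types (E : riSpace R) (f g : R -> \bar R).

Lemma lebesgue_measure_shift (a : R) (A : set R) : measurable A ->
  leb [set x | A (x + a)] = leb A.
Proof.
move=> mA; pose sh : measurableTypeR R -> measurableTypeR R := fun x => x + a.
have msh : measurable_fun setT sh.
  by apply: measurable_funD => //; exact: measurable_cst.
rewrite -[LHS]/(pushforward leb sh A).
apply/esym/lebesgue_measure_unique => // X [[u v]] _ <-.
rewrite -[RHS]/(leb (sh @^-1` `]u, v])).
rewrite (_ : sh @^-1` _ = `]u - a, v - a]%classic); last first.
  by apply/seteqP; split=> x /=; rewrite !in_itv/= /sh ltrBlDr lerBrDr.
rewrite /= !lebesgue_measure_itv/= !lte_fin ltrD2r.
by case: ifP => // _; rewrite -!EFinB; congr EFin; ring.
Qed.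

(** Lebesgue measure is by construction an outer measure, hence monotone and
    countably subadditive on arbitrary sets. *)
Lemma lebesgue_measure_le (A B : set R) : A `<=` B -> (leb A <= leb B)%E.
Proof. exact: (le_outer_measure (wlength idfun)^*%mu). Qed.

Lemma lebesgue_measure_bigcup_le (F : nat -> set R) :
  (leb (\bigcup_n F n) <= \sum_(0 <= n <oo) leb (F n))%E.
Proof.
exact: (outer_measure_sigma_subadditive (wlength idfun)^*%mu).
Qed.

(** A map that does not contract distances by more than a factor [c] has
    preimages that are not much larger than the original sets: the preimage
    of an interval has a controlled diameter. *)
Lemma lebesgue_preimage_expanding (c : R) (psi : R -> R) (A : set R) : 0 < c ->
  (forall x y, 0 < x -> 0 < y -> c * `|x - y| <= `|psi x - psi y|) ->
  (leb (pos_itv `&` psi @^-1` A) <= (2 / c)%:E * leb A)%E.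
Proof.
move=> c0 hpsi.
have hc : 0 < 2 / c by rewrite divr_gt0.
have itv_case (I : set R) : is_open_itv I ->
    (leb (pos_itv `&` psi @^-1` I) <= (2 / c)%:E * wlength idfun I)%E.
  move=> [[a b] ->].
  have [[x [x0 Ix]]|/set0P/negP/negPn/eqP ->] :=
    pselect ((pos_itv `&` psi @^-1` `]a, b[) !=set0); last first.
    by rewrite measure0 mule_ge0// ?wlength_ge0// lee_fin ltW.
  rewrite wlength_itv/= lte_fin; move: Ix x0; rewrite /= in_itv/= pos_itvE.
  move=> /andP[ax xb] x0; rewrite (lt_trans ax xb).
  apply: (@le_trans _ _ (leb `[x - (b - a) / c, x + (b - a) / c])).
    apply: lebesgue_measure_le => y [y0 /=]; rewrite !in_itv/= => /andP[ay yb].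
    rewrite -ler_distlC ler_pdivlMr// mulrC.
    rewrite pos_itvE in y0.
    apply: le_trans (hpsi _ _ x0 y0) _; rewrite ler_norml; apply/andP; split; lra.
  rewrite lebesgue_measure_itv/= lte_fin; case: ifP => _; last first.
    by rewrite -EFinB -EFinM lee_fin mulr_ge0 ?ltW// subr_gt0 (lt_trans ax xb).
  rewrite -!EFinB -EFinM lee_fin le_eqVlt; apply/orP; left; apply/eqP.
  by ring.
rewrite -[leb A]/((wlength idfun)^*%mu A) outer_measure_open_itv_cover.
rewrite -lee_pdivrMl//; apply: le_ereal_inf_tmp => _ [F [Fo AF] <-].
rewrite lee_pdivrMl//.
apply: (@le_trans _ _ (leb (\bigcup_n (pos_itv `&` psi @^-1` (F n))))).
  by apply: lebesgue_measure_le => x [x0 /AF[n _ Fn]]; exists n.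
apply: le_trans (lebesgue_measure_bigcup_le _) _.
rewrite -nneseriesZl; last by move=> n _; exact: wlength_ge0.
by apply: lee_nneseries => // n _; exact: itv_case.
Qed.

End lebesgue_facts.

Section dilation.
Context {R : realType}.
Notation leb := (@lebesgue_measure R).
Implicit Types (E : riSpace R) (f g : R -> \bar R).

Definition stripes0 (h : R) : set R :=
  \bigcup_n [set` `[(n.*2)%:R * h, (n.*2.+1)%:R * h[ ].
Definition stripes1 (h : R) : set R :=
  \bigcup_n [set` `[(n.*2.+1)%:R * h, (n.*2.+2)%:R * h[ ].

Lemma measurable_stripes0 h : measurable (stripes0 h).
Proof. by apply: bigcupT_measurable => n; exact: measurable_itv. Qed.

Lemma measurable_stripes1 h : measurable (stripes1 h).
Proof. by apply: bigcupT_measurable => n; exact: measurable_itv. Qed.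

Lemma stripesU h x : 0 < h -> 0 < x -> stripes0 h x \/ stripes1 h x.
Proof.
move=> h0 x0; have := @truncn_itv R (x / h) (ltW (divr_gt0 x0 h0)).
move: (Num.Def.trunc _) => n; rewrite ler_pdivlMr// ltr_pdivrMr//.
have := odd_double_half n; move: (n./2) => m; case: (odd n) => /= <- nx.
- by right; exists m => //=; rewrite in_itv/= -add1n.
- by left; exists m => //=; rewrite in_itv/=.
Qed.

Lemma stripes_disj h : 0 < h -> stripes0 h `&` stripes1 h = set0.
Proof.
move=> h0; apply/seteqP; split=> x // -[[n _ /=] + [m _ /=]].
rewrite !in_itv/= => /andP[a1 a2] /andP[b1 b2].
have : (n.*2)%:R * h < (m.*2.+2)%:R * h by exact: le_lt_trans b2.
rewrite ltr_pM2r// ltr_nat -doubleS ltn_double ltnS => nm.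
have : (m.*2.+1)%:R * h < (n.*2.+1)%:R * h by exact: le_lt_trans a2.
by rewrite ltr_pM2r// ltr_nat ltnS ltn_double ltnNge nm.
Qed.

(** Every stripe of [stripes1] is the translate by [h] of a stripe of
    [stripes0] nearer to the origin, so that [stripes1] occupies no more of
    [`[0, 2 * d[] than [stripes0] does. *)
Lemma stripes_half (h d : R) : 0 < h -> 0 <= d ->
  (leb (stripes1 h `&` `[0%R, (2 * d)%R[) <= d%:E)%E.
Proof.
move=> h0 d0.
set I := `[0, 2 * d[%classic.
have mI : measurable I by exact: measurable_itv.
have sh : (leb (stripes1 h `&` I) <= leb (stripes0 h `&` I))%E.
  rewrite -[leRHS](@lebesgue_measure_shift _ (- h)); last first.
    by apply: measurableI => //; exact: measurable_stripes0.
  apply: lebesgue_measure_le => x [[n _ /=]]; rewrite /I /= !in_itv/=.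
  move=> /andP[n1 n2] /andP[x1 x2]; split.
    exists n => //=; rewrite in_itv/=; move: n1 n2; rewrite -!natr1 => n1 n2.
    by apply/andP; split; lra.
  apply/andP; split; last by lra.
  rewrite subr_ge0 (le_trans _ n1)//; apply: ler_peMl; [exact: ltW|by rewrite ler1n].
have IE : leb I = (2 * d)%:E.
  rewrite lebesgue_measure_itv/= lte_fin; case: ltP => [_|].
    by rewrite oppr0 adde0.
  by rewrite pmulr_rle0// => d0'; rewrite (_ : d = 0) ?mulr0//; lra.
have add : (leb (stripes1 h `&` I) + leb (stripes0 h `&` I) <= (2 * d)%:E)%E.
  rewrite -IE -measureU; first last.
  - by rewrite setIACA [X in X `&` _]setIC stripes_disj// set0I.
  - by apply: measurableI => //; exact: measurable_stripes0.
  - by apply: measurableI => //; exact: measurable_stripes1.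
  by apply: lebesgue_measure_le => x [[]|[]].
have : (leb (stripes1 h `&` I) + leb (stripes1 h `&` I) <= (2 * d)%:E)%E.
  by apply: le_trans add; rewrite leeD2l.
case: (leb (stripes1 h `&` I)) => [r| |]; rewrite ?leNye//.
by rewrite -EFinD !lee_fin => rr; lra.
Qed.

(** A translation by [- h] maps [stripes0], deprived of its first stripe,
    into [stripes1]. *)
Lemma stripes_half0 (h d : R) : 0 < h -> 0 <= d ->
  (leb (stripes0 h `&` `[h, (2 * d)%R[) <= d%:E)%E.
Proof.
move=> h0 d0; apply: le_trans (stripes_half h0 d0).
rewrite -[leRHS](@lebesgue_measure_shift _ (- h)); last first.
  by apply: measurableI; [exact: measurable_stripes1|exact: measurable_itv].
apply: lebesgue_measure_le => x [[[|n] _ /=]]; rewrite !in_itv/=.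
  by move=> /andP[_ xh] /andP[hx _]; move: xh; rewrite mul1r ltNge hx.
move=> /andP[n1 n2] /andP[x1 x2]; split; last first.
  by apply/andP; split; lra.
exists n => //=; rewrite in_itv/=.
move: n1 n2; rewrite doubleS -!natr1 => n1 n2; apply/andP; split; lra.
Qed.

(** Stretching the rearrangement of [g] by 2 rather than [g] itself makes the
    superlevel sets initial intervals; the distribution function doubles. *)
Definition dilate g : R -> \bar R := fun x => frearr g (x / 2).

Lemma mpos_dilate g : mpos (dilate g).
Proof.
apply: mpos_nonincreasing => [x y _ xy|x _]; last exact: rearr_ge0.
by apply: rearr_nonincreasing; rewrite ler_pM2r ?invr_gt0.
Qed.

Lemma lt_dilate g (s x : R) : mpos g -> 0 <= s ->
  (s%:E < dilate g x)%E <-> (x%:E < 2%:E * dist g s)%E.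
Proof.
move=> mg s0; rewrite (lt_frearr _ mg s0).
by rewrite mulrC EFinM lte_pdivrMl.
Qed.

Lemma dist_ge0 g s : (0 <= dist g s)%E.
Proof. exact: outer_measure_ge0 (wlength idfun)^*%mu _. Qed.

Lemma dist_dilate g (s : R) : mpos g -> 0 <= s ->
  dist (dilate g) s = (2%:E * dist g s)%E.
Proof.
move=> mg s0; rewrite /dist.
rewrite -[RHS]leb_initial; last by rewrite mule_ge0// dist_ge0.
by congr (leb (_ `&` _)); apply/seteqP; split=> x /=; rewrite lt_dilate.
Qed.

(** The half-line is cut into alternating stripes of width [h]. Away from
    [`]0, h[], each family of stripes occupies at most half of every initial
    interval, so the restriction of [dilate g] to it is dominated in
    distribution by [g]; letting [h] tend to 0 gives the factor 2. *)
Lemma ri_dilate E g : mpos g -> (E (dilate g) <= 2%:E * E g)%E.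
Proof.
move=> mg.
have mD := mpos_dilate g.
have half (A : set R) : measurable A ->
    (forall d, 0 <= d -> (leb (A `&` `]0%R, (2 * d)%R[) <= d%:E)%E) ->
    (E (cut A (dilate g)) <= E g)%E.
  move=> mA hA; apply: ri_le_dist => //; first exact: mpos_cutT.
  move=> s s0; case dE : (dist g s) => [d| |]; last 2 first.
  - by rewrite leey.
  - by have := dist_ge0 g s; rewrite dE.
  have d0 : 0 <= d by rewrite -lee_fin -dE dist_ge0.
  apply: le_trans (hA _ d0); apply: lebesgue_measure_le => x [].
  rewrite pos_itvE /cut /= => x0; case: ifPn => [|_]; last by rewrite lte_fin ltNge s0.
  rewrite inE => Ax /(lt_dilate _ mg s0); rewrite dE -EFinM lte_fin => xd.
  by split => //=; rewrite in_itv/= x0.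
have main (h : R) : 0 < h -> (E (cut `[h, +oo[ (dilate g)) <= 2%:E * E g)%E.
  move=> h0.
  have m0 : measurable (stripes0 h `&` `[h, +oo[).
    by apply: measurableI; [exact: measurable_stripes0|exact: measurable_itv].
  apply: (@le_trans _ _ (E (fun x => cut (stripes1 h) (dilate g) x +
       cut (stripes0 h `&` `[h, +oo[) (dilate g) x)))%E.
    apply: ri_le_pt.
    - by apply: mpos_cutT => //; exact: measurable_itv.
    - by apply: mposD; apply: mpos_cutT => //; exact: measurable_stripes1.
    - move=> x x0; rewrite /cut; have dx0 : (0 <= dilate g x)%E by exact: rearr_ge0.
      case: ifPn => [|_]; last by rewrite adde_ge0//; case: ifP.
      rewrite inE => hx; have [sx|sx] := stripesU h0 x0.
        rewrite [X in (_ + X)%E](_ : _ = dilate g x) ?leeDr//; first by case: ifP.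
        by rewrite mem_set.
      by rewrite (mem_set sx) leeDl//; case: ifP.
  apply: le_trans (ri_normD _ _ _) _.
  - by apply: mpos_cutT => //; exact: measurable_stripes1.
  - exact: mpos_cutT.
  rewrite (_ : 2%:E = 1 + 1)%E// ge0_muleDl// !mul1e leeD//;
    apply: half => //; first exact: measurable_stripes1.
  - move=> d d0; apply: le_trans (stripes_half h0 d0);
    apply: lebesgue_measure_le => x [sx /=].
    by rewrite in_itv/= => /andP[x0 xd]; split => //; rewrite in_itv/= (ltW x0).
  - move=> d d0; apply: le_trans (stripes_half0 h0 d0).
    apply: lebesgue_measure_le => x [[sx /=]]; rewrite !in_itv/= andbT => hx.
    by move=> /andP[x0 xd]; split => //; rewrite hx.
have cv : E (cut `[n.+1%:R^-1, +oo[ (dilate g)) @[n --> \oo] --> E (dilate g).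
  apply: (ri_fatou (ri_normP E)) => //.
    by move=> n; apply: mpos_cutT => //; exact: measurable_itv.
  apply: aeW => x; rewrite pos_itvE => x0; split.
    move=> n m nm; rewrite /cut; case: ifPn; last by case: ifP; rewrite ?rearr_ge0.
    rewrite inE /= in_itv/= andbT => nx; rewrite mem_set//= in_itv/= andbT.
    by apply: le_trans nx; rewrite lef_pV2 ?posrE// ler_nat ltnS.
  apply: cvg_near_cst.
  have [k] := @ltr_add_invr R 0 x x0; rewrite add0r => kx.
  exists k => // n /= kn; rewrite /cut mem_set//= in_itv/= andbT (le_trans _ (ltW kx))//.
  by rewrite lef_pV2 ?posrE// ler_nat ltnS.
rewrite -(cvg_lim _ cv)//; apply: lime_le; first by apply/cvg_ex; eexists; exact: cv.
by apply: nearW => n; apply: main.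
Qed.

(** Each dilation of [g] absorbs a factor 2 in front of its distribution
    function. *)
Lemma ri_le_dist_pow2 E n f g : mpos f -> mpos g ->
  (forall s, 0 <= s -> (dist f s <= (2 ^+ n)%:E * dist g s)%E) ->
  (E f <= (2 ^+ n)%:E * E g)%E.
Proof.
elim: n g => [|n IH] g mf mg fg.
  rewrite expr0 mul1e; apply: ri_le_dist => // s s0.
  by have := fg s s0; rewrite expr0 mul1e.
apply: (@le_trans _ _ ((2 ^+ n)%:E * E (dilate g))%E).
  apply: IH => //; first exact: mpos_dilate.
  by move=> s s0; rewrite dist_dilate// muleA -EFinM -exprSr fg.
rewrite [in leRHS]exprSr EFinM -muleA lee_wpmul2l ?lee_fin ?exprn_ge0//.
exact: ri_dilate.
Qed.

Lemma ri_le_dist_scale (c : R) : 0 < c -> exists2 C : R, 0 < C &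
  forall E f g, mpos f -> mpos g ->
  (forall s, 0 <= s -> (dist f s <= c%:E * dist g s)%E) ->
  (E f <= C%:E * E g)%E.
Proof.
move=> c0; pose n := (Num.Def.trunc c).+1.
exists (2 ^+ n) => [|E f g mf mg fg]; first by rewrite exprn_gt0.
apply: ri_le_dist_pow2 => // s s0; apply: le_trans (fg s s0) _.
rewrite lee_wpmul2r ?dist_ge0// lee_fin.
have /andP[_ /ltW cn] := truncn_itv (ltW c0); apply: (le_trans cn).
by rewrite -/n -natrX ler_nat ltnW// ltn_expl.
Qed.

Lemma ri_shift_left E (a : R) g : 0 <= a -> mpos g -> mpos (fun x => g (x + a)%R) ->
  (E (fun x => g (x + a)%R) <= E g)%E.
Proof.
move=> a0 mg mga; apply: ri_le_dist => // s s0; rewrite /dist.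
rewrite -[leRHS](@lebesgue_measure_shift _ a).
  apply: lebesgue_measure_le => x []; rewrite pos_itvE => x0 /= gs.
  by split => //; rewrite pos_itvE ltr_wpDr.
by apply: emeasurable_fun_o_infty; [exact: measurable_pos_itv|exact: mg.1].
Qed.

Lemma ri_shift_right E (a : R) g : mpos g ->
  mpos (cut `]a, +oo[ (fun x => g (x - a)%R)) ->
  (E (cut `]a, +oo[ (fun x => g (x - a)%R)) <= E g)%E.
Proof.
move=> mg mga; apply: ri_le_dist => // s s0; rewrite /dist.
rewrite -[leRHS](@lebesgue_measure_shift _ (- a)).
  apply: lebesgue_measure_le => x []; rewrite pos_itvE => x0 /=; rewrite /cut.
  case: ifPn => [|_]; last by rewrite lte_fin ltNge s0.
  by rewrite inE /= in_itv/= andbT => ax gs; split => //; rewrite pos_itvE subr_gt0.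
by apply: emeasurable_fun_o_infty; [exact: measurable_pos_itv|exact: mg.1].
Qed.

(** The superlevel sets of [g \o psi] are preimages of those of [g], whose
    measure is controlled by [lebesgue_preimage_expanding]. *)
Lemma ri_comp_expanding (c : R) : 0 < c -> exists2 C : R, 0 < C &
  forall E (psi : R -> R) g, mpos g -> mpos (g \o psi) ->
  (forall x, 0 < x -> 0 < psi x) ->
  (forall x y, 0 < x -> 0 < y -> c * `|x - y| <= `|psi x - psi y|) ->
  (E (g \o psi) <= C%:E * E g)%E.
Proof.
move=> c0; have [C C0 hC] := @ri_le_dist_scale (2 / c) (divr_gt0 (ltr0Sn _ 1) c0).
exists C => // E psi g mg mgp psi0 hpsi; apply: hC => // s s0.
apply: le_trans (lebesgue_preimage_expanding _ c0 hpsi).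
apply: lebesgue_measure_le => x [px /= gs]; split => //=; split => //.
by rewrite pos_itvE psi0 -?pos_itvE.
Qed.

End dilation.

(** * The logarithmic variable *)

Section haar_measure.
Context {R : realType}.
Notation leb := (@lebesgue_measure R).
Implicit Types (E : riSpace R) (f g : R -> \bar R) (A : set R).

Lemma mpos_invr : mpos (fun x : R => (x^-1)%:E).
Proof.
apply: mpos_nonincreasing => [x y x0 xy|x x0]; rewrite lee_fin.
  by rewrite lef_pV2 ?posrE// (lt_le_trans x0 xy).
by rewrite invr_ge0 ltW.
Qed.

Lemma dt_over_t0 : @dt_over_t R set0 = 0%E.
Proof. by rewrite /dt_over_t set0I integral_set0. Qed.

Lemma dt_over_t_ge0 A : (0 <= dt_over_t A)%E.
Proof. by apply: integral_ge0 => x [_]; exact: mpos_invr.2. Qed.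

Lemma dt_over_t_sigma_additive :
  semi_sigma_additive (@dt_over_t R : set (measurableTypeR R) -> \bar R).
Proof.
move=> /= F mF tF mUF; rewrite /dt_over_t; apply: cvg_toP.
  apply: ereal_nondecreasing_is_cvgn => m n mn.
  by apply: lee_sum_nneg_natr => // k _ _; exact: dt_over_t_ge0.
rewrite setI_bigcupl ge0_integral_bigcup//=.
- by move=> k; apply: measurableI => //; exact: measurable_pos_itv.
- rewrite -setI_bigcupl; apply: measurable_funS mpos_invr.1 => //.
  exact: measurable_pos_itv.
- by move=> x [k _ [_ px]]; exact: mpos_invr.2.
- by apply: trivIset_setIr.
Qed.

(** A copy of [dt_over_t] on the measurable type of the reals, which carries
    the structure of a measure. *)
Definition haar : set (measurableTypeR R) -> \bar R := @dt_over_t R.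

HB.instance Definition _ := isMeasure.Build _ (measurableTypeR R) R haar
  dt_over_t0 dt_over_t_ge0 dt_over_t_sigma_additive.

Lemma dt_over_t_itv (a b : R) : a < b ->
  dt_over_t `[expR a, expR b[ = (b - a)%:E.
Proof.
move=> ab; have eab : expR a < expR b by rewrite ltr_expR.
rewrite /dt_over_t setIidl; last first.
  by move=> x /=; rewrite in_itv/= pos_itvE => /andP[/(lt_le_trans (expR_gt0 a))].
have subpos : `[expR a, expR b] `<=` (pos_itv : set R).
  by move=> x /=; rewrite in_itv/= pos_itvE => /andP[/(lt_le_trans (expR_gt0 a))].
rewrite integral_itv_bndo_bndc; last first.
  apply: measurable_funS mpos_invr.1; first exact: measurable_pos_itv.
  by apply: subset_trans subpos => x /=; rewrite !in_itv/= => /andP[-> /ltW].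
rewrite (@continuous_FTC2 _ _ (@ln R))//.
- by rewrite !expRK -EFinB.
- apply: continuous_in_subspaceT => x; rewrite inE => /subpos; rewrite pos_itvE => x0.
  by apply: inv_continuous; rewrite gt_eqF.
- split.
  + move=> x; rewrite in_itv/= => /andP[/(lt_trans (expR_gt0 a)) x0 _].
    by have := is_derive1_ln x0; move=> [].
  + by apply: cvg_at_right_filter; apply: continuous_ln; exact: expR_gt0.
  + by apply: cvg_at_left_filter; apply: continuous_ln; exact: expR_gt0.
- move=> x; rewrite in_itv/= => /andP[/(lt_trans (expR_gt0 a)) x0 _].
  by rewrite derive1E; have := is_derive1_ln x0 => -[_ ->].
Qed.

Lemma measurable_expRN : measurable_fun setT (fun x : R => expR (- x)).
Proof.
by apply: measurableT_comp; [exact: measurable_expR|exact: oppr_measurable].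
Qed.

(** In the variable [- ln t] the measure [dt/t] is translation-invariant,
    hence Lebesgue measure. *)
Lemma dt_over_tE A : measurable A ->
  dt_over_t A = leb [set x | A (expR (- x))].
Proof.
move=> mA; pose nl : measurableTypeR R -> measurableTypeR R := fun t => - ln t.
have mnl : measurable_fun setT nl by apply: measurableT_comp => //; exact: measurable_ln.
have mB : measurable [set x | A (expR (- x))].
  by rewrite -[X in measurable X]setTI; exact: measurable_expRN.
have -> : leb [set x | A (expR (- x))] =
    pushforward haar nl [set x | A (expR (- x))].
  apply: lebesgue_measure_unique => // X [[u v]] _ <-.
  rewrite -[RHS]/(dt_over_t (nl @^-1` `]u, v])) /= lebesgue_measure_itv/= lte_fin.
  have IE : nl @^-1` `]u, v] `&` pos_itv = `[expR (- v), expR (- u)[ `&` pos_itv.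
    apply/seteqP; split=> x []; rewrite pos_itvE /= !in_itv/= /nl.
      move=> /andP[ux xv] x0; split; last by rewrite pos_itvE.
      by rewrite -[x]lnK ?posrE// ler_expR ltr_expR lerNl xv ltrNr ux.
    move=> /andP[vx xu] x0; split; last by rewrite pos_itvE.
    move: vx xu; rewrite -[x]lnK ?posrE// ler_expR ltr_expR expRK.
    by rewrite lerNl ltrNr => -> ->.
  rewrite /dt_over_t IE -[RHS]/(dt_over_t _); case: ltP => uv.
    by rewrite dt_over_t_itv ?ltrN2// -EFinD opprK addrC.
  rewrite (_ : `[_, _[%classic = set0) ?dt_over_t0//.
  by apply: set_itv_ge; rewrite bnd_simp -leNgt ler_expR lerN2.
rewrite /pushforward /haar /dt_over_t; congr (integral _ _ _).
apply/seteqP; split=> x [] Ax; rewrite pos_itvE => x0; split; rewrite ?pos_itvE//.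
  by rewrite /= /nl opprK lnK.
by move: Ax; rewrite /= /nl opprK lnK.
Qed.

Definition logcut (I : set R) g : R -> \bar R := fun x => patch (cst 0%E) I g (expR (- x)).

Lemma unit_expRN (x : R) : unit_itv (expR (- x)) = (0 < x) :> Prop.
Proof. by rewrite unit_itvE expR_gt0 /= -[X in _ < X]expR0 ltr_expR oppr_lt0. Qed.

Lemma mpos_expRN f : measurable_fun unit_itv f ->
  (forall t, unit_itv t -> (0 <= f t)%E) -> mpos (fun x => f (expR (- x))).
Proof.
move=> mf f0; split; last by move=> x; rewrite pos_itvE => x0; apply: f0; rewrite unit_expRN.
apply: (measurable_comp measurable_unit_itv _ mf).
  by move=> _ [x + <-]; rewrite pos_itvE unit_expRN.
by apply: measurable_funTS; exact: measurable_expRN.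
Qed.

(** Norms with respect to [dt/t] on [`]0, 1[] are norms on the half-line in
    the variable [- ln t]: both functions have the same distribution. *)
Lemma tilde_normE E (I : set R) g : measurable I -> I `<=` unit_itv ->
  measurable_fun unit_itv g -> (forall t, I t -> (0 <= g t)%E) ->
  tilde_norm E I g = E (logcut I g) /\ mpos (logcut I g).
Proof.
move=> mI I1 mg g0.
have p0 t : (0 <= patch (cst 0%E) I g t)%E.
  by rewrite patchE; case: ifPn => //; rewrite inE => /g0.
have mp : measurable_fun setT (patch (cst 0%E) I g).
  apply/(measurable_restrictT (D := I)) => //.
  exact: measurable_funS measurable_unit_itv I1 mg.
have ml : mpos (logcut I g).
  by apply: mpos_expRN => //; exact: measurable_funTS.
split => //; apply: (ri_equimeasurable (ri_normP E)) => //; first exact: mpos_rearr.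
move=> s s0.
rewrite -[LHS]/(dist _ _) (@dist_rearr _ _ haar)//; last 2 first.
- exact: measurable_pos_itv.
- exact: measurable_funTS.
rewrite dt_over_tE; last first.
  apply: emeasurable_fun_o_infty; first exact: measurable_pos_itv.
  by apply: measurable_funTS; exact: measurableT_comp.
congr (leb _); apply/seteqP; split=> x /=; rewrite !pos_itvE gee0_abs//.
  move=> [_ h]; split => //; move: h; rewrite patchE; case: ifPn.
    by rewrite inE => /I1; rewrite unit_expRN.
  by rewrite lte_fin ltNge s0.
by move=> [x0 h]; split => //; exact: expR_gt0.
Qed.

End haar_measure.

(** * Fundamental functions and regular variation *)

Section fundamental_function.
Context {R : realType}.
Notation leb := (@lebesgue_measure R).
Implicit Types (E : riSpace R) (f g : R -> \bar R).

Lemma mpos_indic (A : set R) : measurable A -> mpos (fun x => (\1_A x)%:E : \bar R).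
Proof.
move=> mA; apply: (@mpos_EFin _ (\1_A)) => [|x _].
  by apply: measurable_indic.
by rewrite indicE; case: (_ \in _).
Qed.

Lemma dist_indic (A : set R) (s : R) : A `<=` pos_itv -> 0 <= s ->
  dist (fun x => (\1_A x)%:E) s = if s < 1 then leb A else 0%E.
Proof.
move=> Ap s0; rewrite /dist; case: ltP => s1.
  congr (leb _); apply/seteqP; split=> x.
    move=> [_ /=]; rewrite lte_fin indicE; case: (boolP (x \in A)).
      by rewrite inE.
    by rewrite /= ltNge s0.
  by move=> Ax; split; [exact: Ap|rewrite /= lte_fin indicE mem_set].
rewrite (_ : _ `&` _ = set0) ?measure0//; apply/seteqP; split=> x // [_ /=].
rewrite lte_fin indicE; case: (_ \in _) => /=; first by rewrite ltNge s1.
by rewrite ltNge s0.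
Qed.

Lemma ri_indic_le E (A B : set R) : measurable A -> measurable B ->
  A `<=` pos_itv -> B `<=` pos_itv -> (leb A <= leb B)%E ->
  (E (fun x => (\1_A x)%:E) <= E (fun x => (\1_B x)%:E))%E.
Proof.
move=> mA mB Ap Bp AB; apply: ri_le_dist; [exact: mpos_indic|exact: mpos_indic|].
by move=> s s0; rewrite !dist_indic//; case: ifP.
Qed.

Lemma initial_pos (s : R) : `]0, s[ `<=` (pos_itv : set R).
Proof. by move=> x /=; rewrite in_itv/= pos_itvE => /andP[]. Qed.

Lemma leb_initial_itv (s : R) : 0 <= s -> leb `]0%R, s[ = s%:E.
Proof.
rewrite lebesgue_measure_itv/= lte_fin le_eqVlt => /orP[/eqP <-|s0].
  by rewrite ltxx.
by rewrite s0 oppr0 adde0.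
Qed.

Lemma fundamentalE E (s : R) : 0 <= s ->
  E (fun x => (\1_(`]0, s[ : set R) x)%:E) = (fundamental E s)%:E.
Proof.
move=> s0; rewrite /fundamental fineK// ge0_fin_numE; last first.
  by apply: ri_nneg; apply: mpos_indic; exact: measurable_itv.
apply: (ri_indic (ri_normP E)) => //; first exact: initial_pos.
by rewrite leb_initial_itv// ltry.
Qed.

Lemma fundamental_gt0 E (s : R) : 0 < s -> 0 < fundamental E s.
Proof.
move=> s0; rewrite -lte_fin -fundamentalE; last exact: ltW.
have mi := @mpos_indic `]0, s[ (measurable_itv _).
rewrite lt0e ri_nneg// andbT; apply/eqP => /(ri_eq0 (ri_normP E) mi) [N [mN N0 sN]].
have : (leb `]0%R, s[ <= leb N)%E.
  apply: lebesgue_measure_le => x xs; apply: sN => /= h.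
  have := h (initial_pos xs); rewrite indicE mem_set//= => -[] /eqP.
  by rewrite oner_eq0.
by rewrite N0 leb_initial_itv ?(ltW s0)// lee_fin leNgt s0.
Qed.

Lemma fundamental_le E (s t : R) : 0 <= s -> s <= t ->
  fundamental E s <= fundamental E t.
Proof.
move=> s0 st; rewrite -lee_fin -!fundamentalE ?(le_trans s0 st)//.
apply: ri_indic_le; try exact: measurable_itv; try exact: initial_pos.
by rewrite !leb_initial_itv ?lee_fin// (le_trans s0 st).
Qed.

(** The norm of an indicator function depends only on the measure of the set,
    so that [`[s, s + t[] has the norm of [`]0, t[]. *)
Lemma fundamentalD E (s t : R) : 0 <= s -> 0 <= t ->
  fundamental E (s + t) <= fundamental E s + fundamental E t.
Proof.
move=> s0 t0; rewrite -lee_fin EFinD -!fundamentalE ?addr_ge0//.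
have mi (I : interval R) : mpos (fun x => (\1_([set` I] : set R) x)%:E : \bar R).
  by apply: mpos_indic; exact: measurable_itv.
apply: (@le_trans _ _ (E (fun x => (\1_(`]0, s[ : set R) x)%:E +
    (\1_(`[s, s + t[ : set R) x)%:E)%E)).
  apply: ri_le_pt => [||x x0]; [exact: mi|exact: mposD|].
  rewrite -EFinD lee_fin !indicE /= !mem_setE !in_itv/= x0 /=.
  by case: (ltP x s) => xs; case: (ltP x (s + t)) => xst /=;
    rewrite ?addr0 ?add0r ?lexx ?ler_wpDl// ?ler01.
apply: le_trans (ri_normD _ _ _) _ => //; rewrite leeD2l//.
(* for [s = 0] the interval [`[s, s + t[] leaves the open half-line *)
have [->|sn0] := eqVneq s 0; last first.
  apply: ri_indic_le; try exact: measurable_itv; try exact: initial_pos.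
    move=> x /=; rewrite in_itv/= pos_itvE => /andP[+ _]; apply: lt_le_trans.
    by rewrite lt_neqAle eq_sym sn0.
  rewrite leb_initial_itv// lebesgue_measure_itv/= lte_fin.
  by case: ifP => _; rewrite -?EFinD lee_fin//; lra.
rewrite add0r; apply: ri_le_pt => // x x0.
by rewrite !indicE !mem_setE !in_itv/= x0 (ltW x0).
Qed.

Lemma fundamentalMn E n (s : R) : 0 <= s ->
  fundamental E (n%:R * s) <= n%:R * fundamental E s.
Proof.
move=> s0; elim: n => [|n IH].
  rewrite !mul0r -lee_fin -fundamentalE// (_ : (fun x => _) = fun=> 0%E) ?ri0//.
  apply/funext => x; rewrite indicE mem_setE/= in_itv/=.
  by case: ltP => //= x0; rewrite ltNge (ltW x0).
rewrite -natr1 !mulrDl !mul1r; apply: le_trans (fundamentalD _ _ _) _ => //.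
  by rewrite mulr_ge0.
by rewrite lerD2r.
Qed.

End fundamental_function.

Section regular_variation.
Context {R : realType}.
Implicit Types (k e : R) (u v V : R -> R).

(** Regular variation of index [k] in the variable [- ln t]: up to factors
    growing slower than any exponential, [V x] behaves like [expR (k * x)]. *)
Definition regvar k V : Prop :=
  [/\ measurable_fun (pos_itv : set R) V, (forall x, 0 < x -> 0 < V x) &
      forall e, 0 < e -> exists2 C : R, 0 < C &
        forall x y, 0 < x -> 0 < y ->
          V x <= C * expR (k * (x - y) + e * `|x - y|) * V y].

Lemma regvar_meas k V : regvar k V -> measurable_fun (pos_itv : set R) V.
Proof. by case. Qed.

Lemma regvar_gt0 k V x : regvar k V -> 0 < x -> 0 < V x.
Proof. by case=> _ + _; exact. Qed.

Lemma regvar_bound k V e : regvar k V -> 0 < e -> exists2 C : R, 0 < C &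
  forall x y, 0 < x -> 0 < y ->
    V x <= C * expR (k * (x - y) + e * `|x - y|) * V y.
Proof. by case=> _ _; exact. Qed.

Lemma regvar_mpos k V : regvar k V -> mpos (EFin \o V).
Proof. by case=> mV V0 _; apply: mpos_EFin => // x /V0/ltW. Qed.

Lemma regvar_eq k u v : regvar k u -> (forall x, 0 < x -> v x = u x) -> regvar k v.
Proof.
move=> [mu u0 hu] uv; split.
- by apply: eq_measurable_fun mu => x; rewrite inE pos_itvE => /uv.
- by move=> x x0; rewrite uv// u0.
- move=> e /hu[C C0 h]; exists C => // x y x0 y0; rewrite !uv//; exact: h.
Qed.

Lemma regvar_index k k' V : k = k' -> regvar k V -> regvar k' V.
Proof. by move=> ->. Qed.

Lemma regvar_exp k : regvar k (fun x => expR (k * x)).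
Proof.
split=> [|x _|e e0]; last 2 first.
- exact: expR_gt0.
- exists 1 => // x y _ _; rewrite mul1r -expRD ler_expR.
  by have := mulr_ge0 (ltW e0) (normr_ge0 (x - y)); lra.
apply: measurable_funTS; apply: measurableT_comp; first exact: measurable_expR.
by apply: measurable_funM; [exact: measurable_cst|exact: measurable_id].
Qed.

Lemma regvarM k l u v : regvar k u -> regvar l v -> regvar (k + l) (fun x => u x * v x).
Proof.
move=> [mu u0 hu] [mv v0 hv]; split.
- exact: measurable_funM.
- by move=> x x0; rewrite mulr_gt0 ?u0 ?v0.
- move=> e e0; have e20 : 0 < e / 2 by rewrite divr_gt0.
  have [C C0 h] := hu _ e20; have [D D0 h'] := hv _ e20.
  exists (C * D) => [|x y x0 y0]; first by rewrite mulr_gt0.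
  apply: (@le_trans _ _ ((C * expR (k * (x - y) + e / 2 * `|x - y|) * u y) *
    (D * expR (l * (x - y) + e / 2 * `|x - y|) * v y))).
    by apply: ler_pM; rewrite ?h ?h'// ltW ?u0 ?v0.
  rewrite (_ : (k + l) * (x - y) + e * `|x - y| =
    (k * (x - y) + e / 2 * `|x - y|) + (l * (x - y) + e / 2 * `|x - y|)); last by field.
  rewrite (expRD (k * _ + _) (l * _ + _)).
  by rewrite le_eqVlt; apply/orP; left; apply/eqP; ring.
Qed.

Lemma measurable_fun_inv_pos u : measurable_fun (pos_itv : set R) u ->
  (forall x, 0 < x -> 0 < u x) -> measurable_fun (pos_itv : set R) (fun x => (u x)^-1).
Proof.
move=> mu u0.
apply: (eq_measurable_fun (fun x => expR (- ln (u x)))).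
  by move=> x; rewrite inE pos_itvE => x0; rewrite expRN lnK// posrE u0.
apply: (@measurableT_comp _ _ _ _ _ _ (fun z => expR (- ln z)) _ u) => //.
apply: measurableT_comp; first exact: measurable_expR.
by apply: measurableT_comp; [exact: oppr_measurable|exact: measurable_ln].
Qed.

Lemma regvarV k u : regvar k u -> regvar (- k) (fun x => (u x)^-1).
Proof.
move=> [mu u0 hu]; split; first exact: measurable_fun_inv_pos.
- by move=> x x0; rewrite invr_gt0 u0.
- move=> e e0; have [C C0 h] := hu _ e0; exists C => // x y x0 y0.
  rewrite -div1r ler_pdivrMr ?u0// mulrAC ler_pdivlMr ?u0// mul1r.
  apply: le_trans (h _ _ y0 x0) _.
  rewrite (_ : k * (y - x) = - k * (x - y)); last by ring.
  by rewrite [`|y - x|]distrC.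
Qed.

Lemma regvar_powR k u (a : R) : regvar k u -> regvar (a * k) (fun x => u x `^ a).
Proof.
have pos (b : R) : 0 <= b -> regvar k u -> regvar (b * k) (fun x => u x `^ b).
  move=> b0 [mu u0 hu]; split.
  - by apply: (@measurableT_comp _ _ _ _ _ _ (fun z => z `^ b) _ u) => //; exact: measurable_powR.
  - by move=> x x0; rewrite powR_gt0 ?u0.
  - move=> e e0; have eb : 0 < e / (b + 1) by rewrite divr_gt0// ltr_wpDl.
    have [C C0 h] := hu _ eb.
    exists (C `^ b) => [|x y x0 y0]; first by rewrite powR_gt0.
    apply: (@le_trans _ _ ((C * expR (k * (x - y) + e / (b + 1) * `|x - y|) * u y) `^ b)).
      apply: ge0_ler_powR; rewrite ?nnegrE ?h ?(ltW (u0 _ _))//.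
      by rewrite mulr_ge0 ?ltW ?u0// mulr_gt0 ?expR_gt0.
    rewrite !powRM ?(ltW C0) ?(ltW (u0 _ _)) ?expR_ge0 ?mulr_ge0 ?expR_ge0 ?(ltW C0)//.
    rewrite ler_wpM2r ?powR_ge0// ler_wpM2l ?powR_ge0//.
    rewrite -expRM ler_expR mulrDl mulrAC [k * b]mulrC lerD2l.
    rewrite -mulrA [_ * b]mulrC mulrA ler_wpM2r// mulrAC ler_pdivrMr ?ltr_wpDl//.
    by rewrite ler_wpM2l ?(ltW e0)// ler_wpDr.
have [a0|a0] := leP 0 a; first exact: pos.
move=> hu; have ha : 0 <= - a by rewrite oppr_ge0 ltW.
apply: regvar_eq (regvar_index _ (regvarV (pos _ ha hu))) _; first by ring.
by move=> x x0; rewrite -powRN opprK.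
Qed.

Lemma regvar_equiv k u v (c : R) : 0 < c -> regvar k u ->
  measurable_fun (pos_itv : set R) v ->
  (forall x, 0 < x -> u x <= c * v x /\ v x <= c * u x) -> regvar k v.
Proof.
move=> c0 [mu u0 hu] mv uv; split => //.
- move=> x x0; have [h _] := uv x x0.
  by rewrite -(pmulr_rgt0 _ c0); apply: lt_le_trans h; exact: u0.
- move=> e e0; have [C C0 h] := hu _ e0.
  exists (c * C * c) => [|x y x0 y0]; first by rewrite !mulr_gt0.
  have [_ h1] := uv x x0; have [h2 _] := uv y y0.
  apply: (le_trans h1).
  rewrite -!mulrA ler_pM2l// (mulrC c) -!mulrA; apply: le_trans (h _ _ x0 y0) _.
  rewrite -mulrA ler_pM2l// ler_pM2l ?expR_gt0//.
  by rewrite mulrC.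
Qed.

Lemma regvar_comp u (L : R) (psi : R -> R) : 0 < L -> regvar 0 u ->
  measurable_fun (pos_itv : set R) psi ->
  (forall x, 0 < x -> 0 < psi x) ->
  (forall x y, 0 < x -> 0 < y -> `|psi x - psi y| <= L * `|x - y|) ->
  regvar 0 (u \o psi).
Proof.
move=> L0 [mu u0 hu] mpsi psi0 hpsi; split.
- apply: (measurable_comp measurable_pos_itv _ mu) => //.
  by move=> _ [x + <-]; rewrite !pos_itvE; exact: psi0.
- by move=> x x0 /=; rewrite u0 ?psi0.
- move=> e e0; have eL : 0 < e / L by rewrite divr_gt0.
  have [C C0 h] := hu _ eL; exists C => // x y x0 y0 /=.
  apply: le_trans (h _ _ (psi0 _ x0) (psi0 _ y0)) _.
  rewrite ler_wpM2r ?(ltW (u0 _ _))// ?psi0// ler_pM2l// ler_expR !mul0r !add0r.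
  apply: (@le_trans _ _ (e / L * (L * `|x - y|))).
    by rewrite ler_wpM2l ?hpsi// ltW.
  by rewrite mulrA divfK ?gt_eqF.
Qed.

Lemma linear_le_exp e : 0 < e -> exists2 C : R, 0 < C &
  forall h, 0 <= h -> 1 + h <= C * expR (e * h).
Proof.
move=> e0; exists (1 + e^-1) => [|h h0]; first by rewrite addr_gt0 ?invr_gt0.
apply: (@le_trans _ _ ((1 + e^-1) * (1 + e * h))); last first.
  by rewrite ler_pM2l ?addr_gt0 ?invr_gt0// expR_ge1Dx.
rewrite mulrDl mul1r mulrDr mulr1 mulrA mulVf ?gt_eqF// mul1r.
have : 0 <= e * h by rewrite mulr_ge0// ltW.
have : 0 <= e^-1 by rewrite invr_ge0 ltW.
lra.
Qed.

(** Subadditive functions grow at most linearly, hence vary slowly in the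
    exponential scale. *)
Lemma regvar_subadditive (phi : R -> R) :
  (forall s, 0 < s -> 0 < phi s) ->
  (forall s t, 0 < s -> s <= t -> phi s <= phi t) ->
  (forall n s, 0 < s -> phi (n%:R * s) <= n%:R * phi s) ->
  regvar 0 (fun x => phi (1 + x)).
Proof.
move=> phi0 phile phiM; split.
- have [+ _] : mpos (EFin \o (fun x => phi (1 + x))).
    apply: mpos_nondecreasing => [x y x0 xy|x x0] /=.
      by rewrite lee_fin phile ?lerD2l// addr_gt0.
    by rewrite lee_fin ltW// phi0// addr_gt0.
  by move/measurable_EFinP.
- by move=> x x0; rewrite phi0// addr_gt0.
- move=> e e0; have [C C0 h] := linear_le_exp e0.
  exists (2 * C) => [|x y x0 y0]; first by rewrite mulr_gt0.
  have y1 : 0 < 1 + y by rewrite addr_gt0.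
  have x1 : 0 < 1 + x by rewrite addr_gt0.
  pose q := (1 + x) / (1 + y); pose n := (Num.Def.trunc q).+1.
  have q0 : 0 < q by rewrite divr_gt0.
  have /andP[nq qn] := truncn_itv (ltW q0); rewrite -/n in qn.
  apply: (@le_trans _ _ (phi (n%:R * (1 + y)))).
    by apply: phile => //; rewrite -ler_pdivrMr// ltW.
  apply: (le_trans (phiM _ _ y1)); rewrite ler_wpM2r ?(ltW (phi0 _ _))//.
  rewrite mul0r add0r; have nx := normr_ge0 (x - y).
  apply: (@le_trans _ _ (2 * (1 + `|x - y|))); last first.
    by rewrite -mulrA ler_pM2l// h.
  have qle : q <= 1 + `|x - y|.
    rewrite ler_pdivrMr//; have := ler_norm (x - y).
    have : 0 <= `|x - y| * y by rewrite mulr_ge0// ltW.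
    lra.
  rewrite /n -natr1; lra.
Qed.

Lemma regvar_fundamental (E : riSpace R) : regvar 0 (fun x => fundamental E (1 + x)).
Proof.
apply: regvar_subadditive => [s|s t|n s] s0.
- exact: fundamental_gt0.
- by apply: fundamental_le; exact: ltW.
- by apply: fundamentalMn; exact: ltW.
Qed.

Lemma regvar_affine : regvar 0 (fun x : R => 1 + x).
Proof.
apply: (@regvar_subadditive (fun x : R => x)) => //.
Qed.

(** The logarithm of a slowly varying function is at bounded distance from a
    function with small Lipschitz constant: its McShane regularization. *)
Lemma regvar_lipschitz v (d : R) : regvar 0 v -> 0 < d ->
  exists (lam : R -> R) (c : R), [/\ 0 <= c,
    (forall x, 0 < x -> `|ln (v x) - lam x| <= c) &
    (forall x y, `|lam x - lam y| <= d * `|x - y|)].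
Proof.
move=> [_ v0 hv] d0; have [C C0 h] := hv _ d0.
have lnh x y : 0 < x -> 0 < y -> ln (v x) <= ln C + d * `|x - y| + ln (v y).
  move=> x0 y0; have := h x y x0 y0; rewrite mul0r add0r => hxy.
  rewrite -[d * _]expRK -!lnM ?posrE ?mulr_gt0 ?expR_gt0 ?v0//.
  by rewrite ler_ln ?posrE ?mulr_gt0 ?expR_gt0 ?v0.
pose S x := [set ln (v y) + d * `|x - y| | y in (pos_itv : set R)].
have lnC0 : 0 <= ln C by have := lnh 1 1 ltr01 ltr01; rewrite subrr normr0 mulr0; lra.
have S1 x : S x !=set0 by exists (ln (v 1) + d * `|x - 1|), 1 => //; rewrite pos_itvE.
have lbS x : has_lbound (S x).
  exists (ln (v 1) - ln C - d * `|x - 1|) => _ [y + <-]; rewrite pos_itvE => y0.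
  have := lnh 1 y ltr01 y0.
  have := ler_distD x 1 y; rewrite (distrC 1 x).
  have := normr_ge0 (x - y); nra.
have inf_le x y : 0 < y -> inf (S x) <= ln (v y) + d * `|x - y|.
  by move=> y0; apply: ge_inf => //; exists y => //; rewrite pos_itvE.
exists (fun x => inf (S x)), (ln C); split => //.
- move=> x x0; rewrite ler_norml; apply/andP; split.
    rewrite lerBrDl; apply: (le_trans _ (lexx _)).
    have := inf_le x x x0; rewrite subrr normr0 mulr0 addr0; lra.
  rewrite lerBlDr -lerBlDl; apply: lb_le_inf => // _ [y + <-]; rewrite pos_itvE => y0.
  by have := lnh x y x0 y0; lra.
- have half x y : inf (S x) <= inf (S y) + d * `|x - y|.
    rewrite -lerBlDr; apply: lb_le_inf => // _ [z + <-]; rewrite pos_itvE => z0.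
    have := inf_le x z z0; have := ler_distD y x z; nra.
  move=> x y; rewrite ler_norml; apply/andP; split.
    by have := half y x; rewrite distrC; lra.
  by have := half x y; lra.
Qed.

(** The almost monotone function [t `^ (- e) * b t] bounds the growth of
    [b] when the argument increases, and [t `^ e * b t] when it decreases. *)
Lemma regvar_SV (b : R -> R) : SV b -> regvar 0 (fun x => b (expR (- x))).
Proof.
move=> [b0 mb hb]; split.
- have [+ _] : mpos (fun x => (EFin \o b) (expR (- x))).
    apply: mpos_expRN; first exact/measurable_EFinP.
    by move=> t /b0; rewrite lee_fin => /ltW.
  by move/measurable_EFinP.
- by move=> x x0; apply: b0; rewrite unit_expRN.
- move=> e e0; have [[g gm [C1 C10 gE]] [h hm [C2 C20 hE]]] := hb e e0.
  have uE (x : R) : 0 < x -> unit_itv (expR (- x)) by rewrite unit_expRN.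
  have step (a C : R) (u : R -> R) (x y : R) : 0 < C -> 0 < x -> 0 < y ->
      u (expR (- x)) <= u (expR (- y)) ->
      (forall t, unit_itv t -> C^-1 * u t <= t `^ a * b t /\ t `^ a * b t <= C * u t) ->
      b (expR (- x)) <= C * C * expR (a * (x - y)) * b (expR (- y)).
    move=> C0 x0 y0 uxy hu.
    have [_ h1] := hu _ (uE _ x0); have [h2 _] := hu _ (uE _ y0).
    rewrite -(ler_pM2l (powR_gt0 a (expR_gt0 (- x)))); apply: (le_trans h1).
    rewrite [leRHS](_ : _ = C * (C * (expR (- y) `^ a * b (expR (- y))))).
      by rewrite ler_pM2l// (le_trans uxy)// -ler_pdivrMl.
    by rewrite -!expRM (_ : - y * a = - x * a + a * (x - y)) ?expRD; ring.
  exists (C1 * C1 + C2 * C2) => [|x y x0 y0]; first by rewrite addr_gt0 ?mulr_gt0.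
  have by0 := ltW (b0 _ (uE _ y0)); rewrite mul0r add0r; have [xy|yx] := leP x y.
    apply: le_trans (step (- e) C2 h x y C20 x0 y0 _ hE) _.
      by apply: hm (uE _ y0) (uE _ x0) _; rewrite ler_expR lerN2.
    rewrite ler0_norm ?subr_le0// mulrN -mulNr !ler_wpM2r ?expR_ge0//.
    by rewrite lerDr mulr_ge0 ?(ltW C10).
  apply: le_trans (step e C1 g x y C10 x0 y0 _ gE) _.
    by apply: gm (uE _ x0) (uE _ y0) _; rewrite ler_expR lerN2 ltW.
  rewrite gtr0_norm ?subr_gt0// !ler_wpM2r ?expR_ge0//.
  by rewrite lerDl mulr_ge0 ?(ltW C20).
Qed.

End regular_variation.

(** * Weighted suprema of nondecreasing functions *)

Section weighted_sup.
Context {R : realType}.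
Implicit Types (E : riSpace R) (f g G : R -> \bar R) (k e : R) (w V : R -> R).

(** The properties of a rearrangement in the logarithmic variable. They are
    required on the whole line, because rearrangements of sums involve
    translates. *)
Definition nondecr0 (F : R -> \bar R) : Prop :=
  (forall x y, x <= y -> (F x <= F y)%E) /\ (forall x, (0 <= F x)%E).

Definition wsup w (F : R -> \bar R) (A : set R) : \bar R :=
  ereal_sup [set (w z)%:E * F z | z in A]%E.

Definition wtail w F (x : R) : \bar R := wsup w F `]x, +oo[.

Lemma wsup_le w F A (a : \bar R) :
  (forall z, A z -> ((w z)%:E * F z <= a)%E) -> (wsup w F A <= a)%E.
Proof. by move=> h; apply: ge_ereal_sup => _ [z Az <-]; exact: h. Qed.

Lemma le_wsup w F (A : set R) z : A z -> ((w z)%:E * F z <= wsup w F A)%E.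
Proof. by move=> Az; apply: ereal_sup_ubound; exists z. Qed.

Lemma wsup_sub w F (A B : set R) : A `<=` B -> (wsup w F A <= wsup w F B)%E.
Proof. by move=> AB; apply: wsup_le => z /AB; exact: le_wsup. Qed.

Lemma le_wtail w F x z : x < z -> ((w z)%:E * F z <= wtail w F x)%E.
Proof. by move=> xz; apply: le_wsup; rewrite /= in_itv/= xz. Qed.

Lemma wtail_le w F x (a : \bar R) :
  (forall z, x < z -> ((w z)%:E * F z <= a)%E) -> (wtail w F x <= a)%E.
Proof. by move=> h; apply: wsup_le => z /=; rewrite in_itv/= andbT; exact: h. Qed.

Lemma wtail_nonincr w F x y : x <= y -> (wtail w F y <= wtail w F x)%E.
Proof.
by move=> xy; apply: wtail_le => z yz; apply: le_wtail; exact: le_lt_trans yz.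
Qed.

Lemma regvar_ge0 k V x : regvar k V -> 0 < x -> 0 <= V x.
Proof. by move=> hV x0; exact: ltW (regvar_gt0 hV x0). Qed.

Lemma wF_ge0 k w F z : regvar k w -> nondecr0 F -> 0 < z -> (0 <= (w z)%:E * F z)%E.
Proof.
by move=> hw [_ F0] z0; rewrite mule_ge0// lee_fin (regvar_ge0 hw).
Qed.

Lemma wtail_ge0 k w F x : regvar k w -> nondecr0 F -> 0 <= x -> (0 <= wtail w F x)%E.
Proof.
move=> hw hF x0; apply: (le_trans (wF_ge0 (z := x + 1) hw hF _)).
  by rewrite ltr_wpDl.
by apply: le_wtail; rewrite ltrDl.
Qed.

Lemma mpos_wtail k w F : regvar k w -> nondecr0 F -> mpos (wtail w F).
Proof.
move=> hw hF; apply: mpos_nonincreasing => [x y _|x x0]; first exact: wtail_nonincr.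
exact: wtail_ge0 hw hF (ltW x0).
Qed.

Lemma mpos_nondecr0 F : nondecr0 F -> mpos F.
Proof. by move=> [hF F0]; apply: mpos_nondecreasing => // x y _; exact: hF. Qed.

Lemma mpos_wF k w F : regvar k w -> nondecr0 F -> mpos (fun z => (w z)%:E * F z)%E.
Proof. by move=> hw hF; exact: (mposM (regvar_mpos hw) (mpos_nondecr0 hF)). Qed.

Lemma regvar_local k V : regvar k V -> exists2 C : R, 0 < C &
  forall x y, 0 < x -> 0 < y -> `|x - y| <= 1 -> V x <= C * V y.
Proof.
move=> hV; have [C C0 h] := regvar_bound hV ltr01.
exists (C * expR (`|k| + 1)) => [|x y x0 y0 xy]; first by rewrite mulr_gt0 ?expR_gt0.
apply: le_trans (h _ _ x0 y0) _; rewrite ler_wpM2r ?(regvar_ge0 hV)// ler_pM2l//.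
rewrite ler_expR mul1r lerD//.
by rewrite (le_trans (ler_norm _))// normrM ler_piMr.
Qed.

Lemma regvar_decay k V : 0 < k -> regvar (- k) V -> exists2 C : R, 0 < C &
  forall x y, 0 < x -> x <= y -> V y <= C * expR (- (k / 2) * (y - x)) * V x.
Proof.
move=> k0 hV; have [C C0 h] := regvar_bound hV (divr_gt0 k0 (ltr0Sn _ 1)).
exists C => // x y x0 xy; apply: le_trans (h _ _ (lt_le_trans x0 xy) x0) _.
rewrite ler_wpM2r ?(regvar_ge0 hV)// ler_pM2l// ler_expR ger0_norm ?subr_ge0//.
lra.
Qed.

Lemma regvar_growth k V : 0 < k -> regvar k V -> exists2 C : R, 0 < C &
  forall x y, 0 < x -> x <= y -> V x <= C * expR (- (k / 2) * (y - x)) * V y.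
Proof.
move=> k0 hV; have [C C0 h] := regvar_bound hV (divr_gt0 k0 (ltr0Sn _ 1)).
exists C => // x y x0 xy; apply: le_trans (h _ _ x0 (lt_le_trans x0 xy)) _.
rewrite ler_wpM2r ?(regvar_ge0 hV) ?(lt_le_trans x0 xy)// ler_pM2l// ler_expR.
rewrite ler0_norm ?subr_le0//; lra.
Qed.

Lemma regvar_decayW k V : 0 < k -> regvar (- k) V -> exists2 C : R, 0 < C &
  forall x y, 0 < x -> x <= y -> V y <= C * V x.
Proof.
move=> k0 hV; have [C C0 h] := regvar_decay k0 hV; exists C => // x y x0 xy.
apply: le_trans (h x y x0 xy) _; rewrite ler_wpM2r ?(regvar_ge0 hV)//.
rewrite ler_piMr ?(ltW C0)// -[leRHS]expR0 ler_expR mulNr oppr_le0.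
by rewrite mulr_ge0 ?divr_ge0 ?subr_ge0// ltW.
Qed.

(** Since [F] is monotone and [w] is locally almost constant, [w * F] is
    locally almost increasing. *)
Lemma wF_local k w : regvar k w -> exists2 C : R, 0 < C &
  forall F, nondecr0 F -> forall z z', 0 < z -> z <= z' -> z' <= z + 1 ->
    ((w z)%:E * F z <= C%:E * ((w z')%:E * F z'))%E.
Proof.
move=> hw; have [C C0 h] := regvar_local hw; exists C => // F [hF F0] z z' z0 zz' z1.
have z'0 := lt_le_trans z0 zz'.
rewrite muleA -EFinM; apply: lee_pmul => //; first by rewrite lee_fin (regvar_ge0 hw).
  rewrite lee_fin h// distrC ger0_norm ?subr_ge0//; lra.
exact: hF.
Qed.

Lemma wF_le_wtail k w : regvar k w -> exists2 C : R, 0 < C &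
  forall F, nondecr0 F -> forall z, 0 < z ->
    ((w z)%:E * F z <= C%:E * wtail w F z)%E.
Proof.
move=> hw; have [C C0 h] := wF_local hw; exists C => // F hF z z0.
apply: le_trans (h F hF z (z + 1) z0 _ _) _ => //; first by rewrite lerDl.
by rewrite lee_pmul2l// ?le_wtail// ltrDl.
Qed.

(** By [wF_local] a value of [w * F] taken on [`]x, x + 1]] is bounded by one
    taken one unit further. *)
Lemma wtail_step k w : regvar k w -> exists2 C : R, 0 < C &
  forall F, nondecr0 F -> forall x, 0 <= x ->
    (wtail w F x <= C%:E * wtail w F (x + 1))%E.
Proof.
move=> hw; have [C C0 h] := wF_local hw; exists C => // F hF x x0.
apply: wtail_le => z xz; have z0 := le_lt_trans x0 xz.
apply: le_trans (h F hF z (z + 1) z0 _ _) _ => //; first by rewrite lerDl.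
by rewrite lee_pmul2l// le_wtail// ltrD2r.
Qed.

Lemma ri_ge_const E G (a : \bar R) (s : R) : 0 < s -> mpos G -> (0 <= a)%E ->
  (forall x, 0 < x -> x < s -> (a <= G x)%E) ->
  (a * (fundamental E s)%:E <= E G)%E.
Proof.
move=> s0 mG a0 h.
have real (r : R) : 0 <= r -> (r%:E <= a)%E -> (r%:E * (fundamental E s)%:E <= E G)%E.
  move=> r0 ra; rewrite -fundamentalE; last exact: ltW.
  have mi : mpos (fun x => (\1_(`]0, s[ : set R) x)%:E).
    by apply: mpos_indic; exact: measurable_itv.
  rewrite -(ri_scale (ri_normP E))//; apply: ri_le_pt => //; first exact: mposZ.
  move=> x x0; rewrite indicE mem_setE/= in_itv/= x0 /=; case: ltP => xs.
    by rewrite mule1; apply: (le_trans ra); exact: h.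
  by rewrite mule0; apply: mG.2; rewrite pos_itvE.
case: a a0 h real => [r| |]// a0 h real; first exact: real.
have p0 := fundamental_gt0 E s0.
rewrite gt0_mulye ?lte_fin// leye_eq; apply/eqP/eq_infty => t.
have [t0|/ltW t0] := leP 0 t; last by apply: le_trans (ri_nneg E mG); rewrite lee_fin.
have := real (t / fundamental E s) (divr_ge0 t0 (ltW p0)) (leey _).
by rewrite -EFinM divfK// gt_eqF.
Qed.

Lemma ri_le_const E G (a : \bar R) (A : set R) (s : R) : 0 < s ->
  measurable A -> A `<=` pos_itv -> (lebesgue_measure A <= s%:E)%E ->
  mpos (cut A G) -> (forall x, A x -> (G x <= a)%E) -> (0 <= a)%E ->
  (E (cut A G) <= a * (fundamental E s)%:E)%E.
Proof.
move=> s0 mA Ap As mG h; case: a h => [r| |]// h a0; last first.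
  by rewrite gt0_mulye ?leey// lte_fin fundamental_gt0.
have mi := @mpos_indic R A mA.
apply: (@le_trans _ _ (r%:E * E (fun x => (\1_A x)%:E))%E).
  apply: ri_le_scale => // x x0; rewrite /cut indicE; case: (boolP (x \in A)).
    by rewrite inE mule1; exact: h.
  by rewrite mule0.
rewrite lee_wpmul2l// -fundamentalE; last exact: ltW.
apply: ri_indic_le => //; first exact: initial_pos.
by rewrite leb_initial_itv// ltW.
Qed.

(** The part of [P] on [`]0, x]] is bounded by a constant; the length [1 + x]
    instead of [x] keeps the fundamental function away from 0 for small [x]. *)
Lemma ri_le_split E P Q (a : \bar R) (x : R) : 0 < x -> mpos P ->
  mpos (cut `]x, +oo[ Q) -> (0 <= a)%E ->
  (forall y, 0 < y -> y <= x -> (P y <= a)%E) -> (forall y, x < y -> (P y <= Q y)%E) ->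
  (E P <= E (cut `]x, +oo[ Q) + a * (fundamental E (1 + x))%:E)%E.
Proof.
move=> x0 mP mQ a0 Pa PQ; have mc : mpos (cut `]0, x] (fun=> a)).
  by apply: mpos_cut => //; exact: measurable_itv.
apply: (@le_trans _ _ (E (fun y => cut `]x, +oo[ Q y + cut `]0%R, x] (fun=> a) y)%E)).
  apply: ri_le_pt => //; first exact: mposD.
  move=> y y0; rewrite /cut; have [yx|xy] := leP y x.
    rewrite memNset ?add0e; last by rewrite /= in_itv/= andbT; apply/negP; rewrite -leNgt.
    by rewrite mem_set/= ?in_itv/= ?y0// Pa.
  rewrite mem_set/= ?in_itv/= ?xy// memNset ?adde0 ?PQ//= in_itv/=.
  by apply/negP; rewrite negb_and -!ltNge xy orbT.
apply: le_trans (ri_normD _ mQ mc) _; rewrite leeD2l//.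
apply: ri_le_const => //; first by rewrite addr_gt0.
  by move=> y /=; rewrite in_itv/= pos_itvE => /andP[].
by rewrite lebesgue_measure_itv/= lte_fin x0 oppr0 adde0 lee_fin lerDr.
Qed.

Lemma block_index (x y : R) : x < y -> exists n : nat, x + n%:R < y /\ y <= x + n.+1%:R.
Proof.
move=> xy; have yx : 0 < y - x by rewrite subr_gt0.
have /andP[h1 h2] := truncn_itv (ltW yx); set n := Num.Def.trunc _ in h1 h2.
move: h1; rewrite le_eqVlt => /orP[/eqP h1|h1]; last by exists n; split; lra.
case: n h1 h2 => [|m] h1 h2; first by rewrite -h1 ltxx in yx.
exists m; split; last by lra.
by move: h1; rewrite -natr1; lra.
Qed.

Lemma le_nneseries_term (a : nat -> \bar R) n : (forall m, (0 <= a m)%E) ->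
  (a n <= \sum_(0 <= m <oo) a m)%E.
Proof.
move=> a0; apply: le_trans (nneseries_lim_ge n.+1 _); last by move=> m _ _; exact: a0.
by rewrite big_nat_recr//= leeDr// sume_ge0.
Qed.

(** The half-line beyond [x] is cut into blocks of length 1, on each of which
    the norm is at most a bound for [G] times the norm of the indicator
    function of a unit interval. *)
Lemma ri_le_blocks E G (x : R) (a : nat -> \bar R) : 0 <= x ->
  mpos (cut `]x, +oo[ G) -> (forall n, (0 <= a n)%E) ->
  (forall n y, x + n%:R < y -> y <= x + n.+1%:R -> (G y <= a n)%E) ->
  (E (cut `]x, +oo[ G) <= \sum_(0 <= n <oo) (a n * (fundamental E 1)%:E))%E.
Proof.
move=> x0 mG a0 h; pose B n : set R := [set` `]x + n%:R, x + n.+1%:R] ].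
have Bx n : B n `<=` `]x, +oo[.
  move=> y; rewrite /B /= !in_itv/= andbT => /andP[+ _]; apply: le_lt_trans.
  by rewrite lerDl.
have Bp n : B n `<=` pos_itv.
  by move=> y /Bx /=; rewrite in_itv/= andbT pos_itvE; exact: le_lt_trans.
have mB n : measurable (B n) by exact: measurable_itv.
have mc n : mpos (cut (B n) G).
  apply: (mpos_eq (mpos_cutT (mB n) mG)) => y y0; rewrite /cut.
  by case: ifPn => //; rewrite inE => /Bx yx; rewrite mem_set.
apply: (@le_trans _ _ (E (fun y => \sum_(0 <= n <oo) cut (B n) G y))%E).
  apply: ri_le_pt => //; first exact: mpos_nneseries.
  move=> y y0; rewrite [in leLHS]/cut; case: ifPn => [|_]; last first.
    by apply: nneseries_ge0 => n _ _; apply: (mc n).2; rewrite pos_itvE.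
  rewrite inE /= in_itv/= andbT => /block_index[n [n1 n2]].
  apply: le_trans (le_nneseries_term n _); last first.
    by move=> m; apply: (mc m).2; rewrite pos_itvE.
  by rewrite /cut mem_set// /B /= in_itv/= n1 n2.
apply: le_trans (ri_nneseries _ mc) _.
apply: lee_nneseries => [n _ _|n _]; first exact: ri_nneg.
apply: ri_le_const => //.
- rewrite lebesgue_measure_itv/= lte_fin; case: ifP => _; last by rewrite lee_fin.
  by rewrite -EFinD lee_fin -natr1; lra.
- by move=> y; rewrite /B /= in_itv/= => /andP[]; exact: h.
Qed.

Lemma cvg_exp_geometric e : 0 < e -> exists2 S : R, 0 < S &
  (\sum_(0 <= n <oo) (expR (- e * n%:R))%:E <= S%:E :> \bar R)%E.
Proof.
move=> e0; pose z := expR (- e).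
have z0 : 0 < z by exact: expR_gt0.
have z1 : z < 1 by rewrite -[ltRHS]expR0 ltr_expR oppr_lt0.
exists (1 - z)^-1; first by rewrite invr_gt0 subr_gt0.
apply: lime_le; first by apply: is_cvg_nneseries => n _ _; rewrite lee_fin expR_ge0.
apply: nearW => n.
rewrite (eq_bigr (fun i => (z ^+ i)%:E)); last first.
  by move=> i _; rewrite /z -expRM_natl mulr_natl mulr_natr.
rewrite sumEFin lee_fin -[leRHS]mul1r ler_pdivlMr ?subr_gt0//.
have -> : (\sum_(0 <= i < n) z ^+ i) * (1 - z) = 1 - z ^+ n.
  elim: n => [|n IH]; first by rewrite big_nil mul0r expr0 subrr.
  by rewrite big_nat_recr//= mulrDl IH exprSr; ring.
by rewrite gerBl exprn_ge0 ?ltW.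
Qed.

(** A function of negative index decays exponentially, so that the sum over
    unit blocks is geometric and is dominated by its first term. *)
Lemma ri_regvar_tail E k V : 0 < k -> regvar (- k) V -> exists2 C : R, 0 < C &
  forall x, 0 < x -> (E (cut `]x, +oo[ (EFin \o V)) <= (C * V x)%:E)%E.
Proof.
move=> k0 hV; have [C C0 h] := regvar_decay k0 hV.
have [S S0 hS] := cvg_exp_geometric (divr_gt0 k0 (ltr0Sn _ 1)).
have p0 := fundamental_gt0 E (@ltr01 R).
exists (C * fundamental E 1 * S) => [|x x0]; first by rewrite !mulr_gt0.
have Vx := regvar_gt0 hV x0.
apply: le_trans (@ri_le_blocks E _ _
   (fun n => (C * V x * expR (- (k / 2) * n%:R))%:E) (ltW x0) _ _ _) _.
- by apply: mpos_cutT; [exact: measurable_itv|exact: regvar_mpos hV].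
- by move=> n; rewrite lee_fin !mulr_ge0 ?expR_ge0// ltW.
- move=> n y ny _; rewrite lee_fin /=.
  have xy : x <= y by apply: le_trans (ltW ny); rewrite lerDl.
  apply: (le_trans (h _ _ x0 xy)); rewrite mulrAC ler_pM2l ?mulr_gt0//.
  rewrite ler_expR !mulNr lerN2 ler_wpM2l ?divr_ge0 ?(ltW k0)//; lra.
- rewrite (eq_eseriesr (g := fun n => ((C * V x * fundamental E 1)%:E *
      (expR (- (k / 2) * n%:R))%:E)%E)); last first.
    by move=> n _; rewrite -!EFinM mulrAC.
  rewrite nneseriesZl; last by move=> n _; rewrite lee_fin expR_ge0.
  apply: (@le_trans _ _ ((C * V x * fundamental E 1)%:E * S%:E)%E).
    by rewrite lee_pmul2l// lte_fin !mulr_gt0.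
  by rewrite -EFinM lee_fin le_eqVlt; apply/orP; left; apply/eqP; ring.
Qed.

(** On [`]0, 1 + x[] the nonincreasing function [wtail w F] is at least its
    value at [1 + x], which [wtail_step] compares with its value at [x]. *)
Lemma wtail_embedding E k w : regvar k w -> exists2 C : R, 0 < C &
  forall F, nondecr0 F -> forall x, 0 < x ->
    ((fundamental E (1 + x))%:E * wtail w F x <= C%:E * E (wtail w F))%E.
Proof.
move=> hw; have [C C0 h] := wtail_step hw; exists C => // F hF x x0.
have x1 : 0 < 1 + x by rewrite addr_gt0.
have p0 := fundamental_gt0 E x1.
apply: (@le_trans _ _ ((fundamental E (1 + x))%:E * (C%:E * wtail w F (x + 1)))%E).
  by rewrite lee_pmul2l// h// ltW.
rewrite muleCA lee_pmul2l// muleC; apply: ri_ge_const => //.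
- exact: mpos_wtail hw hF.
- by apply: wtail_ge0 hw hF _; rewrite addr_ge0// ltW.
- by move=> y y0 yx; apply: wtail_nonincr; rewrite addrC ltW.
Qed.

End weighted_sup.

(** * A model of the K-functional *)

Ltac nneg := solve [repeat first
  [ assumption | apply: ltW; assumption | apply: mulr_ge0 | apply: addr_ge0
  | rewrite invr_ge0 ]].

Section holmstedt.
Context {R : realType} (E0 E1 : riSpace R) (w0 w1 : R -> R) (k0 k1 : R).
Hypotheses (k1_gt0 : 0 < k1) (k10 : k1 < k0).
Hypotheses (hw0 : regvar (- k0) w0) (hw1 : regvar (- k1) w1).
Implicit Types (F G : R -> \bar R).

Let phi0 x := fundamental E0 (1 + x).
Let phi1 x := fundamental E1 (1 + x).

(** The critical curve: up to constants, [rhow x] is the ratio of the norms of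
    the indicator function of [`]0, expR (- x)[] in the two spaces. This is
    what makes the three terms of [Kmodel] fit together, see [rhowE]. *)
Definition rhow (x : R) : R := w0 x * phi0 x / (w1 x * phi1 x).

Definition Ktail F x : \bar R := E0 (cut `]x, +oo[ (wtail w0 F)).

Definition Khead F x : \bar R :=
  E1 (cut `]0%R, x[ (fun y => wsup w1 F `]y, x[)).

(** The Holmstedt-type expression that is equivalent to the K-functional at
    [rhow x] when [F] is the rearrangement in the logarithmic variable. *)
Definition Kmodel F x : \bar R :=
  (Ktail F x + (phi0 x)%:E * wtail w0 F x + (rhow x)%:E * Khead F x)%E.

Lemma phi0_gt0 x : 0 < x -> 0 < phi0 x.
Proof. by move=> x0; apply: fundamental_gt0; rewrite addr_gt0. Qed.

Lemma phi1_gt0 x : 0 < x -> 0 < phi1 x.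
Proof. by move=> x0; apply: fundamental_gt0; rewrite addr_gt0. Qed.

Lemma phi0_ge x : 0 < x -> fundamental E0 1 <= phi0 x.
Proof. by move=> x0; apply: fundamental_le => //; rewrite lerDl ltW. Qed.

Lemma phi1_ge x : 0 < x -> fundamental E1 1 <= phi1 x.
Proof. by move=> x0; apply: fundamental_le => //; rewrite lerDl ltW. Qed.

Lemma regvar_rhow : regvar (- (k0 - k1)) rhow.
Proof.
have h0 := regvarM hw0 (regvar_fundamental E0).
have h1 := regvarV (regvarM hw1 (regvar_fundamental E1)).
by apply: regvar_index (regvarM h0 h1); ring.
Qed.

Lemma rhow_gt0 x : 0 < x -> 0 < rhow x.
Proof. exact: regvar_gt0 regvar_rhow. Qed.

Lemma rhowE x : 0 < x -> rhow x * (w1 x * phi1 x) = w0 x * phi0 x.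
Proof.
move=> x0; rewrite /rhow divfK// gt_eqF// mulr_gt0 ?phi1_gt0//.
exact: regvar_gt0 hw1 x0.
Qed.

Lemma mpos_Ktail_fun F x : nondecr0 F -> mpos (cut `]x, +oo[ (wtail w0 F)).
Proof.
move=> hF; apply: mpos_cutT; first exact: measurable_itv.
exact: mpos_wtail hw0 hF.
Qed.

Lemma mpos_Khead_fun F x : nondecr0 F ->
  mpos (cut `]0%R, x[ (fun y => wsup w1 F `]y, x[)).
Proof.
move=> hF.
have ge0 y : 0 < y -> (0 <= cut `]0%R, x[ (fun y => wsup w1 F `]y, x[) y)%E.
  move=> y0; rewrite /cut; case: ifPn => //; rewrite inE /= in_itv/= => /andP[_ yx].
  apply: (le_trans (wF_ge0 (z := (y + x) / 2) hw1 hF _)); first by lra.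
  by apply: le_wsup; rewrite /= in_itv/=; apply/andP; split; lra.
apply: mpos_nonincreasing => // y z y0 yz.
have [zx|xz] := ltP z x; last first.
  rewrite [leLHS](_ : _ = 0%E) ?ge0// /cut memNset//= in_itv/=.
  by apply/negP; rewrite negb_and -!leNgt xz orbT.
rewrite /cut !mem_set/= ?in_itv/= ?zx ?(le_lt_trans yz zx) ?y0 ?(lt_le_trans y0 yz)//.
by apply: wsup_sub => t /=; rewrite !in_itv/= => /andP[/(le_lt_trans yz) -> ->].
Qed.

Lemma Kmodel_ge0 F x : nondecr0 F -> 0 < x -> (0 <= Kmodel F x)%E.
Proof.
move=> hF x0; rewrite !adde_ge0// ?mule_ge0//.
- by apply: ri_nneg; exact: mpos_Ktail_fun.
- by rewrite lee_fin ltW// phi0_gt0.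
- exact: wtail_ge0 hw0 hF (ltW x0).
- by rewrite lee_fin ltW// rhow_gt0.
- by apply: ri_nneg; exact: mpos_Khead_fun.
Qed.

(** [G1] and [G0] stand for the rearrangements of a function truncated
    at the level [lam = F x] and of the remaining excess. Before [x]
    the weighted supremum of [G0] is at most that of [F] at [x], and beyond [x]
    at most that of [F], which gives the first two terms of the model. That of [G1] is
    bounded before [x] by the third term, up to the contribution of the
    constant [lam] from [x] on; as [w1] decays exponentially, the latter has a
    norm of the order of [lam * w1 x * phi1 x], and [rhow x] times this is
    [lam * w0 x * phi0 x], a part of the middle term. *)
Lemma Kmodel_upper : exists2 C : R, 0 < C & forall F G0 G1 (x lam : R),
  nondecr0 F -> nondecr0 G0 -> nondecr0 G1 -> 0 < x -> 0 <= lam ->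
  F x = lam%:E -> (forall z, (G0 z <= F z)%E) -> (forall z, z <= x -> G0 z = 0%E) ->
  (forall z, (G1 z <= F z)%E) -> (forall z, (G1 z <= lam%:E)%E) ->
  (E0 (wtail w0 G0) <= Kmodel F x)%E /\
  ((rhow x)%:E * E1 (wtail w1 G1) <= C%:E * Kmodel F x)%E.
Proof.
have [D D0 hD] := regvar_decayW k1_gt0 hw1.
have [T T0 hT] := ri_regvar_tail E1 k1_gt0 hw1.
have [B B0 hB] := wF_le_wtail hw0.
pose f1 := fundamental E1 1; have f10 : 0 < f1 by exact: fundamental_gt0.
pose C := (D + D * T / f1) * B.
have DT0 : 0 < D + D * T / f1 by rewrite addr_gt0// divr_gt0// mulr_gt0.
exists (1 + C) => [|F G0 G1 x lam hF hG0 hG1 x0 lam0 Fx G0F G00 G1F G1l].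
  by rewrite addr_gt0 ?mulr_gt0.
have p0 := phi0_gt0 x0; have p1 := phi1_gt0 x0; have r0 := rhow_gt0 x0.
have M0 : (0 <= wtail w0 F x)%E by apply: wtail_ge0 hw0 hF _; exact: ltW.
have tl0 : (0 <= Ktail F x)%E by apply: ri_nneg; exact: mpos_Ktail_fun.
have hd0 : (0 <= Khead F x)%E by apply: ri_nneg; exact: mpos_Khead_fun.
have Q0 : (0 <= (phi0 x)%:E * wtail w0 F x)%E by rewrite mule_ge0// lee_fin ltW.
have rh0 : (0 <= (rhow x)%:E * Khead F x)%E by rewrite mule_ge0// lee_fin ltW.
have m0x : measurable (`]0, x] : set R) by exact: measurable_itv.
have p0x : `]0, x] `<=` (pos_itv : set R).
  by move=> y /=; rewrite in_itv/= pos_itvE => /andP[].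
have l0x : (lebesgue_measure (`]0%R, x] : set R) <= (1 + x)%:E)%E.
  by rewrite lebesgue_measure_itv/= lte_fin x0 oppr0 adde0 lee_fin lerDr.
split.
- apply: (@le_trans _ _ (Ktail F x + (phi0 x)%:E * wtail w0 F x)%E); last by rewrite leeDl.
  rewrite [X in (_ <= _ + X)%E]muleC; apply: ri_le_split => //.
  + exact: mpos_wtail hw0 hG0.
  + exact: mpos_Ktail_fun.
  + move=> y y0 yx; apply: wtail_le => z yz; have z0 := lt_trans y0 yz.
    have [zx|xz] := leP z x; first by rewrite G00// mule0.
    apply: le_trans (le_wtail _ _ xz); rewrite lee_wpmul2l// lee_fin.
    exact: regvar_ge0 hw0 z0.
  + move=> y xy; apply: wtail_le => z yz; apply: le_trans (le_wtail _ _ yz).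
    by rewrite lee_wpmul2l// lee_fin (regvar_ge0 hw0)// (lt_trans _ yz)// (lt_trans x0).
- have w1x := regvar_gt0 hw1 x0.
  have step : (E1 (wtail w1 G1) <=
      Khead F x + ((D + D * T / f1) * lam * w1 x * phi1 x)%:E)%E.
    have mc : mpos (cut `]0%R, x] (fun=> (D * lam * w1 x)%:E)).
      apply: mpos_cut => // y _ _; rewrite lee_fin !mulr_ge0// ltW//.
    have mt : mpos (cut `]x, +oo[ (EFin \o w1)).
      by apply: mpos_cutT; [exact: measurable_itv|exact: regvar_mpos hw1].
    have Dl : 0 <= D * lam by rewrite mulr_ge0// ltW.
    have mt' : mpos (fun y => (D * lam)%:E * cut `]x, +oo[ (EFin \o w1) y)%E.
      exact: mposZ.
    apply: (@le_trans _ _ (E1 (fun y => cut `]0%R, x[ (fun y => wsup w1 F `]y, x[) y +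
      (cut `]0%R, x] (fun=> (D * lam * w1 x)%:E) y +
       (D * lam)%:E * cut `]x, +oo[ (EFin \o w1) y))%E)).
      apply: ri_le_pt => [||y y0]; first exact: mpos_wtail hw1 hG1.
        by apply: mposD; [exact: mpos_Khead_fun|exact: mposD].
      have c0 : (0 <= cut `]0%R, x[ (fun y => wsup w1 F `]y, x[) y)%E.
        by apply: (mpos_Khead_fun x hF).2; rewrite pos_itvE.
      have w1G z : x <= z -> ((w1 z)%:E * G1 z <= (D * lam * w1 x)%:E)%E.
        move=> xz; apply: (@le_trans _ _ ((w1 z)%:E * lam%:E)%E).
          by rewrite lee_wpmul2l// lee_fin (regvar_ge0 hw1)// (lt_le_trans x0 xz).
        by rewrite -EFinM lee_fin mulrAC ler_wpM2r// hD.
      have [yx|xy] := leP y x.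
        rewrite [X in (_ <= _ + (X + _))%E](_ : _ = (D * lam * w1 x)%:E); last first.
          by rewrite /cut mem_set//= in_itv/= y0 yx.
        rewrite [X in (_ <= _ + (_ + X))%E](_ : _ = 0%E) ?adde0; last first.
          by rewrite /cut memNset ?mule0//= in_itv/= andbT; apply/negP; rewrite -leNgt.
        apply: wtail_le => z yz; have z0 := lt_trans y0 yz.
        have [zx|xz] := ltP z x; last first.
          by apply: (le_trans (w1G _ xz)); rewrite leeDr.
        have yx' := lt_trans yz zx.
        apply: (@le_trans _ _ (wsup w1 F `]y, x[)).
          apply: (@le_trans _ _ ((w1 z)%:E * F z)%E).
            by rewrite lee_wpmul2l// lee_fin (regvar_ge0 hw1).
          by apply: le_wsup; rewrite /= in_itv/= yz.
        rewrite /cut mem_set/= ?in_itv/= ?y0// leeDl// lee_fin !mulr_ge0// ltW//.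
      rewrite [X in (_ <= _ + (X + _))%E](_ : _ = 0%E) ?add0e; last first.
        rewrite /cut memNset//= in_itv/=; apply/negP.
        by rewrite negb_and -!ltNge xy orbT.
      rewrite [X in (_ <= _ + _ * X)%E](_ : _ = (w1 y)%:E); last first.
        by rewrite /cut mem_set//= in_itv/= andbT.
      apply: wtail_le => z yz; have z0 := lt_trans y0 yz.
      apply: (@le_trans _ _ ((D * lam)%:E * (w1 y)%:E)%E); last by rewrite leeDr.
      apply: (@le_trans _ _ ((w1 z)%:E * lam%:E)%E).
        by rewrite lee_wpmul2l// lee_fin (regvar_ge0 hw1).
      by rewrite -!EFinM lee_fin mulrAC ler_wpM2r// hD// ltW.
    apply: le_trans (ri_normD _ (mpos_Khead_fun x hF) (mposD mc mt')) _.
    rewrite leeD2l//; apply: le_trans (ri_normD _ mc mt') _.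
    rewrite (_ : (D + D * T / f1) * lam * w1 x * phi1 x =
      D * lam * w1 x * phi1 x + (D * lam * (T * w1 x)) * (phi1 x / f1)); last first.
      by field; rewrite gt_eqF.
    rewrite EFinD leeD//.
      rewrite [leRHS]EFinM; apply: ri_le_const => //; first by rewrite addr_gt0.
      by rewrite lee_fin !mulr_ge0// ltW.
    rewrite (ri_scale (ri_normP E1))//.
    apply: (@le_trans _ _ ((D * lam)%:E * (T * w1 x)%:E)%E).
      by rewrite lee_wpmul2l// hT.
    rewrite -EFinM lee_fin ler_peMr ?mulr_ge0 ?(ltW D0) ?(ltW T0) ?(ltW w1x)//.
    by rewrite ler_pdivlMr// mul1r phi1_ge.
  apply: (@le_trans _ _ ((rhow x)%:E * Khead F x +
      C%:E * ((phi0 x)%:E * wtail w0 F x))%E).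
    apply: (@le_trans _ _ ((rhow x)%:E * (Khead F x +
        ((D + D * T / f1) * lam * w1 x * phi1 x)%:E))%E).
      by rewrite lee_pmul2l.
    rewrite muleDr//; last by rewrite fin_num_adde_defl.
    rewrite leeD2l// -EFinM.
    rewrite (_ : rhow x * _ = ((D + D * T / f1) * phi0 x) * (w0 x * lam)); last first.
      by transitivity (rhow x * (w1 x * phi1 x) * ((D + D * T / f1) * lam)); [ring|rewrite rhowE//; ring].
    apply: (@le_trans _ _ (((D + D * T / f1) * phi0 x)%:E * (B%:E * wtail w0 F x))%E).
      rewrite EFinM lee_wpmul2l//; first by rewrite lee_fin mulr_ge0 ?(ltW DT0) ?(ltW p0).
      by rewrite EFinM -Fx; exact: hB.
    by rewrite !muleA -!EFinM /C mulrAC.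
  have C0 : 0 <= C by rewrite /C mulr_ge0// ltW.
  have Km0 := Kmodel_ge0 hF x0.
  rewrite EFinD ge0_muleDl// mul1e; apply: leeD.
    by rewrite /Kmodel leeDr// adde_ge0.
  rewrite lee_wpmul2l// /Kmodel -addeA; apply: (@le_trans _ _ _ _ _ _ (leeDr _ tl0)).
  by rewrite leeDl.
Qed.

(** [G0] and [G1] stand for the rearrangements of the two parts of a
    decomposition, and [n0] and [n1] for their norms. By subadditivity each term
    of the model splits into a part from [G0] and one from [G1]. The norm of
    [G0] is the natural bound for its share of the first two terms, and that
    of [G1] for its share of the third one. The crossed parts are estimated
    pointwise through [wtail_embedding], and the bounds can be summed because
    [w0 / w1] decays and [(rhow * phi1)^-1] grows exponentially. *)
Lemma Kmodel_lower : exists2 C : R, 0 < C & forall F G0 G1 (n0 n1 x : R),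
  nondecr0 F -> nondecr0 G0 -> nondecr0 G1 -> 0 < x -> 0 <= n0 -> 0 <= n1 ->
  (forall z, 0 < z -> (F z <= G0 (z + 1)%R + G1 (z + 1)%R)%E) ->
  (E0 (wtail w0 G0) <= n0%:E)%E -> (E1 (wtail w1 G1) <= n1%:E)%E ->
  (Kmodel F x <= (C * (n0 + rhow x * n1))%:E)%E.
Proof.
have [L0 L00 hL0] := regvar_local hw0.
have [L1 L10 hL1] := regvar_local hw1.
have [A0 A00 hA0] := wtail_embedding E0 hw0.
have [A1 A10 hA1] := wtail_embedding E1 hw1.
have [B0 B00 hB0] := wF_le_wtail hw0.
have k01 : 0 < k0 - k1 by rewrite subr_gt0.
pose q x := w0 x / w1 x.
have hq : regvar (- (k0 - k1)) q.
  by apply: regvar_index (regvarM hw0 (regvarV hw1)); ring.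
have [D D0 hD] := regvar_decayW k01 hq.
have [T T0 hT] := ri_regvar_tail E0 k01 hq.
pose v x := (rhow x * phi1 x)^-1.
have hv : regvar (k0 - k1) v.
  by apply: regvar_index (regvarV (regvarM regvar_rhow (regvar_fundamental E1))); ring.
have [S S0 hS] := regvar_growth k01 hv.
have [L L_0 hL] := regvar_local hv.
pose f0 := fundamental E0 1; have f00 : 0 < f0 by exact: fundamental_gt0.
pose c1 := L0 * (1 + D * A1 * T / f0).
pose c2 := L0 * (A0 + D * A1).
pose c3 := L1 * (1 + S * L * B0 * A0).
have c10 : 0 < c1 by rewrite mulr_gt0 ?addr_gt0 ?divr_gt0 ?mulr_gt0.
have c20 : 0 < c2 by rewrite mulr_gt0 ?addr_gt0 ?mulr_gt0.
have c30 : 0 < c3 by rewrite mulr_gt0 ?addr_gt0 ?mulr_gt0.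
exists (c1 + c2 + c3) => [|F G0 G1 n0 n1 x hF hG0 hG1 x0 n00 n10 FG h0 h1].
  by rewrite !addr_gt0.
have w0p z : 0 < z -> 0 < w0 z by exact: regvar_gt0 hw0.
have w1p z : 0 < z -> 0 < w1 z by exact: regvar_gt0 hw1.
have p0 := phi0_gt0 x0; have p1 := phi1_gt0 x0; have r0 := rhow_gt0 x0.
have qx := regvar_gt0 hq x0; have vx := regvar_gt0 hv x0.
(* the weights at [z] and at [z + 1] are comparable *)
have split_term (w : R -> R) (Lw : R) z : 0 < Lw -> (forall z, 0 < z -> 0 < w z) ->
    (forall a b, 0 < a -> 0 < b -> `|a - b| <= 1 -> w a <= Lw * w b) -> 0 < z ->
    ((w z)%:E * F z <= Lw%:E * ((w (z + 1)%R)%:E * G0 (z + 1)%R +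
       (w (z + 1)%R)%:E * G1 (z + 1)%R))%E.
  move=> Lw0 wp hw z0; have z10 : 0 < z + 1 by rewrite addr_gt0.
  rewrite -ge0_muleDr; [|exact: hG0.2|exact: hG1.2].
  rewrite muleA -EFinM; apply: lee_pmul => //.
  - by rewrite lee_fin ltW// wp.
  - exact: hF.2.
  - by rewrite lee_fin hw// opprD addrA subrr add0r normrN1.
  - exact: FG.
have tailD y : 0 <= y ->
    (wtail w0 F y <= L0%:E * (wtail w0 G0 y + wtail w0 G1 y))%E.
  move=> y0; apply: wtail_le => z yz; have z0 := le_lt_trans y0 yz.
  apply: (le_trans (split_term _ _ _ L00 w0p hL0 z0)).
  have yz1 : y < z + 1 by rewrite ltr_wpDr.
  by rewrite lee_pmul2l// leeD// le_wtail.
have emb0 y : 0 < y -> (wtail w0 G0 y <= (A0 * n0 / phi0 y)%:E)%E.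
  move=> y0; have py := phi0_gt0 y0.
  rewrite mulrC EFinM lee_pdivlMl//.
  apply: le_trans (hA0 _ hG0 _ y0) _; rewrite EFinM.
  by rewrite lee_wpmul2l// lee_fin ltW.
have emb1 y : 0 < y -> (wtail w1 G1 y <= (A1 * n1 / phi1 y)%:E)%E.
  move=> y0; have py := phi1_gt0 y0.
  rewrite mulrC EFinM lee_pdivlMl//.
  apply: le_trans (hA1 _ hG1 _ y0) _; rewrite EFinM.
  by rewrite lee_wpmul2l// lee_fin ltW.
pose m1 := A1 * n1 / phi1 x.
have m10 : 0 <= m1 by rewrite divr_ge0 ?mulr_ge0// ltW.
have cross y : x <= y -> (wtail w0 G1 y <= (D * q y * m1)%:E)%E.
  move=> xy; have y0 := lt_le_trans x0 xy; apply: wtail_le => z yz.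
  have z0 := lt_trans y0 yz.
  apply: (@le_trans _ _ ((D * q y)%:E * wtail w1 G1 x)%E); last first.
    rewrite [leRHS]EFinM lee_wpmul2l ?emb1// lee_fin mulr_ge0 ?(ltW D0)//.
    exact: regvar_ge0 hq y0.
  apply: (@le_trans _ _ ((D * q y)%:E * ((w1 z)%:E * G1 z))%E).
    rewrite muleA -EFinM lee_wpmul2r//; first exact: hG1.2.
    rewrite lee_fin -ler_pdivrMr ?w1p//; exact: hD (ltW yz).
  rewrite lee_wpmul2l ?le_wtail ?(le_lt_trans xy)//.
  by rewrite lee_fin mulr_ge0 ?(ltW D0)// (regvar_ge0 hq).
have rhoq : q x * (phi0 x / phi1 x) = rhow x.
  by rewrite /q /rhow; field; rewrite !gt_eqF ?w1p.
have tail_le : (Ktail F x <= (c1 * (n0 + rhow x * n1))%:E)%E.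
  have mt0 := mpos_Ktail_fun x hG0; have mt1 := mpos_Ktail_fun x hG1.
  apply: (@le_trans _ _ (L0%:E * (Ktail G0 x + Ktail G1 x))%E).
    apply: (@le_trans _ _ (L0%:E * E0 (fun y => cut `]x, +oo[ (wtail w0 G0) y +
       cut `]x, +oo[ (wtail w0 G1) y)%E)%E).
      apply: ri_le_scale; [exact: ltW|exact: mpos_Ktail_fun|exact: mposD|].
      move=> y y0; rewrite /cut; case: ifPn => _; last by rewrite adde0 mule0.
      by rewrite tailD// ltW.
    by rewrite lee_pmul2l//; exact: ri_normD.
  have t0 : (Ktail G0 x <= n0%:E)%E.
    apply: le_trans h0; apply: ri_le_pt => //; first exact: mpos_wtail hw0 hG0.
    move=> y y0; rewrite /cut; case: ifPn => // _.
    by apply: wtail_ge0 hw0 hG0 _; exact: ltW.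
  have t1 : (Ktail G1 x <= (D * A1 * T / f0 * rhow x * n1)%:E)%E.
    apply: (@le_trans _ _ ((D * m1)%:E * E0 (cut `]x, +oo[ (EFin \o q)))%E).
      apply: ri_le_scale => //; first by nneg.
        by apply: mpos_cutT; [exact: measurable_itv|exact: regvar_mpos hq].
      move=> y y0; rewrite /cut; case: ifPn => [|_]; last by rewrite mule0.
      rewrite inE /= in_itv/= andbT => xy; apply: (le_trans (cross _ (ltW xy))).
      by rewrite -EFinM mulrAC.
    apply: (@le_trans _ _ ((D * m1)%:E * (T * q x)%:E)%E).
      by rewrite lee_wpmul2l ?hT// lee_fin mulr_ge0// ltW.
    rewrite -EFinM lee_fin.
    rewrite (_ : D * m1 * (T * q x) = D * A1 * T / f0 * rhow x * n1 * (f0 / phi0 x)).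
      rewrite ler_piMr//; last by rewrite ler_pdivrMr// mul1r phi0_ge.
      by nneg.
    by rewrite -rhoq /m1; field; rewrite !gt_eqF.
  apply: (@le_trans _ _ (L0%:E * (n0%:E + (D * A1 * T / f0 * rhow x * n1)%:E))%E).
    by rewrite lee_pmul2l// leeD.
  rewrite -EFinD -EFinM lee_fin /c1 -[leRHS]mulrA ler_pM2l//.
  have : 0 <= rhow x * n1 by nneg.
  have : 0 <= D * A1 * T / f0 * n0 by nneg.
  nra.
have mid_le : ((phi0 x)%:E * wtail w0 F x <= (c2 * (n0 + rhow x * n1))%:E)%E.
  apply: (@le_trans _ _ ((phi0 x)%:E * (L0%:E * ((A0 * n0 / phi0 x)%:E + (D * q x * m1)%:E)))%E).
    rewrite lee_pmul2l//; apply: (le_trans (tailD _ (ltW x0))).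
    by rewrite lee_pmul2l// leeD// ?emb0 ?cross.
  rewrite -EFinD -!EFinM lee_fin.
  rewrite (_ : phi0 x * _ = L0 * (A0 * n0 + D * A1 * (rhow x * n1))); last first.
    by rewrite -rhoq /m1; field; rewrite !gt_eqF.
  rewrite /c2 -[leRHS]mulrA ler_pM2l//.
  have : 0 <= rhow x * n1 by nneg.
  have : 0 <= D * A1 by nneg.
  nra.
have head_le : ((rhow x)%:E * Khead F x <= (c3 * (n0 + rhow x * n1))%:E)%E.
  pose d0 := S * L * B0 * A0 * n0 * v x.
  have d00 : 0 <= d0 by nneg.
  have term z : 0 < z -> z < x ->
      ((w1 (z + 1)%R)%:E * G0 (z + 1)%R <= d0%:E)%E.
    move=> z0 zx; have z10 : 0 < z + 1 by rewrite addr_gt0.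
    have pz := phi0_gt0 z10; have vz := regvar_gt0 hv z10.
    have -> : w1 (z + 1) = v (z + 1) * phi0 (z + 1) * w0 (z + 1).
      rewrite /v /rhow; field; rewrite !gt_eqF ?w1p ?w0p ?phi1_gt0//.
    rewrite EFinM -muleA.
    apply: (@le_trans _ _ ((v (z + 1)%R * phi0 (z + 1)%R)%:E * (B0 * (A0 * n0 / phi0 (z + 1)%R))%:E)%E).
      rewrite lee_wpmul2l ?lee_fin ?mulr_ge0 ?(ltW pz) ?(ltW vz)//.
      apply: (le_trans (hB0 _ hG0 _ z10)); rewrite EFinM lee_pmul2l//.
      exact: emb0.
    rewrite -EFinM lee_fin.
    rewrite [leLHS](_ : _ = v (z + 1) * (B0 * A0 * n0)); last by field; rewrite gt_eqF.
    rewrite [leRHS](_ : _ = S * L * v x * (B0 * A0 * n0)); last by rewrite /d0; ring.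
    rewrite ler_wpM2r ?mulr_ge0 ?(ltW B00) ?(ltW A00)//.
    have x10 : 0 < x + 1 by rewrite addr_gt0.
    have zx1 : z + 1 <= x + 1 by rewrite lerD2r ltW.
    apply: (le_trans (hS _ _ z10 zx1)).
    rewrite -mulrA; apply: (@le_trans _ _ (S * (1 * v (x + 1)))).
      rewrite ler_pM2l// ler_wpM2r ?(regvar_ge0 hv)//.
      rewrite -[leRHS]expR0 ler_expR mulNr oppr_le0 mulr_ge0 ?divr_ge0 ?subr_ge0//.
      exact: ltW.
    rewrite mul1r -mulrA ler_pM2l//; apply: hL => //.
    by rewrite addrAC subrr add0r normr1.
  have hb : (Khead F x <= L1%:E * ((d0 * phi1 x)%:E + n1%:E))%E.
    have m0x : measurable (`]0, x[ : set R) by exact: measurable_itv.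
    have mc : mpos (cut `]0, x[ (fun=> d0%:E)).
      by apply: mpos_cut => // y _ _; rewrite lee_fin.
    have mw := mpos_wtail hw1 hG1.
    apply: (@le_trans _ _ (L1%:E * E1 (fun y => cut `]0%R, x[ (fun=> d0%:E) y +
        wtail w1 G1 y)%E)%E).
      apply: ri_le_scale; [exact: ltW|exact: mpos_Khead_fun|exact: mposD|].
      move=> y y0; rewrite [in leLHS]/cut; case: ifPn => [|_]; last first.
        rewrite mule_ge0 ?lee_fin ?(ltW L10)// adde_ge0//.
          by apply: mc.2; rewrite pos_itvE.
        by apply: wtail_ge0 hw1 hG1 _; exact: ltW.
      rewrite inE /= in_itv/= => /andP[_ yx]; rewrite /cut mem_set ?/= ?in_itv/= ?y0//.
      apply: wsup_le => z /=; rewrite in_itv/= => /andP[yz zx].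
      have z0 := lt_trans y0 yz.
      apply: (le_trans (split_term _ _ _ L10 w1p hL1 z0)).
      rewrite lee_pmul2l// leeD//; first exact: term.
      by apply: le_wtail; rewrite ltr_wpDr.
    rewrite lee_pmul2l//; apply: le_trans (ri_normD _ mc mw) _; rewrite leeD//.
    rewrite [leRHS]EFinM; apply: ri_le_const => //.
    - by rewrite addr_gt0.
    - exact: initial_pos.
    - by rewrite leb_initial_itv ?lee_fin ?lerDr// ltW.
  apply: (@le_trans _ _ ((rhow x)%:E * (L1%:E * ((d0 * phi1 x)%:E + n1%:E)))%E).
    by rewrite lee_pmul2l.
  rewrite -EFinD -!EFinM lee_fin.
  rewrite [leLHS](_ : _ = L1 * (S * L * B0 * A0 * n0 + rhow x * n1)); last first.
    by rewrite /d0 /v; field; rewrite !gt_eqF.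
  rewrite /c3 -[leRHS]mulrA ler_pM2l//.
  have : 0 <= rhow x * n1 by nneg.
  have : 0 <= S * L * B0 * A0 by nneg.
  nra.
move: (n0 + _) tail_le mid_le head_le => t ht hm hh.
by rewrite 2!mulrDl 2!EFinD; apply: leeD => //; exact: leeD.
Qed.

End holmstedt.

(** * Hardy inequalities for the model *)

Section hardy.
Context {R : realType}.
Implicit Types (E : riSpace R) (f g G P : R -> \bar R).

Lemma mpos_shift_left (a : R) P : 0 <= a -> mpos P -> mpos (fun x => P (x + a)).
Proof.
move=> a0 [mP P0]; split; last first.
  by move=> x; rewrite pos_itvE => x0; apply: P0; rewrite pos_itvE ltr_wpDr.
apply: (measurable_comp measurable_pos_itv _ mP).
  by move=> _ [x + <-]; rewrite !pos_itvE => x0; rewrite ltr_wpDr.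
by apply: measurable_funD => //; exact: measurable_cst.
Qed.

Lemma mpos_shift_right (a : R) P : 0 <= a -> mpos P ->
  mpos (cut `]a, +oo[ (fun x => P (x - a))).
Proof.
move=> a0 [mP P0]; apply: mpos_cut; first exact: measurable_itv.
  apply: (measurable_comp measurable_pos_itv _ mP).
    by move=> _ [x [_ /=] + <-]; rewrite in_itv/= andbT pos_itvE subr_gt0.
  by apply: measurable_funB => //; exact: measurable_cst.
by move=> x x0 /=; rewrite in_itv/= andbT => ax; apply: P0; rewrite pos_itvE subr_gt0.
Qed.

(** Discrete Hardy inequality: exponentially weighted sums of translates,
    each of which does not increase the norm. *)
Lemma ri_geometric e : 0 < e -> exists2 C : R, 0 < C &
  forall E (A : R) G P (P_ : nat -> R -> \bar R), 0 < A -> mpos G -> mpos P ->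
  (forall n, mpos (P_ n)) -> (forall n, (E (P_ n) <= E P)%E) ->
  (forall x, 0 < x ->
    (G x <= A%:E * \sum_(0 <= n <oo) (expR (- e * n%:R))%:E * P_ n x)%E) ->
  (E G <= (C * A)%:E * E P)%E.
Proof.
move=> e0; have [S S0 hS] := @cvg_exp_geometric R _ e0.
exists S => // E A G P P_ A0 mG mP mP_ hP hG.
have mZ n : mpos (fun x => (expR (- e * n%:R))%:E * P_ n x)%E.
  by apply: mposZ => //; exact: expR_ge0.
apply: (@le_trans _ _ (A%:E * E (fun x => \sum_(0 <= n <oo)
    (expR (- e * n%:R))%:E * P_ n x))%E).
  by apply: ri_le_scale => //; [exact: ltW|exact: mpos_nneseries].
rewrite [S * A]mulrC EFinM -muleA lee_pmul2l//.
apply: le_trans (ri_nneseries _ mZ) _.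
apply: (@le_trans _ _ (\sum_(0 <= n <oo) (expR (- e * n%:R))%:E * E P)%E).
  apply: lee_nneseries => [n _ _|n _]; first exact: ri_nneg.
  by rewrite (ri_scale (ri_normP E)) ?expR_ge0// lee_pmul2l ?lte_fin ?expR_gt0.
have EP0 := ri_nneg E mP.
case: (E P) EP0 => [r| |]// r0; last by rewrite gt0_muley ?lte_fin// leey.
rewrite (eq_eseriesr (g := fun n => (r%:E * (expR (- e * n%:R))%:E)%E)); last first.
  by move=> n _; rewrite muleC.
rewrite nneseriesZl; last by move=> n _; rewrite lee_fin expR_ge0.
by rewrite muleC lee_wpmul2r.
Qed.

Lemma ri_geometric_left e : 0 < e -> exists2 C : R, 0 < C &
  forall E (A : R) G P, 0 < A -> mpos G -> mpos P ->
  (forall x, 0 < x ->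
    (G x <= A%:E * \sum_(0 <= n <oo) (expR (- e * n%:R))%:E * P (x + n%:R)%R)%E) ->
  (E G <= (C * A)%:E * E P)%E.
Proof.
move=> e0; have [C C0 h] := ri_geometric e0; exists C => // E A G P A0 mG mP hG.
apply: (h _ _ _ _ (fun n x => P (x + n%:R))) => // n; first exact: mpos_shift_left.
by apply: ri_shift_left => //; exact: mpos_shift_left.
Qed.

Lemma ri_geometric_right e : 0 < e -> exists2 C : R, 0 < C &
  forall E (A : R) G P, 0 < A -> mpos G -> mpos P ->
  (forall x, 0 < x -> (G x <= A%:E * \sum_(0 <= n <oo) (expR (- e * n%:R))%:E *
     cut `]n%:R, +oo[ (fun y => P (y - n%:R)%R) x)%E) ->
  (E G <= (C * A)%:E * E P)%E.
Proof.
move=> e0; have [C C0 h] := ri_geometric e0; exists C => // E A G P A0 mG mP hG.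
apply: (h _ _ _ _ (fun n => cut `]n%:R, +oo[ (fun y => P (y - n%:R)))) => // n.
  exact: mpos_shift_right.
by apply: ri_shift_right => //; exact: mpos_shift_right.
Qed.

End hardy.

Section hardy_holmstedt.
Context {R : realType} (E E0 E1 : riSpace R) (w0 w1 d : R -> R) (k0 k1 mu : R).
Hypotheses (k1_gt0 : 0 < k1) (k10 : k1 < k0).
Hypotheses (hw0 : regvar (- k0) w0) (hw1 : regvar (- k1) w1) (hd : regvar mu d).
Implicit Types (F : R -> \bar R).

Let phi0 x := fundamental E0 (1 + x).
Let phi1 x := fundamental E1 (1 + x).
Let rho := rhow E0 E1 w0 w1.

Definition tailpart F x : \bar R := ((d x)%:E * Ktail E0 w0 F x)%E.
Definition midpart F x : \bar R := ((d x * phi0 x)%:E * wtail w0 F x)%E.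
Definition headpart F x : \bar R := ((d x * rho x)%:E * Khead E1 w1 F x)%E.
(** What the middle term would be if the supremum in it were attained at [x],
    and, by [coreE], what the head term would be if its suprema were. *)
Definition corepart F x : \bar R := ((d x * phi0 x * w0 x)%:E * F x)%E.
Definition Kpart F x : \bar R := ((d x)%:E * Kmodel E0 E1 w0 w1 F x)%E.

Let hrho : regvar (- (k0 - k1)) rho. Proof. exact: regvar_rhow. Qed.
Let hphi0 : regvar 0 phi0. Proof. exact: regvar_fundamental. Qed.
Let hphi1 : regvar 0 phi1. Proof. exact: regvar_fundamental. Qed.

Lemma regvar_dphi0 : regvar mu (fun x => d x * phi0 x).
Proof. by apply: regvar_index (regvarM hd hphi0); rewrite addr0. Qed.

Lemma regvar_core : regvar (mu - k0) (fun x => d x * phi0 x * w0 x).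
Proof. exact: regvarM regvar_dphi0 hw0. Qed.

Lemma regvar_drho : regvar (mu - (k0 - k1)) (fun x => d x * rho x).
Proof. exact: regvarM hd hrho. Qed.

Lemma coreE x : 0 < x -> d x * phi0 x * w0 x = d x * rho x * (phi1 x * w1 x).
Proof.
move=> x0; have h : rho x * (w1 x * phi1 x) = w0 x * phi0 x := rhowE E0 E1 w0 hw1 x0.
by transitivity (d x * (w0 x * phi0 x)); [ring|rewrite -h; ring].
Qed.

Lemma mpos_core F : nondecr0 F -> mpos (corepart F).
Proof. exact: mpos_wF regvar_core. Qed.

Lemma Ktail_nonincr F x y : nondecr0 F -> x <= y ->
  (Ktail E0 w0 F y <= Ktail E0 w0 F x)%E.
Proof.
move=> hF xy; apply: ri_le_pt => [||z z0].
- exact: mpos_Ktail_fun hw0 _ _ hF.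
- exact: mpos_Ktail_fun hw0 _ _ hF.
- rewrite /cut; case: ifPn => [|_].
    rewrite inE /= in_itv/= andbT => yz.
    by rewrite mem_set//= in_itv/= andbT (le_lt_trans xy).
  case: ifPn => // _; exact: wtail_ge0 hw0 hF (ltW z0).
Qed.

Lemma mpos_Ktail F : nondecr0 F -> mpos (Ktail E0 w0 F).
Proof.
move=> hF; apply: mpos_nonincreasing => [x y _|x _]; first exact: Ktail_nonincr.
by apply: ri_nneg; exact: mpos_Ktail_fun hw0 _ _ hF.
Qed.

Lemma Khead_nondecr F x y : nondecr0 F -> x <= y ->
  (Khead E1 w1 F x <= Khead E1 w1 F y)%E.
Proof.
move=> hF xy; apply: ri_le_pt => [||z z0].
- exact: mpos_Khead_fun hw1 _ _ hF.
- exact: mpos_Khead_fun hw1 _ _ hF.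
- rewrite [leLHS]/cut; case: ifPn => [|_]; last first.
    by apply: (mpos_Khead_fun hw1 y hF).2; rewrite pos_itvE.
  rewrite inE /= in_itv/= => /andP[_ zx].
  rewrite /cut mem_set/=; last by rewrite in_itv/= z0 (lt_le_trans zx).
  by apply: wsup_sub => t /=; rewrite !in_itv/= => /andP[-> /lt_le_trans->].
Qed.

Lemma mpos_Khead F : nondecr0 F -> mpos (Khead E1 w1 F).
Proof.
move=> hF; apply: mpos_nondecreasing => [x y _|x _]; first exact: Khead_nondecr.
by apply: ri_nneg; exact: mpos_Khead_fun hw1 _ _ hF.
Qed.

Lemma mpos_tailpart F : nondecr0 F -> mpos (tailpart F).
Proof. by move=> hF; exact: mposM (regvar_mpos hd) (mpos_Ktail hF). Qed.

Lemma mpos_midpart F : nondecr0 F -> mpos (midpart F).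
Proof.
by move=> hF; exact: mposM (regvar_mpos regvar_dphi0) (mpos_wtail hw0 hF).
Qed.

Lemma mpos_headpart F : nondecr0 F -> mpos (headpart F).
Proof. by move=> hF; exact: mposM (regvar_mpos regvar_drho) (mpos_Khead hF). Qed.

Lemma KpartE F x : nondecr0 F -> 0 < x ->
  Kpart F x = (tailpart F x + midpart F x + headpart F x)%E.
Proof.
move=> hF x0; have px : pos_itv x by rewrite pos_itvE.
have p0 : 0 <= phi0 x by exact: regvar_ge0 hphi0 x0.
have r0 : 0 <= rho x by exact: regvar_ge0 hrho x0.
have t0 := (mpos_Ktail hF).2 _ px; have h0 := (mpos_Khead hF).2 _ px.
have m0 := wtail_ge0 hw0 hF (ltW x0).
have pm0 : (0 <= (phi0 x)%:E * wtail w0 F x)%E by rewrite mule_ge0.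
have rh0 : (0 <= (rho x)%:E * Khead E1 w1 F x)%E by rewrite mule_ge0.
rewrite /Kpart /Kmodel ge0_muleDr//; last by rewrite adde_ge0.
by rewrite ge0_muleDr// !muleA -!EFinM.
Qed.

Lemma mpos_Kpart F : nondecr0 F -> mpos (Kpart F).
Proof.
move=> hF; apply: mpos_eq (mposD (mposD (mpos_tailpart hF) (mpos_midpart hF))
  (mpos_headpart hF)) _ => x x0; exact: KpartE.
Qed.

Lemma ri_Kpart_le F : nondecr0 F ->
  (E (Kpart F) <= E (tailpart F) + E (midpart F) + E (headpart F))%E.
Proof.
move=> hF; have mt := mpos_tailpart hF; have mm := mpos_midpart hF.
have mh := mpos_headpart hF.
rewrite (ri_eq_pt E (mpos_Kpart hF) (fun x => KpartE hF)).
apply: le_trans (ri_normD _ (mposD mt mm) mh) _.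
by rewrite leeD2r//; exact: ri_normD.
Qed.

Lemma ri_Kpart_ge F : nondecr0 F ->
  [/\ (E (tailpart F) <= E (Kpart F))%E, (E (midpart F) <= E (Kpart F))%E &
      (E (headpart F) <= E (Kpart F))%E].
Proof.
move=> hF; have mt := mpos_tailpart hF; have mm := mpos_midpart hF.
have mh := mpos_headpart hF; have mK := mpos_Kpart hF.
have p x : 0 < x -> (pos_itv : set R) x by rewrite pos_itvE.
split; apply: ri_le_pt => // x x0; rewrite KpartE//;
  have t0 := mt.2 _ (p _ x0); have m0 := mm.2 _ (p _ x0); have h0 := mh.2 _ (p _ x0).
- by rewrite -addeA leeDl// adde_ge0.
- by rewrite addeAC leeDr// adde_ge0.
- by rewrite leeDr// adde_ge0.
Qed.

(** In the sum over unit blocks beyond [x], the exponential growth of [d]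
    bounds the [n]-th term by [expR (- (mu / 2) * n%:R)] times the translate of
    the middle term by [n]. *)
Lemma ri_tailpart_le : 0 < mu -> exists2 C : R, 0 < C &
  forall F, nondecr0 F -> (E (tailpart F) <= C%:E * E (midpart F))%E.
Proof.
move=> mu0; have mu20 : 0 < mu / 2 by rewrite divr_gt0.
have [C C0 hC] := ri_geometric_left mu20.
have [A A0 hA] := regvar_growth mu0 hd.
exists (C * A) => [|F hF]; first by rewrite mulr_gt0.
apply: hC => //; [exact: mpos_tailpart|exact: mpos_midpart|] => x x0.
have d0 := regvar_gt0 hd x0.
have W0 y : 0 < y -> (0 <= wtail w0 F y)%E by move=> y0; exact: wtail_ge0 hw0 hF (ltW y0).
have xn n : 0 < x + n%:R by rewrite ltr_wpDr.
have f10 := fundamental_gt0 E0 (@ltr01 R).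
apply: (@le_trans _ _ ((d x)%:E *
    \sum_(0 <= n <oo) (wtail w0 F (x + n%:R)%R * (fundamental E0 1)%:E))%E).
  rewrite lee_pmul2l//; apply: ri_le_blocks => //.
  - exact: ltW.
  - exact: mpos_Ktail_fun hw0 _ _ hF.
  - by move=> n; exact: W0.
  - by move=> n y ny _; apply: wtail_nonincr; exact: ltW.
rewrite -nneseriesZl; last by move=> n _; rewrite mule_ge0 ?W0// lee_fin ltW.
rewrite -nneseriesZl; last first.
  move=> n _; rewrite mule_ge0 ?lee_fin ?expR_ge0//.
  by apply: (mpos_midpart hF).2; rewrite pos_itvE.
apply: lee_nneseries => [n _ _|n _].
  by rewrite !mule_ge0 ?W0// lee_fin ltW.
rewrite /midpart !muleA -!EFinM muleAC -EFinM lee_wpmul2r ?W0//.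
rewrite lee_fin; have pn := phi0_gt0 E0 (xn n); have p1 := phi0_ge E0 (xn n).
have dn := regvar_gt0 hd (xn n).
apply: (@le_trans _ _ ((A * expR (- (mu / 2) * n%:R) * d (x + n%:R)) * phi0 (x + n%:R))).
  apply: ler_pM => //; [exact: ltW|exact: ltW|].
  have := hA x (x + n%:R) x0; rewrite lerDl ler0n => /(_ isT).
  by rewrite addrAC subrr add0r.
by rewrite le_eqVlt; apply/orP; left; apply/eqP; ring.
Qed.

Lemma wtail_leZ w F (c x : R) (a : \bar R) : 0 < c ->
  (forall z, x < z -> (c%:E * ((w z)%:E * F z) <= a)%E) -> (c%:E * wtail w F x <= a)%E.
Proof.
move=> c0 h; rewrite -lee_pdivlMl//; apply: wtail_le => z xz.
by rewrite lee_pdivlMl// h.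
Qed.

(** A value of [w0 * F] at distance between [n] and [n + 1] beyond [x] is
    bounded by the core at [x + n + 1], with a factor that the exponential
    growth of [d * phi0] makes geometric. *)
Lemma ri_midpart_le : 0 < mu -> exists2 C : R, 0 < C &
  forall F, nondecr0 F -> (E (midpart F) <= C%:E * E (corepart F))%E.
Proof.
move=> mu0; have mu20 : 0 < mu / 2 by rewrite divr_gt0.
have [C C0 hC] := ri_geometric_left mu20.
have [A A0 hA] := regvar_growth mu0 regvar_dphi0.
have [L L0 hL] := wF_local regvar_core.
exists (C * (A * L * expR (mu / 2))) => [|F hF]; first by rewrite !mulr_gt0 ?expR_gt0.
have mc := mpos_core hF.
apply: hC => //; [by rewrite !mulr_gt0 ?expR_gt0|exact: mpos_midpart|] => x x0.
apply: wtail_leZ; first exact: regvar_gt0 regvar_dphi0 x0.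
move=> z xz; have z0 := lt_trans x0 xz; have [n [n1 n2]] := block_index xz.
have wz := regvar_gt0 hw0 z0.
apply: (@le_trans _ _ ((A * expR (- (mu / 2) * n%:R))%:E * corepart F z)%E).
  rewrite /corepart !muleA -!EFinM lee_wpmul2r//; first exact: hF.2.
  rewrite lee_fin mulrA ler_pM2r//; apply: (le_trans (hA _ _ x0 (ltW xz))).
  rewrite ler_wpM2r ?(regvar_ge0 regvar_dphi0)// ler_pM2l// ler_expR.
  rewrite !mulNr lerN2 ler_pM2l//; lra.
have xn10 : 0 < x + n.+1%:R by rewrite ltr_wpDr.
apply: (@le_trans _ _ ((A * expR (- (mu / 2) * n%:R))%:E *
    (L%:E * corepart F (x + n.+1%:R)%R))%E).
  rewrite lee_pmul2l ?lte_fin ?mulr_gt0 ?expR_gt0//; apply: hL => //.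
  by rewrite -natr1; lra.
apply: (@le_trans _ _ ((A * L * expR (mu / 2))%:E *
    ((expR (- (mu / 2) * n.+1%:R))%:E * corepart F (x + n.+1%:R)%R))%E).
  have : (0 <= corepart F (x + n.+1%:R)%R)%E by apply: mc.2; rewrite pos_itvE.
  move: (corepart F _) => c c0; rewrite !muleA -!EFinM lee_wpmul2r//.
  rewrite lee_fin -(mulrA (A * L)) -expRD.
  rewrite (_ : mu / 2 + _ = - (mu / 2) * n%:R); last by rewrite -natr1; ring.
  by rewrite le_eqVlt; apply/orP; left; apply/eqP; ring.
rewrite lee_pmul2l ?lte_fin ?mulr_gt0 ?expR_gt0//.
apply: (le_nneseries_term (a := fun m => (expR (- (mu / 2) * m%:R))%:E *
  corepart F (x + m%:R)%R)%E n.+1) => m.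
rewrite mule_ge0 ?lee_fin ?expR_ge0//; apply: mc.2.
by rewrite pos_itvE ltr_wpDr.
Qed.

(** The dual situation: [d * rho * phi1] decays exponentially, so the values of
    [w1 * F] at distance about [n] before [x] enter with geometric factors, and
    the translates go to the right. *)
Lemma ri_headpart_le : mu < k0 - k1 -> exists2 C : R, 0 < C &
  forall F, nondecr0 F -> (E (headpart F) <= C%:E * E (corepart F))%E.
Proof.
move=> muk; pose nu := k0 - k1 - mu; have nu0 : 0 < nu by rewrite subr_gt0.
have nu20 : 0 < nu / 2 by rewrite divr_gt0.
have [C C0 hC] := ri_geometric_right nu20.
pose V x := d x * rho x * phi1 x.
have hV : regvar (- nu) V.
  by apply: regvar_index (regvarM regvar_drho hphi1); rewrite /nu; ring.
have [A A0 hA] := regvar_decay nu0 hV.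
have [L L0 hL] := wF_local regvar_core.
exists (C * (A * L)) => [|F hF]; first by rewrite !mulr_gt0.
have mc := mpos_core hF.
apply: hC => //; [by rewrite !mulr_gt0|exact: mpos_headpart|] => x x0.
set T := (_ * _)%E.
have T0 n : (0 <= (expR (- (nu / 2) * n%:R))%:E *
   cut `]n%:R, +oo[ (fun y => corepart F (y - n%:R)%R) x)%E.
  rewrite mule_ge0 ?lee_fin ?expR_ge0//.
  by apply: (mpos_shift_right (ler0n _ n) mc).2; rewrite pos_itvE.
have T_0 : (0 <= T)%E.
  by rewrite mule_ge0 ?lee_fin ?mulr_ge0 ?(ltW A0) ?(ltW L0)//; apply: nneseries_ge0.
have Vx := regvar_gt0 hV x0; have px := phi1_gt0 E1 x0.
have dr := regvar_gt0 regvar_drho x0.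
have key z : 0 < z -> z < x -> ((w1 z)%:E * F z <= ((V x)^-1)%:E * T)%E.
  move=> z0 zx; rewrite lee_pdivlMl//.
  have w1z := regvar_gt0 hw1 z0.
  have xz0 : 0 < x - z by rewrite subr_gt0.
  have /andP[n1 n2] := truncn_itv (ltW xz0).
  set n := Num.Def.trunc _ in n1 n2.
  have xn0 : 0 < x - n%:R by lra.
  apply: (@le_trans _ _ ((A * expR (- (nu / 2) * n%:R))%:E * corepart F z)%E).
    rewrite /corepart coreE// !muleA -!EFinM lee_wpmul2r//; first exact: hF.2.
    rewrite lee_fin [leRHS](_ : _ = A * expR (- (nu / 2) * n%:R) * V z * w1 z); last first.
      by rewrite /V; ring.
    rewrite ler_pM2r//; apply: (le_trans (hA _ _ z0 (ltW zx))).
    rewrite ler_wpM2r ?(regvar_ge0 hV)// ler_pM2l// ler_expR !mulNr lerN2.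
    by rewrite ler_pM2l.
  apply: (@le_trans _ _ ((A * expR (- (nu / 2) * n%:R))%:E *
      (L%:E * corepart F (x - n%:R)%R))%E).
    rewrite lee_pmul2l ?lte_fin ?mulr_gt0 ?expR_gt0//; apply: hL => //; first by lra.
    by move: n2; rewrite -natr1; lra.
  rewrite muleA -EFinM mulrAC EFinM -muleA /T lee_pmul2l ?lte_fin ?mulr_gt0//.
  apply: le_trans (le_nneseries_term n T0); rewrite /cut mem_set//= in_itv/= andbT.
  by rewrite -subr_gt0.
rewrite /headpart -lee_pdivlMl//.
have a0 : (0 <= ((V x)^-1)%:E * T)%E by rewrite mule_ge0// lee_fin invr_ge0 ltW.
apply: (@le_trans _ _ (((V x)^-1)%:E * T * (phi1 x)%:E)%E).
  apply: ri_le_const => //.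
  - by rewrite addr_gt0.
  - exact: initial_pos.
  - by rewrite leb_initial_itv ?lee_fin ?lerDr// ltW.
  - exact: mpos_Khead_fun hw1 _ _ hF.
  - move=> y /=; rewrite in_itv/= => /andP[y0 yx]; apply: wsup_le => z /=.
    rewrite in_itv/= => /andP[yz zx]; apply: key => //; exact: lt_trans yz.
rewrite muleAC -EFinM lee_wpmul2r// lee_fin le_eqVlt; apply/orP; left; apply/eqP.
by rewrite /V; field; rewrite !gt_eqF ?(regvar_gt0 hd) ?(regvar_gt0 hrho).
Qed.

Lemma ri_core_mid : exists2 C : R, 0 < C &
  forall F, nondecr0 F -> (E (corepart F) <= C%:E * E (midpart F))%E.
Proof.
have [B B0 hB] := wF_le_wtail hw0; exists B => // F hF.
apply: ri_le_scale; [exact: ltW|exact: mpos_core|exact: mpos_midpart|] => x x0.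
rewrite /corepart /midpart EFinM -muleA [leRHS]muleCA lee_pmul2l ?hB//.
exact: regvar_gt0 regvar_dphi0 x0.
Qed.

(** For all [y < x + 1] the interval [`]y, x + 1[] contains points beyond [x],
    where [w1 * F] is at least a constant times its value at [x]. Hence the
    head at [x + 1] dominates the core at [x]. *)
Lemma ri_core_head : exists2 C : R, 0 < C &
  forall F, nondecr0 F -> (E (corepart F) <= C%:E * E (headpart F))%E.
Proof.
have [L L0 hL] := wF_local hw1.
have [D D0 hD] := regvar_local regvar_drho.
exists (D * L) => [|F hF]; first by rewrite mulr_gt0.
have mh := mpos_headpart hF; have ms := mpos_shift_left ler01 mh.
apply: (@le_trans _ _ ((D * L)%:E * E (fun x => headpart F (x + 1)%R))%E); last first.
  by rewrite lee_pmul2l ?lte_fin ?mulr_gt0//; exact: ri_shift_left.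
apply: ri_le_scale => //; [by rewrite mulr_ge0// ltW|exact: mpos_core|] => x x0.
have px : 0 < phi1 x := phi1_gt0 E1 x0; have x10 : 0 < x + 1 by rewrite addr_gt0.
have dr := regvar_gt0 regvar_drho x0; have dr1 := regvar_gt0 regvar_drho x10.
have wF0 := wF_ge0 hw1 hF x0.
have head : ((L^-1)%:E * ((w1 x)%:E * F x) * (phi1 x)%:E <= Khead E1 w1 F (x + 1))%E.
  rewrite /phi1 addrC; apply: ri_ge_const => //.
  - exact: mpos_Khead_fun hw1 _ _ hF.
  - by rewrite mule_ge0// lee_fin invr_ge0 ltW.
  - move=> y y0 yx; rewrite /cut mem_set/=; last by rewrite in_itv/= y0.
    rewrite lee_pdivrMl//; pose z := (Num.max x y + (x + 1)) / 2.
    have mx : Num.max x y < x + 1 by rewrite gt_max yx ltrDl ltr01.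
    have zx : x <= Num.max x y by rewrite le_max lexx.
    have zy : y <= Num.max x y by rewrite le_max lexx orbT.
    have z1 : x <= z by rewrite /z; lra.
    have z2 : z <= x + 1 by rewrite /z; lra.
    apply: (le_trans (hL _ hF x z x0 z1 z2)); rewrite lee_pmul2l//.
    apply: le_wsup; rewrite /= in_itv/=; apply/andP; split; rewrite /z; lra.
rewrite /corepart coreE//.
apply: (@le_trans _ _ ((D * L * (d (x + 1) * rho (x + 1)))%:E *
    ((L^-1)%:E * ((w1 x)%:E * F x) * (phi1 x)%:E))%E); last first.
  rewrite /headpart [in leRHS]muleA -EFinM lee_pmul2l//.
  by rewrite lte_fin mulr_gt0// mulr_gt0.
rewrite [X in (_ <= _ * X)%E]muleC !muleA -!EFinM lee_wpmul2r//; first exact: hF.2.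
rewrite lee_fin (_ : D * L * _ * _ * _ * _ =
   D * (d (x + 1) * rho (x + 1)) * (phi1 x * w1 x)); last by field; rewrite gt_eqF.
rewrite ler_wpM2r//; first by rewrite mulr_ge0 ?(ltW px)// (regvar_ge0 hw1).
by apply: hD => //; rewrite opprD addrA subrr add0r normrN1.
Qed.

End hardy_holmstedt.

(** * Rearrangements on the unit interval and the norm of B *)

Section rearranged_functions.
Context {R : realType}.
Notation leb := (@lebesgue_measure R).
Implicit Types (f g : R -> R) (E : riSpace R).

Notation mf1 f := (measurable_fun (unit_itv : set R) f).

Definition mdist f (s : R) : \bar R := leb (unit_itv `&` [set x | s < `|f x|]).

Lemma measurable_level f (s : R) : mf1 f ->
  measurable (unit_itv `&` [set x | s < `|f x|]).
Proof.
move=> mf; rewrite (_ : [set x | s < `|f x|] =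
    [set x | (s%:E < (EFin \o (fun y => `|f y|%R)) x)%E]); last first.
  by apply/seteqP; split=> x /=; rewrite lte_fin.
apply: emeasurable_fun_o_infty; first exact: measurable_unit_itv.
by apply/measurable_EFinP; exact: measurableT_comp.
Qed.

Lemma mdist_abs_le f g s : (forall x, unit_itv x -> `|f x| <= `|g x|) ->
  (mdist f s <= mdist g s)%E.
Proof.
move=> fg; apply: lebesgue_measure_le => x [ux /= h]; split => //=.
exact: lt_le_trans (fg _ ux).
Qed.

Lemma lt_fstar f (s t : R) : mf1 f -> 0 <= s ->
  (s%:E < fstar f t)%E <-> (t%:E < mdist f s)%E.
Proof.
move=> mf s0; apply: (@lt_rearr _ _ leb) => //; last exact/measurable_EFinP.
exact: measurable_unit_itv.
Qed.

Lemma fstar_le f (s t : R) : mf1 f -> 0 <= s ->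
  (fstar f t <= s%:E)%E <-> (mdist f s <= t%:E)%E.
Proof.
move=> mf s0; split; rewrite !leNgt => /negP h; apply/negP => h'; apply: h;
  exact/(lt_fstar _ mf s0).
Qed.

Lemma fstar_ge0 f t : (0 <= fstar f t)%E.
Proof. exact: rearr_ge0. Qed.

Lemma fstar_nonincr f t u : t <= u -> (fstar f u <= fstar f t)%E.
Proof. exact: rearr_nonincreasing. Qed.

(** A finite-valued function on a set of finite measure has level sets whose
    measures tend to 0. *)
Lemma fstar_fin f t : mf1 f -> 0 < t -> fstar f t \is a fin_num.
Proof.
move=> mf t0; rewrite ge0_fin_numE ?fstar_ge0// ltNge leye_eq; apply/negP => /eqP ft.
pose L (n : nat) := unit_itv `&` [set x | n%:R < `|f x|].
have mL n : measurable (L n) by exact: measurable_level.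
have L0 : \bigcap_n L n = set0.
  apply/seteqP; split=> x // h; have [_ /= hx] := h (Num.Def.trunc `|f x|).+1 I.
  by have /andP[_] := truncn_itv (normr_ge0 (f x)); rewrite ltNge (ltW hx).
have cv : (leb \o L) @ \oo --> leb (\bigcap_n L n).
  apply: (@nonincreasing_cvg_mu _ (measurableTypeR R) R leb L) => //.
  - apply: (@le_lt_trans _ _ (leb (unit_itv : set R))).
      by apply: lebesgue_measure_le => x [].
    by rewrite lebesgue_measure_itv/= lte_fin ltr01 oppr0 adde0 ltry.
  - by apply: bigcapT_measurable => n; exact: mL.
  - move=> m n mn; apply/subsetPset => x [ux /= h]; split => //=.
    by apply: le_lt_trans h; rewrite ler_nat.
rewrite L0 measure0 in cv.
have : (t%:E <= 0)%E.
  rewrite -(cvg_lim _ cv)//; apply: lime_ge; first by apply/cvg_ex; eexists; exact: cv.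
  apply: nearW => n; apply: ltW; apply/(lt_fstar _ mf) => //.
  by rewrite ft ltry.
by rewrite lee_fin leNgt t0.
Qed.

Definition logstar f (y : R) : \bar R := fstar f (expR (- y)).

Lemma nondecr0_logstar f : nondecr0 (logstar f).
Proof.
split=> [x y xy|x]; last exact: fstar_ge0.
by apply: fstar_nonincr; rewrite ler_expR lerN2.
Qed.

Lemma logstar_fin f y : mf1 f -> logstar f y \is a fin_num.
Proof. by move=> mf; apply: fstar_fin => //; exact: expR_gt0. Qed.

Lemma logstar_abs_le f g y : mf1 f -> mf1 g ->
  (forall x, unit_itv x -> `|f x| <= `|g x|) -> (logstar f y <= logstar g y)%E.
Proof.
move=> mf mg fg; have gf := logstar_fin y mg.
rewrite -[leRHS]fineK//; apply/fstar_le => //; first by rewrite fine_ge0// fstar_ge0.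
apply: le_trans (mdist_abs_le _ fg) _; apply/fstar_le => //.
  by rewrite fine_ge0// fstar_ge0.
by rewrite fineK.
Qed.

(** The familiar inequality [f^*(2 s) <= g^*(s) + h^*(s)], where halving the
    argument is a translation by [ln 2 <= 1] in the logarithmic variable. *)
Lemma logstar_add f g h y : mf1 f -> mf1 g -> mf1 h ->
  (forall x, unit_itv x -> f x = g x + h x) ->
  (logstar f y <= logstar g (y + 1)%R + logstar h (y + 1)%R)%E.
Proof.
move=> mf mg mh fgh.
have gf := logstar_fin (y + 1) mg; have hf := logstar_fin (y + 1) mh.
pose a := fine (logstar g (y + 1)); pose c := fine (logstar h (y + 1)).
have a0 : 0 <= a by rewrite fine_ge0// fstar_ge0.
have c0 : 0 <= c by rewrite fine_ge0// fstar_ge0.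
rewrite -(fineK gf) -(fineK hf) -EFinD -/a -/c.
apply/fstar_le => //; first by rewrite addr_ge0.
have ha : (mdist g a <= (expR (- (y + 1)))%:E)%E by apply/fstar_le => //; rewrite /a fineK.
have hc : (mdist h c <= (expR (- (y + 1)))%:E)%E by apply/fstar_le => //; rewrite /c fineK.
apply: (@le_trans _ _ (mdist g a + mdist h c)%E).
  apply: (@le_trans _ _ (leb ((unit_itv `&` [set x | a < `|g x|]) `|`
     (unit_itv `&` [set x | c < `|h x|])))).
    apply: lebesgue_measure_le => x [ux /= hx].
    have [ag|ga] := ltP a `|g x|; first by left.
    right; split => //=; move: hx; rewrite fgh// => hx.
    have := ler_normD (g x) (h x); lra.
  by apply: measureU2; exact: measurable_level.
apply: le_trans (leeD ha hc) _; rewrite -EFinD lee_fin.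
rewrite opprD expRD -mulr2n -mulrnAr ler_piMr ?expR_ge0//.
rewrite expRN -mulr_natl ler_pdivrMr ?expR_gt0// mul1r.
exact: (@expR_ge1Dx R 1).
Qed.

Definition clip (lam : R) f : R -> R := fun x => Num.max (- lam) (Num.min lam (f x)).

Lemma measurable_clip lam f : mf1 f -> mf1 (clip lam f).
Proof.
move=> mf; apply: measurable_maxr; first exact: measurable_cst.
by apply: measurable_minr => //; exact: measurable_cst.
Qed.

Lemma clipE (lam u : R) : 0 <= lam -> let c := Num.max (- lam) (Num.min lam u) in
  [/\ `|c| <= lam, `|c| <= `|u|, `|u - c| <= `|u| & (0 < `|u - c|) -> lam < `|u|].
Proof.
move=> l0 /=; have [ul|lu] := leP u lam.
  have [lu|ul2] := leP (- lam) u.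
    rewrite subrr normr0 ltxx; split => //.
    by rewrite ler_norml lu ul.
  rewrite normrN (ger0_norm l0).
  have u0 : u <= 0 by lra.
  rewrite (ler0_norm u0) ler0_norm; last by lra.
  by split; lra.
rewrite max_r; last by lra.
have u0 : 0 <= u by lra.
rewrite (ger0_norm l0) (ger0_norm u0) ger0_norm; last by lra.
by split; lra.
Qed.

Lemma logstar_clip f y (lam : R) : mf1 f -> 0 <= lam -> (logstar (clip lam f) y <= lam%:E)%E.
Proof.
move=> mf l0; apply/fstar_le => //; first exact: measurable_clip.
rewrite /mdist (_ : _ `&` _ = set0) ?measure0 ?lee_fin ?expR_ge0//.
apply/seteqP; split=> x // [_ /=]; have [h _ _ _] := clipE (f x) l0.
by rewrite ltNge h.
Qed.

(** The excess over the level [f^*(expR (- x))] is nonzero only where that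
    level is exceeded, on a set of measure at most [expR (- x)]. *)
Lemma logstar_excess f (x y : R) : mf1 f -> y <= x ->
  logstar (fun z => f z - clip (fine (logstar f x)) f z) y = 0%E.
Proof.
move=> mf yx; set lam := fine _.
have l0 : 0 <= lam by rewrite fine_ge0// fstar_ge0.
have mg : mf1 (fun z => f z - clip lam f z).
  by apply: measurable_funB => //; exact: measurable_clip.
apply/eqP; rewrite eq_le fstar_ge0 andbT; apply/fstar_le => //.
apply: (@le_trans _ _ (mdist f lam)).
  apply: lebesgue_measure_le => z [uz /= hz]; split => //=.
  by have [_ _ _] := clipE (f z) l0; exact.
apply: (@le_trans _ _ (expR (- x))%:E); last by rewrite lee_fin ler_expR lerN2.
by apply/fstar_le => //; rewrite fineK// logstar_fin.
Qed.

End rearranged_functions.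

Section averaged_norm.
Context {R : realType}.
Notation leb := (@lebesgue_measure R).
Implicit Types (f g : R -> R) (E : riSpace R).

Notation mf1 f := (measurable_fun (unit_itv : set R) f).

Definition logweight (p a : R) (x : R) : R :=
  expR (- x) `^ p^-1 * ellp (a - 1) (expR (- x)).

Lemma ell_expRN (x : R) : 0 < x -> ell (expR (- x)) = 1 + x.
Proof. by move=> x0; rewrite /ell expRK normrN gtr0_norm. Qed.

Lemma regvar_logweight p a : regvar (- p^-1) (logweight p a).
Proof.
apply: regvar_eq (regvar_index _ (regvarM (regvar_exp (- p^-1))
  (regvar_powR (a - 1) regvar_affine))) _; first by rewrite mulr0 addr0.
move=> x x0; rewrite /logweight /ellp ell_expRN// -expRM.
by congr (expR _ * _); ring.
Qed.

Lemma nneseries_geometric e : 0 < e -> exists2 S : R, 0 < S &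
  forall a : \bar R, (0 <= a)%E ->
  (\sum_(0 <= n <oo) (expR (- e * n%:R))%:E * a <= S%:E * a)%E.
Proof.
move=> e0; have [S S0 hS] := @cvg_exp_geometric R _ e0; exists S => // -[r| |]// r0.
  rewrite (eq_eseriesr (g := fun n => (r%:E * (expR (- e * n%:R))%:E)%E)); last first.
    by move=> n _; rewrite muleC.
  rewrite nneseriesZl; last by move=> n _; rewrite lee_fin expR_ge0.
  by rewrite muleC lee_wpmul2r.
by rewrite gt0_muley ?lte_fin// leey.
Qed.

Lemma measurable_fstar f (t : R) : measurable_fun (`]0, t[ : set R) (fstar f).
Proof.
apply: measurable_fun_nonincreasing; first exact: interval_is_interval.
by move=> x y _ _; exact: fstar_nonincr.
Qed.

Lemma fstarstar_ge0 f t : 0 < t -> (0 <= fstarstar f t)%E.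
Proof.
move=> t0; rewrite /fstarstar mule_ge0 ?lee_fin ?invr_ge0 ?(ltW t0)//.
by apply: integral_ge0 => x _; exact: fstar_ge0.
Qed.

Lemma fstar_le_fstarstar f t : 0 < t -> (fstar f t <= fstarstar f t)%E.
Proof.
move=> t0; rewrite /fstarstar lee_pdivlMl//.
apply: (@le_trans _ _ (\int[leb]_(x in `]0%R, t[) cst (fstar f t) x)%E).
  by rewrite integral_cst//= leb_initial_itv ?(ltW t0)// muleC.
apply: ge0_le_integral => //.
- by move=> x _; exact: fstar_ge0.
- exact: measurable_fstar.
- by move=> x /=; rewrite in_itv/= => /andP[_ xt]; apply: fstar_nonincr; exact: ltW.
Qed.

(** The average is dominated by a geometric sum of translates of the
    rearrangement in the logarithmic variable. *)
Lemma fstarstar_le_sum f (z : R) : mf1 f ->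
  (fstarstar f (expR (- z)) <=
   \sum_(0 <= n <oo) (expR (- 1 * n%:R))%:E * logstar f (z + n.+1%:R)%R)%E.
Proof.
move=> mf; have t0 := expR_gt0 (- z); set t := expR (- z) in t0 *.
have F0 y : (0 <= logstar f y)%E by exact: fstar_ge0.
pose B (n : nat) : set R := `]0, t * expR (- 1 * n%:R)[%classic.
have mB n : measurable (B n) by exact: measurable_itv.
have mi n : measurable_fun (`]0, t[ : set R)
    (fun r => logstar f (z + n.+1%:R) * (\1_(B n) r)%:E)%E.
  apply: emeasurable_funM; first exact: measurable_cst.
  by apply/measurable_EFinP; exact: measurable_indic.
have te n : 0 < t * expR (- 1 * n%:R) by rewrite mulr_gt0// expR_gt0.
rewrite /fstarstar lee_pdivrMl//.
apply: (@le_trans _ _ (\int[leb]_(r in `]0%R, t[)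
   \sum_(0 <= n <oo) (logstar f (z + n.+1%:R)%R * (\1_(B n) r)%:E))%E).
  apply: ge0_le_integral => //.
  - by move=> x _; exact: fstar_ge0.
  - exact: measurable_fstar.
  - apply: (ge0_emeasurable_sum (P := xpredT)) => //.
      by move=> k x _ _; rewrite mule_ge0.
    by move=> k _; exact: mi.
  - move=> r /=; rewrite in_itv/= => /andP[r0 rt].
    have zr : z < - ln r by rewrite ltrNr -ltr_expR lnK ?posrE.
    have [n [n1 n2]] := block_index zr.
    apply: (@le_trans _ _ (logstar f (z + n.+1%:R)%R * (\1_(B n) r)%:E)%E).
      rewrite indicE mem_set ?mule1; last first.
        rewrite /B /= in_itv/= r0 /= /t -expRD mulN1r -[X in X < _]lnK ?posrE//.
        by rewrite ltr_expR; lra.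
      rewrite -[r]lnK ?posrE// -[ln r]opprK.
      by apply: (nondecr0_logstar f).1.
    apply: (le_nneseries_term (a := fun n => logstar f (z + n.+1%:R)%R * (\1_(B n) r)%:E)%E).
    by move=> m; rewrite mule_ge0.
rewrite integral_nneseries//; last by move=> n x _; rewrite mule_ge0.
rewrite -nneseriesZl; last by move=> n _; rewrite mule_ge0// lee_fin expR_ge0.
apply: lee_nneseries => [n _ _|n _].
  by apply: integral_ge0 => x _; rewrite mule_ge0.
rewrite ge0_integralZl//; last first.
  by apply/measurable_EFinP; apply: measurable_indic; exact: mB.
rewrite integral_indic//=; last exact: mB.
rewrite muleA -EFinM [leRHS]muleC lee_wpmul2l//.
apply: (@le_trans _ _ (leb (B n))); first by apply: lebesgue_measure_le => x [].
by rewrite leb_initial_itv// ltW.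
Qed.

(** Since [w] loses at most a factor of order [expR (k * n)] in [n] steps and
    [k < 1], the weights [expR (- n)] of the average leave a geometric
    series. *)
Lemma wtail_average (k : R) (w : R -> R) : k < 1 -> regvar (- k) w ->
  exists2 C : R, 0 < C & forall f, mf1 f -> forall x, 0 <= x ->
  (wtail w (fun z => fstarstar f (expR (- z))) x <= C%:E * wtail w (logstar f) x)%E.
Proof.
move=> k1 hw; pose e := (1 - k) / 2; have e0 : 0 < e by rewrite divr_gt0// subr_gt0.
have [C C0 hC] := regvar_bound hw e0.
have [S S0 hS] := nneseries_geometric e0.
exists (C * expR (1 - e) * S) => [|f mf x x0]; first by rewrite !mulr_gt0 ?expR_gt0.
have hF := nondecr0_logstar f.
apply: wtail_le => z xz; have z0 := le_lt_trans x0 xz.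
have W0 : (0 <= wtail w (logstar f) x)%E by exact: wtail_ge0 hw hF x0.
apply: (@le_trans _ _ ((w z)%:E * \sum_(0 <= n <oo)
    (expR (- 1 * n%:R))%:E * logstar f (z + n.+1%:R)%R)%E).
  rewrite lee_wpmul2l ?lee_fin ?(regvar_ge0 hw)//; exact: fstarstar_le_sum.
rewrite -nneseriesZl; last first.
  by move=> n _; rewrite mule_ge0 ?fstar_ge0// lee_fin expR_ge0.
rewrite EFinM -muleA; apply: le_trans (lee_wpmul2l _ (hS _ W0)); last first.
  by rewrite lee_fin mulr_ge0 ?expR_ge0// ltW.
rewrite -nneseriesZl; last by move=> n _; rewrite mule_ge0// lee_fin expR_ge0.
apply: lee_nneseries => [n _ _|n _].
  by rewrite !mule_ge0 ?fstar_ge0// lee_fin ?expR_ge0// (regvar_ge0 hw).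
have zn : x < z + n.+1%:R by rewrite (lt_le_trans xz)// lerDl.
have zn0 : 0 < z + n.+1%:R by rewrite (le_lt_trans x0).
rewrite [leRHS]muleA -EFinM.
apply: (@le_trans _ _ ((C * expR (1 - e) * expR (- e * n%:R))%:E *
    ((w (z + n.+1%:R)%R)%:E * logstar f (z + n.+1%:R)%R))%E); last first.
  rewrite lee_wpmul2l ?le_wtail// lee_fin !mulr_ge0 ?expR_ge0//; exact: ltW.
rewrite !muleA -!EFinM lee_wpmul2r ?fstar_ge0// lee_fin.
rewrite [leLHS]mulrC -ler_pdivlMl ?expR_gt0//.
apply: (le_trans (hC _ _ z0 zn0)).
rewrite [leRHS](_ : _ = C * (expR (1 - e) * expR (- e * n%:R) *
  (expR (- 1 * n%:R))^-1) * w (z + n.+1%:R)); last by ring.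
rewrite ler_wpM2r ?(regvar_ge0 hw)// ler_pM2l//.
rewrite -expRN -!expRD ler_expR opprD addrA subrr add0r normrN ger0_norm//.
by rewrite -natr1 /e; lra.
Qed.

(** By [wtail_average] the suprema for [f^**] and [f^*] are comparable. *)
Lemma Bspc_norm E (p a : R) : 1 < p -> exists2 C : R, 0 < C & forall f, mf1 f ->
  (E (wtail (logweight p a) (logstar f)) <= fnorm (Bspc p a E) f)%E /\
  (fnorm (Bspc p a E) f <= C%:E * E (wtail (logweight p a) (logstar f)))%E.
Proof.
move=> p1; have p0 : 0 < p by exact: lt_trans p1.
have hw := regvar_logweight p a.
have k1 : p^-1 < 1 by rewrite invf_lt1.
have [C C0 hC] := wtail_average k1 hw; exists C => // f mf.
set w := logweight p a in hw hC *.
pose S (t : R) := ereal_sup [set ((s `^ p^-1 * ellp (a - 1) s)%:E * fstarstar f s)%E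
              | s in `]0%R, t[].
pose A (z : R) := fstarstar f (expR (- z)).
have SA x : S (expR (- x)) = wtail w A x.
  congr (ereal_sup _); apply/seteqP; split=> y [s /=].
    rewrite in_itv/= => /andP[s0 sx] <-; exists (- ln s).
      by rewrite /= in_itv/= andbT ltrNr -ltr_expR lnK ?posrE.
    by rewrite /w /logweight /A opprK lnK.
  rewrite in_itv/= andbT => xs <-; exists (expR (- s)) => //.
  by rewrite /= in_itv/= expR_gt0 ltr_expR ltrN2.
have S0 t : unit_itv t -> (0 <= S t)%E.
  rewrite unit_itvE => /andP[t0 t1].
  apply: (@le_trans _ _ (((t / 2) `^ p^-1 * ellp (a - 1) (t / 2))%:E * fstarstar f (t / 2))%E).
    rewrite mule_ge0 ?fstarstar_ge0 ?divr_gt0// lee_fin mulr_ge0 ?powR_ge0//.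
  apply: ereal_sup_ubound; exists (t / 2) => //=; rewrite in_itv/=; lra.
have mS : measurable_fun unit_itv S.
  apply: measurable_fun_nondecreasing; first exact: interval_is_interval.
  move=> t u _ _ tu; apply: ereal_sup_le => _ [s /= st <-]; exists s => //=.
  by move: st; rewrite !in_itv/= => /andP[-> /lt_le_trans->].
have [e ml] := tilde_normE E measurable_unit_itv (@subset_refl _ _) mS S0.
rewrite (_ : fnorm (Bspc p a E) f = E (logcut unit_itv S)); last exact: e.
have lS x : 0 < x -> logcut unit_itv S x = wtail w A x.
  by move=> x0; rewrite /logcut patchE mem_set ?unit_expRN.
have mW := mpos_wtail hw (nondecr0_logstar f).
split.
- apply: ri_le_pt => // x x0; rewrite lS//; apply: wtail_le => z xz.
  apply: le_trans (le_wtail _ _ xz); rewrite lee_wpmul2l//.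
    by rewrite lee_fin (regvar_ge0 hw)// (lt_trans x0).
  by apply: fstar_le_fstarstar; exact: expR_gt0.
- apply: ri_le_scale => //; first exact: ltW.
  by move=> x x0; rewrite lS//; apply: hC => //; exact: ltW.
Qed.

End averaged_norm.

(** * Equivalence of the K-functional with its model *)

Section change_of_variable.
Context {R : realType}.
Implicit Types (E : riSpace R) (G : R -> \bar R).

Lemma lipschitz_continuous (f : R -> R) (L : R) : 0 < L ->
  (forall x y, `|f x - f y| <= L * `|x - y|) -> continuous f.
Proof.
move=> L0 hf x; apply/cvgrPdist_le => e e0.
have eL : 0 < e / L by rewrite divr_gt0.
have := @nbhsx_ballx _ _ x _ eL; apply: filterS => y; rewrite /ball /= => xy.
by apply: (le_trans (hf x y)); rewrite mulrC -ler_pdivlMr// ltW.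
Qed.

Lemma mpos_comp_homo (psi : R -> R) G : mpos G ->
  (forall x, 0 < x -> 0 < psi x) ->
  (forall x y, 0 < x -> x <= y -> psi x <= psi y) -> mpos (G \o psi).
Proof.
move=> [mG G0] psi0 hpsi; split; last first.
  by move=> x; rewrite pos_itvE => x0; apply: G0; rewrite pos_itvE psi0.
apply: (measurable_comp measurable_pos_itv _ mG).
  by move=> _ [x + <-]; rewrite !pos_itvE; exact: psi0.
have [+ _] : mpos (EFin \o psi).
  by apply: mpos_nondecreasing => [x y x0 xy|x x0]; rewrite lee_fin ?hpsi// ltW// psi0.
by move/measurable_EFinP.
Qed.

(** A function [rho] of negative index can be used as a new variable: up to a
    bounded term, [- ln rho] is a bi-Lipschitz bijection [psi] of the half-line,
    and composition with [psi] is an isomorphism for all rearrangement invariant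
    norms. *)
Lemma log_change_of_variable (k : R) (rho : R -> R) : 0 < k -> regvar (- k) rho ->
  exists (psi : R -> R) (c C : R),
  [/\ 0 < c, 0 < C,
     (forall x, 0 < x -> 0 < psi x /\ `|psi x + ln (rho x)| <= c) &
     (forall V, regvar 0 V -> regvar 0 (V \o psi)) /\
     forall E G, mpos G -> [/\ mpos (G \o psi), (E (G \o psi) <= C%:E * E G)%E &
       (E G <= C%:E * E (G \o psi))%E]].
Proof.
move=> k0 hrho; have k20 : 0 < k / 2 by rewrite divr_gt0.
pose sig x := expR (k * x) * rho x.
have hsig : regvar 0 sig.
  by apply: regvar_index (regvarM (regvar_exp k) hrho); rewrite subrr.
have [lam [c [c0 lamc lamL]]] := regvar_lipschitz hsig k20.
pose psi x := k * x - lam x + lam 0.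
have psiB x y : x <= y -> k / 2 * (y - x) <= psi y - psi x <= 2 * k * (y - x).
  move=> xy; have xyE : `|x - y| = y - x by rewrite distrC ger0_norm ?subr_ge0.
  have := lamL x y; rewrite xyE ler_norml => /andP[h1 h2]; rewrite /psi.
  by apply/andP; split; [lra|nra].
have psi00 : psi 0 = 0 by rewrite /psi mulr0; ring.
have psi0 x : 0 < x -> 0 < psi x.
  move=> x0; have /andP[h _] := psiB _ _ (ltW x0); rewrite psi00 !subr0 in h.
  by apply: lt_le_trans h; rewrite mulr_gt0.
have psi_homo x y : x <= y -> psi x <= psi y.
  move=> xy; have /andP[h _] := psiB _ _ xy; rewrite -subr_ge0.
  by apply: le_trans h; rewrite mulr_ge0 ?subr_ge0// ltW.
have psi_exp x y : k / 2 * `|x - y| <= `|psi x - psi y|.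
  wlog xy : x y / x <= y => [hw|].
    have [/hw//|/ltW/hw] := leP x y.
    by rewrite [`|y - x|]distrC [`|psi y - psi x|]distrC.
  have /andP[h _] := psiB _ _ xy.
  rewrite ler0_norm ?subr_le0// ler0_norm ?subr_le0 ?psi_homo//; lra.
have k2 : 0 < 2 * k by rewrite mulr_gt0.
have psi_lip x y : `|psi x - psi y| <= 2 * k * `|x - y|.
  wlog xy : x y / x <= y => [hw|].
    have [/hw//|/ltW/hw] := leP x y.
    by rewrite [`|y - x|]distrC [`|psi y - psi x|]distrC.
  have /andP[_ h] := psiB _ _ xy.
  rewrite ler0_norm ?subr_le0 ?psi_homo// ler0_norm ?subr_le0//; lra.
have mpsi : measurable_fun (pos_itv : set R) psi.
  have [+ _] : mpos (EFin \o psi).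
    apply: mpos_nondecreasing => [x y _ xy|x x0]; rewrite lee_fin ?psi_homo//.
    by rewrite ltW// psi0.
  by move/measurable_EFinP.
(* the inverse of psi, obtained from the intermediate value theorem *)
have ex t : exists x, 0 < t -> 0 < x /\ psi x = t.
  have [t0|_] := ltP 0 t; last by exists 0.
  have b0 : 0 <= 2 * t / k by rewrite divr_ge0 ?mulr_ge0 ?ltW.
  have hb : t <= psi (2 * t / k).
    have /andP[h _] := psiB _ _ b0; rewrite psi00 !subr0 in h.
    apply: le_trans h; rewrite le_eqVlt; apply/orP; left; apply/eqP.
    by field; rewrite gt_eqF.
  have [|x xin xt] := @IVT R psi 0 (2 * t / k) t b0
      (continuous_subspaceT (lipschitz_continuous k2 psi_lip)).
    rewrite psi00 min_l ?max_r ?(ltW t0) ?hb//; exact: le_trans (ltW t0) hb.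
  exists x => _; split => //; move: xin; rewrite in_itv/= => /andP[+ _].
  rewrite le_eqVlt => /orP[/eqP x0|//]; move: t0.
  by rewrite -xt -x0 psi00 ltxx.
have [phi hphi] := choice ex.
have phi0 t : 0 < t -> 0 < phi t by move=> /hphi[].
have phiK t : 0 < t -> psi (phi t) = t by move=> /hphi[].
have phi_exp s t : 0 < s -> 0 < t -> (2 * k)^-1 * `|s - t| <= `|phi s - phi t|.
  by move=> s0 t0; rewrite ler_pdivrMl// -{1}(phiK _ s0) -{1}(phiK _ t0).
have phi_homo s t : 0 < s -> s <= t -> phi s <= phi t.
  move=> s0 st; rewrite leNgt; apply/negP => ts.
  have /andP[h _] := psiB _ _ (ltW ts).
  have := lt_le_trans s0 st => t0.
  rewrite !phiK// in h.
  have : 0 < k / 2 * (phi s - phi t) by rewrite mulr_gt0 ?subr_gt0.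
  lra.
have [C1 C10 hC1] := @ri_comp_expanding R _ k20.
have k2V : 0 < (2 * k)^-1 by rewrite invr_gt0.
have [C2 C20 hC2] := @ri_comp_expanding R _ k2V.
exists psi, (c + `|lam 0| + 1), (C1 + C2); split.
- by rewrite ltr_wpDl// addr_ge0.
- by rewrite addr_gt0.
- move=> x x0; split; first exact: psi0.
  have -> : ln (rho x) = ln (sig x) - k * x.
    by rewrite /sig lnM ?posrE ?expR_gt0 ?(regvar_gt0 hrho)// expRK addrAC subrr add0r.
  rewrite (_ : _ + _ = (ln (sig x) - lam x) + lam 0); last by rewrite /psi; ring.
  apply: (le_trans (ler_normD _ _)); apply: (@le_trans _ _ (c + `|lam 0|)).
    by rewrite lerD2r lamc.
  by rewrite lerDl.
- split=> [V hV|E G mG]; first exact: regvar_comp k2 hV mpsi psi0 (fun x y _ _ => psi_lip x y).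
  have mGp : mpos (G \o psi) by apply: mpos_comp_homo => // x y _; exact: psi_homo.
  have EG : (0 <= E G)%E by exact: ri_nneg.
  have EGp : (0 <= E (G \o psi))%E by exact: ri_nneg.
  split => //.
    apply: le_trans (hC1 E psi G mG mGp psi0 (fun x y _ _ => psi_exp x y)) _.
    by rewrite lee_wpmul2r// lee_fin lerDl ltW.
  have eG x : 0 < x -> ((G \o psi) \o phi) x = G x by move=> x0 /=; rewrite phiK.
  rewrite (ri_eq_pt E mG (fun x x0 => esym (eG x x0))).
  have mG' : mpos ((G \o psi) \o phi) by apply: mpos_eq mG _.
  apply: le_trans (hC2 E phi _ mGp mG' phi0 phi_exp) _.
  by rewrite lee_wpmul2r// lee_fin lerDr ltW.
Qed.

End change_of_variable.

Section K_functional.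
Context {R : realType} (E0 E1 : riSpace R) (p0 p1 al be : R).
Hypotheses (hp0 : 1 < p0) (hp01 : p0 < p1).
Implicit Types (f : R -> R) (E : riSpace R).

Notation mf1 f := (measurable_fun (unit_itv : set R) f).
Let Y0 := Bspc p0 al E0.
Let Y1 := Bspc p1 be E1.
Let w0 := logweight p0 al.
Let w1 := logweight p1 be.
Let rho := rhow E0 E1 w0 w1.
Let K := Kfun Y0 Y1.

Lemma invp1_gt0 : 0 < p1^-1.
Proof. by rewrite invr_gt0 (lt_trans _ hp01)// (lt_trans _ hp0). Qed.

Lemma invp1_lt_invp0 : p1^-1 < p0^-1.
Proof.
have p00 : 0 < p0 := lt_trans ltr01 hp0.
by rewrite ltf_pV2 ?posrE// (lt_trans p00).
Qed.

Let hw0 : regvar (- p0^-1) w0. Proof. exact: regvar_logweight. Qed.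
Let hw1 : regvar (- p1^-1) w1. Proof. exact: regvar_logweight. Qed.
Let hrho : regvar (- (p0^-1 - p1^-1)) rho. Proof. exact: regvar_rhow. Qed.

Lemma Bspc_norm_ge0 E p a f : 1 < p -> mf1 f -> (0 <= fnorm (Bspc p a E) f)%E.
Proof.
move=> p1' mf; have [C _ h] := Bspc_norm E a p1'; have [h1 _] := h f mf.
apply: le_trans h1; apply: ri_nneg.
exact: mpos_wtail (regvar_logweight p a) (nondecr0_logstar f).
Qed.

Lemma p1_gt1 : 1 < p1. Proof. exact: lt_trans hp01. Qed.

Lemma Kfun_ge0 t f : 0 <= t -> (0 <= K t f)%E.
Proof.
move=> t0; apply: le_ereal_inf_tmp => _ [g0 [g1 [[mg0 _] [mg1 _] _ ->]]].
rewrite adde_ge0 ?mule_ge0 ?Bspc_norm_ge0//; exact: p1_gt1.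
Qed.

(** The K-functional is nondecreasing, and [K t / t] is nonincreasing. *)
Lemma Kfun_ratio (s t c : R) f : 0 <= s -> t <= c * s -> 1 <= c ->
  (K t f <= c%:E * K s f)%E.
Proof.
move=> s0 tcs c1; have c0 : 0 < c by lra.
rewrite -lee_pdivrMl//; apply: le_ereal_inf_tmp => _ [g0 [g1 [hg0 hg1 fg ->]]].
rewrite lee_pdivrMl//.
apply: (@le_trans _ _ (fnorm Y0 g0 + t%:E * fnorm Y1 g1)%E).
  by apply: ereal_inf_lbound; exists g0, g1.
have n0 : (0 <= fnorm Y0 g0)%E by apply: Bspc_norm_ge0 => //; exact: hg0.1.
have n1 : (0 <= fnorm Y1 g1)%E by apply: Bspc_norm_ge0 p1_gt1 _; exact: hg1.1.
rewrite ge0_muleDr ?mule_ge0// leeD//.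
  by rewrite -[leLHS]mul1e lee_wpmul2r// lee_fin.
by rewrite muleA -EFinM lee_wpmul2r// lee_fin.
Qed.

(** Near-optimal decompositions are obtained by truncating [f] at the level
    of its rearrangement. *)
Lemma Kfun_le_model : exists2 C : R, 0 < C & forall f x, mf1 f -> 0 < x ->
  (K (rho x) f <= C%:E * Kmodel E0 E1 w0 w1 (logstar f) x)%E.
Proof.
have [C0 C00 hC0] := Bspc_norm E0 al hp0.
have [C1 C10 hC1] := Bspc_norm E1 be p1_gt1.
have [C C_0 hC] := Kmodel_upper E0 E1 invp1_gt0 hw0 hw1.
exists (C0 + C1 * C) => [|f x mf x0]; first by rewrite addr_gt0// mulr_gt0.
have hF := nondecr0_logstar f.
have Fx := logstar_fin x mf.
set H := Kmodel _ _ _ _ _ _.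
have H0 : (0 <= H)%E by exact: (Kmodel_ge0 E0 E1 hw0 hw1 hF x0).
have [Hoo|Hoo] := eqVneq H +oo%E.
  by rewrite Hoo gt0_muley ?leey// lte_fin addr_gt0// mulr_gt0.
pose lam := fine (logstar f x); pose g1 := clip lam f; pose g0 z := f z - g1 z.
have l0 : 0 <= lam by rewrite fine_ge0// fstar_ge0.
have mg1 : mf1 g1 by exact: measurable_clip.
have mg0 : mf1 g0 by exact: measurable_funB.
have [h0 h1] : (E0 (wtail w0 (logstar g0)) <= H)%E /\
    ((rho x)%:E * E1 (wtail w1 (logstar g1)) <= C%:E * H)%E.
  apply: (hC _ _ _ _ lam) => //; try exact: nondecr0_logstar.
  - by rewrite /lam fineK.
  - move=> z; apply: logstar_abs_le => // y _.
    by have [_ _ + _] := clipE (f y) l0.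
  - by move=> z zx; exact: logstar_excess.
  - move=> z; apply: logstar_abs_le => // y _.
    by have [_ + _ _] := clipE (f y) l0.
  - by move=> z; exact: logstar_clip.
have r0 := regvar_gt0 hrho x0.
have n0 : (fnorm Y0 g0 <= C0%:E * H)%E.
  by apply: le_trans (hC0 _ mg0).2 _; rewrite lee_pmul2l.
have n1 : ((rho x)%:E * fnorm Y1 g1 <= (C1 * C)%:E * H)%E.
  apply: (@le_trans _ _ ((rho x)%:E * (C1%:E * E1 (wtail w1 (logstar g1))))%E).
    by rewrite lee_pmul2l//; exact: (hC1 _ mg1).2.
  by rewrite muleCA [(C1 * C)%:E]EFinM -muleA lee_pmul2l.
have Hfin : H \is a fin_num by rewrite ge0_fin_numE// ltey.
have n1f : (fnorm Y1 g1 < +oo)%E.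
  have : ((rho x)%:E * fnorm Y1 g1 < +oo)%E.
    by apply: le_lt_trans n1 _; rewrite -(fineK Hfin) -EFinM ltry.
  move: (fnorm Y1 g1) => -[r _||]//; first by rewrite ltry.
  by rewrite gt0_muley ?ltxx.
apply: (@le_trans _ _ (fnorm Y0 g0 + (rho x)%:E * fnorm Y1 g1)%E).
  apply: ereal_inf_lbound; exists g0, g1; split => //.
  - split => //; apply: le_lt_trans n0 _.
    by rewrite -(fineK Hfin) -EFinM ltry.
  - by move=> z _; rewrite /g0 subrK.
rewrite (EFinD C0) ge0_muleDl; first exact: leeD.
  by rewrite lee_fin ltW.
by rewrite lee_fin mulr_ge0// ltW.
Qed.

(** The infimum is taken over decompositions of [f], each of which satisfies
    the hypotheses of [Kmodel_lower] by [logstar_add]. *)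
Lemma Kmodel_le_Kfun : exists2 C : R, 0 < C & forall f x, mf1 f -> 0 < x ->
  (Kmodel E0 E1 w0 w1 (logstar f) x <= C%:E * K (rho x) f)%E.
Proof.
have [C0 C00 hC0] := Bspc_norm E0 al hp0.
have [C1 C10 hC1] := Bspc_norm E1 be p1_gt1.
have [C C_0 hC] := Kmodel_lower E0 E1 invp1_lt_invp0 hw0 hw1.
exists C => // f x mf x0.
rewrite -lee_pdivrMl//; apply: le_ereal_inf_tmp => _ [g0 [g1 [hg0 hg1 fg ->]]].
rewrite lee_pdivrMl//.
have [mg0 n0] : mf1 g0 /\ (fnorm Y0 g0 < +oo)%E := hg0.
have [mg1 n1] : mf1 g1 /\ (fnorm Y1 g1 < +oo)%E := hg1.
have n0p : (0 <= fnorm Y0 g0)%E by exact: Bspc_norm_ge0.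
have n1p : (0 <= fnorm Y1 g1)%E by exact: Bspc_norm_ge0 p1_gt1 _.
have n0f : fnorm Y0 g0 \is a fin_num by rewrite ge0_fin_numE.
have n1f : fnorm Y1 g1 \is a fin_num by rewrite ge0_fin_numE.
have -> : (C%:E * (fnorm Y0 g0 + (rho x)%:E * fnorm Y1 g1))%E =
    (C * (fine (fnorm Y0 g0) + rho x * fine (fnorm Y1 g1)))%:E.
  by rewrite [RHS]EFinM (EFinD (fine _)) (EFinM (rho x)) !fineK.
apply: (hC _ (logstar g0) (logstar g1)) => //;
  rewrite ?fine_ge0//; try exact: nondecr0_logstar.
- by move=> z _; exact: logstar_add.
- by rewrite fineK//; exact: (hC0 _ mg0).1.
- by rewrite fineK//; exact: (hC1 _ mg1).1.
Qed.

Lemma regvar_bounded k (V : R -> R) (x : R) : regvar k V -> 0 < x ->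
  exists2 D : R, 0 < D & forall z, 0 < z -> z <= x -> V z <= D.
Proof.
move=> hV x0; have [C C0 h] := regvar_bound hV ltr01.
exists (C * expR (`|k| * x + x) * V x) => [|z z0 zx].
  by rewrite !mulr_gt0 ?expR_gt0 ?(regvar_gt0 hV).
apply: (le_trans (h _ _ z0 x0)); rewrite ler_wpM2r ?(regvar_ge0 hV)// ler_pM2l//.
have zxx : `|z - x| <= x by rewrite ler0_norm ?subr_le0//; lra.
rewrite ler_expR mul1r lerD//; apply: (le_trans (ler_norm _)).
by rewrite normrM ler_wpM2l.
Qed.

(** Finiteness of the model at one point [x] controls [w0 * F] beyond [x]; on
    [`]0, x]] the monotonicity of [F] and the local boundedness of [w0] do the
    rest. *)
Lemma Kmodel_fin_carrier f x : mf1 f -> 0 < x ->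
  (Kmodel E0 E1 w0 w1 (logstar f) x < +oo)%E -> carrier Y0 f.
Proof.
move=> mf x0 hfin; have hF := nondecr0_logstar f.
have [C0 C00 hC0] := Bspc_norm E0 al hp0.
split => //; apply: le_lt_trans (hC0 _ mf).2 _.
have [D D0 hD] := regvar_bounded hw0 x0.
have ph0 : 0 < fundamental E0 (1 + x) by rewrite fundamental_gt0// addr_gt0.
have W0 := wtail_ge0 hw0 hF (ltW x0).
have T0 : (0 <= Ktail E0 w0 (logstar f) x)%E.
  by apply: ri_nneg; exact: mpos_Ktail_fun hw0 _ _ hF.
have H0 : (0 <= (rho x)%:E * Khead E1 w1 (logstar f) x)%E.
  rewrite mule_ge0 ?lee_fin ?(regvar_ge0 hrho)//.
  by apply: ri_nneg; exact: mpos_Khead_fun hw1 _ _ hF.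
have Q0 : (0 <= (fundamental E0 (1 + x))%:E * wtail w0 (logstar f) x)%E.
  by rewrite mule_ge0// lee_fin ltW.
have Tfin : (Ktail E0 w0 (logstar f) x < +oo)%E.
  by apply: le_lt_trans hfin; rewrite /Kmodel -addeA leeDl// adde_ge0.
have Qfin : ((fundamental E0 (1 + x))%:E * wtail w0 (logstar f) x < +oo)%E.
  by apply: le_lt_trans hfin; rewrite /Kmodel addeAC leeDr// adde_ge0.
have Fx := logstar_fin x mf.
pose a := (wtail w0 (logstar f) x + D%:E * logstar f x)%E.
have a0 : (0 <= a)%E by rewrite adde_ge0// mule_ge0 ?fstar_ge0// lee_fin ltW.
have afin : a \is a fin_num.
  rewrite fin_numD fin_numM// ?andbT ge0_fin_numE//.
  case: (wtail _ _ _) Qfin => [r _||]//; first by rewrite ltry.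
  by rewrite gt0_muley ?ltxx.
have mW := mpos_wtail hw0 hF.
have mT := mpos_Ktail_fun hw0 x hF.
have : (E0 (wtail w0 (logstar f)) <= Ktail E0 w0 (logstar f) x +
    a * (fundamental E0 (1 + x))%:E)%E.
  apply: ri_le_split => // y y0 yx; apply: wtail_le => z yz.
  have z0 := lt_trans y0 yz; have [zx|xz] := leP z x.
    apply: (@le_trans _ _ (D%:E * logstar f x)%E); last by rewrite leeDr.
    apply: lee_pmul => //; rewrite ?lee_fin ?(regvar_ge0 hw0) ?hD//.
      exact: fstar_ge0.
    exact: hF.1.
  apply: le_trans (le_wtail _ _ xz) _; rewrite leeDl// mule_ge0 ?fstar_ge0//.
  by rewrite lee_fin ltW.
move=> hle; have : (E0 (wtail w0 (logstar f)) < +oo)%E.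
  apply: (le_lt_trans hle); rewrite lte_add_pinfty//.
  by rewrite -(fineK afin) -EFinM ltry.
have := ri_nneg E0 mW; case: (E0 _) => [r _ _||]//.
by rewrite -EFinM ltry.
Qed.

End K_functional.

(** * The interpolation norm *)

Section interpolation_norm.
Context {R : realType} (E0 E1 : riSpace R) (p0 p1 al be : R) (b : R -> R).
Hypotheses (hp0 : 1 < p0) (hp01 : p0 < p1) (hb : SV b).
Implicit Types (f : R -> R) (E : riSpace R).

Notation mf1 f := (measurable_fun (unit_itv : set R) f).
Let Y0 := Bspc p0 al E0.
Let Y1 := Bspc p1 be E1.
Let w0 := logweight p0 al.
Let w1 := logweight p1 be.
Let rho := rhow E0 E1 w0 w1.
Let k := p0^-1 - p1^-1.

Let hw0 : regvar (- p0^-1) w0. Proof. exact: regvar_logweight. Qed.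
Let hw1 : regvar (- p1^-1) w1. Proof. exact: regvar_logweight. Qed.
Let hrho : regvar (- k) rho. Proof. exact: regvar_rhow. Qed.
Let k_gt0 : 0 < k. Proof. by rewrite subr_gt0; exact: invp1_lt_invp0 hp0 hp01. Qed.

Definition brho (x : R) : R := sv_ext b (rho x).

Definition dweight (th : R) (x : R) : R := rho x `^ (- th) * brho x.

Lemma measurable_brho : measurable_fun (pos_itv : set R) brho.
Proof.
have [b0 mb _] := hb.
have mr := regvar_meas hrho.
pose D : set R := pos_itv `&` [set x | ((rho x)%:E < 1)%E].
have mD : measurable D.
  apply: emeasurable_fun_infty_o; first exact: measurable_pos_itv.
  exact/measurable_EFinP.
have m1 : mpos (cut D (fun x => (b (rho x))%:E)).
  have ur x : D x -> unit_itv (rho x).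
    move=> [+ /=]; rewrite pos_itvE lte_fin unit_itvE => x0 ->.
    by rewrite (regvar_gt0 hrho).
  apply: mpos_cut => //; last by move=> x x0 /ur /b0; rewrite lee_fin => /ltW.
  apply/measurable_EFinP.
  apply: (measurable_comp measurable_unit_itv _ mb).
    by move=> _ [x [_ /ur ux] <-].
  by apply: measurable_funS mr => //; exact: measurable_pos_itv.
have m2 : mpos (cut (~` D) (fun=> 1%:E)) by apply: mpos_cut => //; exact: measurableC.
have [+ _] : mpos (EFin \o brho).
  apply: mpos_eq (mposD m1 m2) _ => x x0.
  rewrite /= /brho /sv_ext /cut; case: ltP => r1.
    rewrite mem_set; last by split; rewrite ?pos_itvE//= lte_fin.
    by rewrite memNset ?adde0// => -[]; rewrite /D /= pos_itvE lte_fin.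
  rewrite memNset; last by move=> [_ /=]; rewrite lte_fin ltNge r1.
  by rewrite mem_set ?add0e// => -[_ /=]; rewrite lte_fin ltNge r1.
by move/measurable_EFinP.
Qed.

(** Where [rho x < 1], the two arguments of [b] are at bounded logarithmic
    distance. Where [1 <= rho x], the function [sv_ext b] is 1 and [psi x] stays
    in [`]0, c]], on which [b (expR (- _))] is comparable to a constant. *)
Lemma brho_equiv (psi : R -> R) (c : R) : 0 < c ->
  (forall x, 0 < x -> 0 < psi x /\ `|psi x + ln (rho x)| <= c) ->
  exists2 C : R, 0 < C & forall x, 0 < x ->
    b (expR (- psi x)) <= C * brho x /\ brho x <= C * b (expR (- psi x)).
Proof.
move=> c0 hpsi; have hv := regvar_SV hb.
have [C C0 hC] := regvar_bound hv ltr01.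
pose v x := b (expR (- x)).
have vc : 0 < v c := regvar_gt0 hv c0.
exists (C * expR c * (1 + v c + (v c)^-1)).
  by rewrite !mulr_gt0 ?expR_gt0// !addr_gt0 ?invr_gt0.
move=> x x0; have [px pr] := hpsi x x0; have rx := regvar_gt0 hrho x0.
have vp : 0 < v (psi x) := regvar_gt0 hv px.
have bound y z : 0 < y -> 0 < z -> `|y - z| <= c -> v y <= C * expR c * v z.
  move=> y0 z0 yz; apply: (le_trans (hC y z y0 z0)).
  rewrite mul0r add0r mul1r ler_wpM2r ?(ltW (regvar_gt0 hv _))// ler_pM2l//.
  by rewrite ler_expR.
have weak (u w : R) : 0 <= u -> 0 <= w -> u <= C * expR c * w ->
    u <= C * expR c * (1 + v c + (v c)^-1) * w.
  move=> u0 w00 uw; apply: (le_trans uw); rewrite ler_wpM2r// ler_peMr//.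
    by rewrite mulr_ge0 ?expR_ge0// ltW.
  by rewrite -addrA lerDl addr_ge0 ?invr_ge0// ltW.
rewrite -/(v (psi x)) /brho /sv_ext; case: ltP => r1.
  have r0 : 0 < - ln (rho x) by rewrite oppr_gt0 ln_lt0// rx.
  have vr : v (- ln (rho x)) = b (rho x) by rewrite /v opprK lnK.
  have vr0 : 0 < b (rho x) by rewrite -vr; exact: regvar_gt0 hv r0.
  have d1 : `|psi x - - ln (rho x)| <= c by rewrite opprK.
  split; apply: weak; rewrite ?(ltW vp) ?(ltW vr0)// -vr.
    exact: bound.
  by apply: bound => //; rewrite distrC.
have lr : 0 <= ln (rho x) by rewrite ln_ge0.
have pc : psi x <= c by move: pr; rewrite ler_norml => /andP[_]; lra.
have d1 : `|psi x - c| <= c by rewrite ler0_norm ?subr_le0//; lra.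
have h1 := bound _ _ px c0 d1.
have h2 := bound c (psi x) c0 px (_ : `|c - psi x| <= c).
have Cc : 0 < C * expR c by rewrite mulr_gt0 ?expR_gt0.
have vcV : 0 < (v c)^-1 by rewrite invr_gt0.
split.
  rewrite mulr1; apply: (le_trans h1); rewrite ler_pM2l//; lra.
rewrite distrC in h2; have {}h2 := h2 d1.
rewrite -(ler_pM2l vc) mulr1; apply: (le_trans h2).
rewrite [leRHS](_ : _ = C * expR c * v (psi x) * (v c * (1 + v c + (v c)^-1))).
  rewrite ler_peMr ?(mulr_ge0 (ltW Cc) (ltW vp))//.
  rewrite mulrDr mulfV ?gt_eqF// lerDr mulr_ge0 ?(ltW vc)//.
  by rewrite addr_ge0// ltW.
by ring.
Qed.

Lemma regvar_brho : regvar 0 brho.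
Proof.
have [psi [c [C [c0 C0 hpsi [hV _]]]]] := log_change_of_variable k_gt0 hrho.
have [D D0 hD] := brho_equiv c0 hpsi.
by apply: (regvar_equiv D0 (hV _ (regvar_SV hb)) measurable_brho hD).
Qed.

Lemma regvar_dweight th : regvar (th * k) (dweight th).
Proof.
by apply: regvar_index (regvarM (regvar_powR (- th) hrho) regvar_brho); ring.
Qed.

Lemma measurable_Kfun f : measurable_fun (unit_itv : set R)
  (fun t => Kfun Y0 Y1 t f).
Proof.
apply: measurable_fun_nondecreasing; first exact: interval_is_interval.
move=> s t; rewrite unit_itvE => /andP[s0 _] _ st.
have := Kfun_ratio E0 E1 al be hp0 hp01 f (ltW (lt_le_trans s0 st)) _ (lexx 1).
by move=> /(_ s); rewrite !mul1e mul1r; exact.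
Qed.

(** The change of variable moves the K-functional from [expR (- x)] to [rho x],
    where [Kmodel] replaces it; the weights [t `^ (- th)] and [b t] move along,
    up to constants. *)
Lemma interp_norm_equiv th : exists2 C : R, 0 < C & forall E f, mf1 f ->
  let N := E (Kpart E0 E1 w0 w1 (dweight th) (logstar f)) in
  (interp_norm Y0 Y1 th b E f <= C%:E * N)%E /\
  (N <= C%:E * interp_norm Y0 Y1 th b E f)%E.
Proof.
have [psi [c [C [c0 C0 hpsi [_ hG]]]]] := log_change_of_variable k_gt0 hrho.
have [D D0 hD] := brho_equiv c0 hpsi.
have [C1 C10 hC1] := Kfun_le_model E0 E1 al be hp0 hp01.
have [C2 C20 hC2] := Kmodel_le_Kfun E0 E1 al be hp0 hp01.
have [b0 mb _] := hb.
pose A := expR (`|th| * c) * D * expR c * (C1 + C2).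
have A0 : 0 < A by rewrite !mulr_gt0 ?expR_gt0// addr_gt0.
exists (C * A) => [|E f mf N]; first by rewrite mulr_gt0.
pose g t := ((t `^ (- th) * b t)%:E * Kfun Y0 Y1 t f)%E.
pose G x := g (expR (- x)).
have K0 t : 0 <= t -> (0 <= Kfun Y0 Y1 t f)%E by exact: Kfun_ge0.
have g0 t : unit_itv t -> (0 <= g t)%E.
  move=> ut; have := b0 _ ut; move: ut; rewrite unit_itvE => /andP[t0 _] bt.
  by rewrite mule_ge0 ?K0 ?(ltW t0)// lee_fin mulr_ge0 ?powR_ge0// ltW.
have mg : measurable_fun unit_itv g.
  apply: emeasurable_funM; last exact: measurable_Kfun.
  apply/measurable_EFinP; apply: measurable_funM => //.
  by apply: measurable_funTS; exact: measurable_powR.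
have mG : mpos G by exact: mpos_expRN.
have NE : interp_norm Y0 Y1 th b E f = E G.
  have [e ml] := tilde_normE E measurable_unit_itv (@subset_refl _ _) mg g0.
  rewrite -[LHS]/(tilde_norm E unit_itv g) e; apply: ri_eq_pt => // x x0.
  by rewrite /logcut patchE mem_set ?unit_expRN.
rewrite NE; have [mGp G1 G2] := hG E G mG.
have hF := nondecr0_logstar f.
have hd := regvar_dweight th.
have mK := mpos_Kpart E0 E1 hw0 hw1 hd hF.
have comp x : 0 < x -> [/\ 0 < psi x, expR (- psi x) <= expR c * rho x &
    rho x <= expR c * expR (- psi x)].
  move=> x0; have [px] := hpsi x x0; rewrite ler_norml => /andP[h1 h2].
  have rx := regvar_gt0 hrho x0; split => //.
    by rewrite -[rho x]lnK ?posrE// -expRD ler_expR; lra.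
  by rewrite -[leLHS]lnK ?posrE// -expRD ler_expR; lra.
have ec1 : 1 <= expR c by rewrite -[leLHS]expR0 ler_expR ltW.
have powth (u v : R) : 0 < u -> 0 < v -> `|ln u - ln v| <= c ->
    u `^ (- th) <= expR (`|th| * c) * v `^ (- th).
  move=> u0 v0 uv; rewrite -[u]lnK ?posrE// -[v in X in _ <= X]lnK ?posrE//.
  rewrite -!expRM -expRD ler_expR -lerBlDr -mulrBl.
  apply: (le_trans (ler_norm _)); rewrite normrM normrN mulrC ler_wpM2l//.
have lnpsi x : 0 < x -> `|ln (expR (- psi x)) - ln (rho x)| <= c.
  move=> x0; rewrite expRK -opprD normrN; exact: (hpsi x x0).2.
split.
- apply: (le_trans G2); rewrite EFinM -muleA lee_pmul2l//.
  apply: ri_le_scale; [exact: ltW|by []|exact: mK|] => x x0.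
  have [px h1 h2] := comp x x0; have rx := regvar_gt0 hrho x0.
  have [hb1 _] := hD x x0.
  have bp : 0 < b (expR (- psi x)) by apply: b0; rewrite unit_expRN.
  have br : 0 < brho x := regvar_gt0 regvar_brho x0.
  rewrite /= /G /g /Kpart /dweight.
  have KK : (Kfun Y0 Y1 (expR (- psi x)) f <=
      (expR c * (C1 + C2))%:E * Kmodel E0 E1 w0 w1 (logstar f) x)%E.
    apply: (le_trans (Kfun_ratio E0 E1 al be hp0 hp01 f (ltW rx) h1 ec1)).
    rewrite EFinM -muleA lee_pmul2l ?lte_fin ?expR_gt0//.
    apply: (le_trans (hC1 f x mf x0)); rewrite lee_wpmul2r ?lee_fin ?lerDl ?(ltW C20)//.
    exact: (Kmodel_ge0 E0 E1 hw0 hw1 hF x0).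
  apply: (@le_trans _ _ ((expR (`|th| * c) * rho x `^ (- th) * (D * brho x))%:E *
      ((expR c * (C1 + C2))%:E * Kmodel E0 E1 w0 w1 (logstar f) x))%E).
    apply: lee_pmul => //.
    + by rewrite lee_fin mulr_ge0 ?powR_ge0// ltW.
    + by apply: K0; exact: expR_ge0.
    + rewrite lee_fin; apply: ler_pM => //; rewrite ?powR_ge0 ?(ltW bp)//.
      by apply: powth => //; [exact: expR_gt0|exact: lnpsi].
  rewrite !muleA -!EFinM /A (_ : expR _ * rho x `^ _ * _ * _ =
    expR (`|th| * c) * D * expR c * (C1 + C2) * (rho x `^ (- th) * brho x))//.
  by ring.
- apply: (@le_trans _ _ (A%:E * E (G \o psi))%E); last first.
    move: (A) A0 => a a0; rewrite [C * a]mulrC EFinM -muleA; by rewrite lee_pmul2l.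
  apply: ri_le_scale; [exact: ltW|exact: mK|by []|] => x x0.
  have [px h1 h2] := comp x x0; have rx := regvar_gt0 hrho x0.
  have [_ hb2] := hD x x0.
  have bp : 0 < b (expR (- psi x)) by apply: b0; rewrite unit_expRN.
  have br : 0 < brho x := regvar_gt0 regvar_brho x0.
  rewrite /= /G /g /Kpart /dweight.
  have KK : (Kmodel E0 E1 w0 w1 (logstar f) x <=
      (expR c * (C1 + C2))%:E * Kfun Y0 Y1 (expR (- psi x)) f)%E.
    apply: (le_trans (hC2 f x mf x0)).
    apply: (@le_trans _ _ (C2%:E * ((expR c)%:E * Kfun Y0 Y1 (expR (- psi x)) f))%E).
      rewrite lee_pmul2l//.
      exact: (Kfun_ratio E0 E1 al be hp0 hp01 f (expR_ge0 (- psi x)) h2 ec1).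
    rewrite muleA -EFinM lee_wpmul2r ?K0 ?expR_ge0// lee_fin mulrC ler_pM2l ?expR_gt0//.
    by rewrite lerDr ltW.
  have Km0 := Kmodel_ge0 E0 E1 hw0 hw1 hF x0.
  apply: (@le_trans _ _ ((expR (`|th| * c) * expR (- psi x) `^ (- th) *
      (D * b (expR (- psi x))))%:E *
      ((expR c * (C1 + C2))%:E * Kfun Y0 Y1 (expR (- psi x)) f))%E).
    apply: lee_pmul => //.
    + by rewrite lee_fin mulr_ge0 ?powR_ge0// ltW.
    + rewrite lee_fin; apply: ler_pM => //; rewrite ?powR_ge0 ?(ltW br)//.
      by apply: powth => //; [exact: expR_gt0|rewrite distrC; exact: lnpsi].
  rewrite !muleA -!EFinM /A (_ : expR _ * expR _ `^ _ * _ * _ =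
    expR (`|th| * c) * D * expR c * (C1 + C2) *
      (expR (- psi x) `^ (- th) * b (expR (- psi x))))//.
  by ring.
Qed.

Lemma ri_fin_exists E (G : R -> \bar R) : mpos G -> (E G < +oo)%E ->
  exists2 x, 0 < x & (G x < +oo)%E.
Proof.
move=> mG EG; apply: contrapT => h.
have Goo x : 0 < x -> (+oo <= G x)%E.
  by move=> x0; rewrite leNgt; apply/negP => Gx; apply: h; exists x.
have := @ri_ge_const _ E G +oo%E 1 ltr01 mG (leey 0) (fun x x0 _ => Goo x x0).
by rewrite gt0_mulye ?lte_fin ?fundamental_gt0// leNgt EG.
Qed.

Lemma interp_norm_carrier th E f : mf1 f ->
  (interp_norm Y0 Y1 th b E f < +oo)%E -> carrier Y0 f.
Proof.
move=> mf fin; have [C C0 hC] := interp_norm_equiv th.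
have [_ h] := hC E f mf; have hd := regvar_dweight th.
have hF := nondecr0_logstar f.
have mK := mpos_Kpart E0 E1 hw0 hw1 hd hF.
have Nfin : (E (Kpart E0 E1 w0 w1 (dweight th) (logstar f)) < +oo)%E.
  by apply: (le_lt_trans h); rewrite lte_mul_pinfty// lee_fin ltW.
have [x x0] := ri_fin_exists mK Nfin.
rewrite /Kpart => Kx; have d0 := regvar_gt0 hd x0.
have K0 := Kmodel_ge0 E0 E1 hw0 hw1 hF x0.
have Kfin : (Kmodel E0 E1 w0 w1 (logstar f) x < +oo)%E.
  case: (Kmodel E0 E1 w0 w1 (logstar f) x) Kx K0 => [r _ _||]//; first exact: ltry.
  by rewrite gt0_muley ?ltxx// lte_fin.
exact: (Kmodel_fin_carrier hp0 mf x0 Kfin).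
Qed.

Lemma same_space_interp th E (Z : fspace R) :
  (forall f, carrier Z f <-> mf1 f /\ (fnorm Z f < +oo)%E) ->
  (exists2 C : R, 0 < C & forall f, mf1 f ->
    let N := E (Kpart E0 E1 w0 w1 (dweight th) (logstar f)) in
    (N <= C%:E * fnorm Z f)%E /\ (fnorm Z f <= C%:E * N)%E) ->
  same_space (interp Y0 Y1 th b E) Z.
Proof.
move=> hZ [C C0 hC]; have [D D0 hD] := interp_norm_equiv th.
have DC : 0 < D * C by rewrite mulr_gt0.
have eqv f : mf1 f -> (interp_norm Y0 Y1 th b E f <= (D * C)%:E * fnorm Z f)%E /\
    (fnorm Z f <= (D * C)%:E * interp_norm Y0 Y1 th b E f)%E.
  move=> mf; have [h1 h2] := hC f mf; have [h3 h4] := hD E f mf; split.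
    by apply: (le_trans h3); rewrite EFinM -muleA lee_pmul2l.
  by apply: (le_trans h2); rewrite [D * C]mulrC EFinM -muleA lee_pmul2l.
split; last by exists (D * C) => // f [[mf _] _]; exact: eqv.
apply/seteqP; split=> f.
  move=> [[mf _] fin]; apply/hZ; split => //; apply: (le_lt_trans (eqv f mf).2).
  by rewrite lte_mul_pinfty// lee_fin ltW.
move=> /hZ[mf fin]; have ifin : (interp_norm Y0 Y1 th b E f < +oo)%E.
  by apply: (le_lt_trans (eqv f mf).1); rewrite lte_mul_pinfty// lee_fin ltW.
by split => //; exact: interp_norm_carrier ifin.
Qed.

End interpolation_norm.

(** * Iterated norms in the logarithmic variable *)

Section iterated_norms.
Context {R : realType}.
Notation leb := (@lebesgue_measure R).
Implicit Types (E : riSpace R) (f b : R -> R) (g F G : R -> \bar R) (w : R -> R).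

Lemma tilde_norm_log E (I J : set R) g G : measurable I -> I `<=` unit_itv ->
  mpos G -> (forall x, 0 < x -> g (expR (- x)) = G x) ->
  (forall x, 0 < x -> I (expR (- x)) <-> J x) ->
  tilde_norm E I g = E (cut J G).
Proof.
move=> mI I1 [mG G0] gG IJ.
have lnpos t : (unit_itv : set R) t -> 0 < - ln t /\ expR (- - ln t) = t.
  by rewrite unit_itvE => /andP[t0 t1]; rewrite opprK lnK ?posrE// oppr_gt0 ln_lt0 ?t0.
have gE t : (unit_itv : set R) t -> g t = G (- ln t).
  by move=> /lnpos[l0 lK]; rewrite -gG// lK.
have mg : measurable_fun unit_itv g.
  apply: (eq_measurable_fun (G \o (fun t => - ln t))).
    by move=> t; rewrite inE => /gE ->.
  apply: (measurable_comp measurable_pos_itv _ mG).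
    by move=> _ [t /lnpos[l0 _] <-]; rewrite pos_itvE.
  by apply: measurable_funTS; apply: measurableT_comp => //; exact: measurable_ln.
have g0 t : I t -> (0 <= g t)%E.
  by move=> /I1 ut; rewrite gE// G0// pos_itvE (lnpos _ ut).1.
have [-> ml] := tilde_normE E mI I1 mg g0.
apply: ri_eq_pt => // x x0; rewrite /logcut /cut patchE -gG//.
by rewrite (_ : (expR (- x) \in I) = (x \in J))//; apply/idP/idP; rewrite !inE => /IJ; exact.
Qed.

Lemma tilde_norm_unit E g G : mpos G -> (forall x, 0 < x -> g (expR (- x)) = G x) ->
  tilde_norm E unit_itv g = E G.
Proof.
move=> mG gG; rewrite (@tilde_norm_log E unit_itv setT g G)//; first last.
- by move=> x x0; rewrite unit_expRN.
- exact: measurable_unit_itv.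
by congr (ri_norm E _); apply/funext => x; rewrite /cut in_setT.
Qed.

Lemma tilde_norm_left E g G x : 0 < x -> mpos G ->
  (forall y, 0 < y -> g (expR (- y)) = G y) ->
  tilde_norm E `]0, expR (- x)[ g = E (cut `]x, +oo[ G).
Proof.
move=> x0 mG gG; apply: tilde_norm_log => //.
  move=> t /=; rewrite unit_itvE in_itv/= => /andP[-> tx] /=.
  by apply: (lt_trans tx); rewrite -[ltRHS]expR0 ltr_expR oppr_lt0.
by move=> y y0 /=; rewrite !in_itv/= expR_gt0 ltr_expR ltrN2 andbT.
Qed.

Lemma tilde_norm_right E g G x : 0 < x -> mpos G ->
  (forall y, 0 < y -> g (expR (- y)) = G y) ->
  tilde_norm E `]expR (- x), 1[ g = E (cut `]0, x[ G).
Proof.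
move=> x0 mG gG; apply: tilde_norm_log => //.
  move=> t /=; rewrite unit_itvE in_itv/= => /andP[xt ->]; rewrite andbT.
  by apply: lt_trans xt; exact: expR_gt0.
move=> y y0 /=; rewrite !in_itv/= ltr_expR ltrN2 y0 -[X in _ && (_ < X)]expR0 ltr_expR.
by rewrite oppr_lt0 y0 andbT.
Qed.

Lemma tilde_norm_mid E g G x y : 0 < x -> 0 < y -> mpos G ->
  (forall y, 0 < y -> g (expR (- y)) = G y) ->
  tilde_norm E `]expR (- x), expR (- y)[ g = E (cut `]y, x[ G).
Proof.
move=> x0 y0 mG gG; apply: tilde_norm_log => //.
  move=> t /=; rewrite unit_itvE in_itv/= => /andP[xt ty].
  rewrite (lt_trans (expR_gt0 _) xt) (lt_trans ty)// -[ltRHS]expR0 ltr_expR.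
  by rewrite oppr_lt0.
by move=> z z0 /=; rewrite !in_itv/= !ltr_expR !ltrN2 andbC.
Qed.

Lemma ri_cut_sub E (A B : set R) G : measurable A -> measurable B -> mpos G ->
  A `<=` B -> (E (cut A G) <= E (cut B G))%E.
Proof.
move=> mA mB mG AB; apply: ri_le_pt => [||x x0]; [exact: mpos_cutT..|].
rewrite /cut; case: ifPn => [|_]; first by rewrite inE => /AB h; rewrite mem_set.
by case: ifP => // _; apply: mG.2; rewrite pos_itvE.
Qed.

(** The essential counterpart of [wsup]: the inner [L_oo] norm of the
    iterated norms, in the variable [- ln s]. *)
Definition wesssup w F (A : set R) : \bar R :=
  Linf R (cut A (fun z => (w z)%:E * F z)%E).

Lemma wesssup_ge0 k w F A : regvar k w -> nondecr0 F -> measurable A ->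
  (0 <= wesssup w F A)%E.
Proof. by move=> hw hF mA; apply: ri_nneg; apply: mpos_cutT => //; exact: mpos_wF hw hF. Qed.

Lemma wesssup_sub k w F A B : regvar k w -> nondecr0 F -> measurable A ->
  measurable B -> A `<=` B -> (wesssup w F A <= wesssup w F B)%E.
Proof. by move=> hw hF mA mB AB; apply: ri_cut_sub => //; exact: mpos_wF hw hF. Qed.

Lemma wesssup_le_wsup k w F A : regvar k w -> nondecr0 F -> measurable A ->
  A `<=` pos_itv -> A !=set0 -> (wesssup w F A <= wsup w F A)%E.
Proof.
move=> hw hF mA Ap [a Aa]; apply/Linf_normP.
  by apply: mpos_cutT => //; exact: mpos_wF hw hF.
apply: aeW => z z0; rewrite /cut; case: ifPn => [|_]; first by rewrite inE; exact: le_wsup.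
apply: le_trans (le_wsup w F Aa); apply: wF_ge0 hw hF _.
by have := Ap _ Aa; rewrite pos_itvE.
Qed.

Lemma ae_itv_witness (P : R -> Prop) (a b : R) : a < b ->
  {ae leb, forall x, P x} -> exists2 x, a < x < b & P x.
Proof.
move=> ab [N [mN N0 hN]]; apply: contrapT => h.
have abN : `]a, b[%classic `<=` N.
  move=> x /=; rewrite in_itv/= => xab; apply: hN => Px; apply: h.
  by exists x.
have : (leb `]a, b[ <= leb N)%E by exact: lebesgue_measure_le.
rewrite [X in (_ <= X)%E]N0 lebesgue_measure_itv/= lte_fin ab -EFinD lee_fin.
by rewrite leNgt subr_gt0 ab.
Qed.

(** As [w * F] is locally almost increasing, the supremum over a set without
    maximum is controlled by the essential one. *)
Lemma wsup_le_wesssup k w : regvar k w -> exists2 C : R, 0 < C & forall F A,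
  nondecr0 F -> measurable A -> A `<=` pos_itv ->
  (forall z, A z -> exists2 z', z < z' & `]z, z'[ `<=` A) ->
  (wsup w F A <= C%:E * wesssup w F A)%E.
Proof.
move=> hw; have [C C0 hC] := wF_local hw; exists C => // F A hF mA Ap openA.
have mp : mpos (cut A (fun z => (w z)%:E * F z)%E).
  by apply: mpos_cutT => //; exact: mpos_wF hw hF.
apply: wsup_le => z Az; have [z' zz' sA] := openA z Az.
have z0 : 0 < z by have := Ap _ Az; rewrite pos_itvE.
have zm : z < Num.min z' (z + 1) by rewrite lt_min zz' ltrDl /=.
have [y + hy] := ae_itv_witness zm (Linf_norm_ge mp).
rewrite lt_min => /andP[zy /andP[yz' yz1]].
have Ay : A y by apply: sA; rewrite /= in_itv/= zy.
apply: (le_trans (hC F hF z y z0 (ltW zy) (ltW yz1))); rewrite lee_pmul2l//.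
by have := hy (Ap _ Ay); rewrite {1}/cut mem_set.
Qed.


Definition esstail E w F x := E (cut `]x, +oo[ (fun y => wesssup w F `]y, +oo[)).

Definition esshead E w F x := E (cut `]0, x[ (fun y => wesssup w F `]y, x[)).

Lemma mpos_wesstail k w F : regvar k w -> nondecr0 F ->
  mpos (fun y => wesssup w F `]y, +oo[).
Proof.
move=> hw hF; apply: mpos_nonincreasing => [x y _ xy|x _].
  apply: (wesssup_sub hw hF) => // z /=; rewrite !in_itv/= !andbT.
  exact: le_lt_trans.
exact: (wesssup_ge0 hw hF).
Qed.

Lemma mpos_wesshead k w F x : regvar k w -> nondecr0 F ->
  mpos (fun y => wesssup w F `]y, x[).
Proof.
move=> hw hF; apply: mpos_nonincreasing => [y z _ yz|y _].
  apply: (wesssup_sub hw hF) => // t /=; rewrite !in_itv/= => /andP[zt ->].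
  by rewrite (le_lt_trans yz zt).
exact: (wesssup_ge0 hw hF).
Qed.

Lemma wesstail_equiv k w : regvar k w -> exists2 C : R, 0 < C & forall F x,
  nondecr0 F -> 0 < x -> (wesssup w F `]x, +oo[ <= wtail w F x)%E /\
    (wtail w F x <= C%:E * wesssup w F `]x, +oo[)%E.
Proof.
move=> hw; have [C C0 hC] := wsup_le_wesssup hw; exists C => // F x hF x0.
have sub : `]x, +oo[%classic `<=` (pos_itv : set R).
  by move=> z /=; rewrite in_itv/= andbT pos_itvE; exact: lt_trans.
split.
  by apply: (wesssup_le_wsup hw) => //; exists (x + 1); rewrite /= in_itv/= andbT ltrDl.
apply: hC => // z /=; rewrite in_itv/= andbT => xz; exists (z + 1); first by rewrite ltrDl.
by move=> t /=; rewrite !in_itv/= andbT => /andP[zt _]; exact: lt_trans zt.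
Qed.

Lemma wesshead_equiv k w : regvar k w -> exists2 C : R, 0 < C & forall F x y,
  nondecr0 F -> 0 < y -> y < x -> (wesssup w F `]y, x[ <= wsup w F `]y, x[)%E /\
    (wsup w F `]y, x[ <= C%:E * wesssup w F `]y, x[)%E.
Proof.
move=> hw; have [C C0 hC] := wsup_le_wesssup hw; exists C => // F x y hF y0 yx.
have sub : `]y, x[%classic `<=` (pos_itv : set R).
  by move=> z /=; rewrite in_itv/= pos_itvE => /andP[+ _]; exact: lt_trans.
split.
  by apply: (wesssup_le_wsup hw) => //; exists ((y + x) / 2); rewrite /= in_itv/= !midf_lt.
apply: hC => // z /=; rewrite in_itv/= => /andP[yz zx]; exists x => //.
by move=> t /=; rewrite !in_itv/= => /andP[zt ->]; rewrite (lt_trans yz zt).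
Qed.

Lemma ri_cut_equiv E (A : set R) G H C : 0 <= C -> mpos (cut A G) -> mpos (cut A H) ->
  (forall y, 0 < y -> A y -> (G y <= C%:E * H y)%E) ->
  (E (cut A G) <= C%:E * E (cut A H))%E.
Proof.
move=> C0 mG mH GH; apply: ri_le_scale => // y y0; rewrite /cut.
by case: ifPn => [|_]; rewrite ?mule0// inE; exact: GH.
Qed.

Lemma esstail_equiv k w : regvar k w -> exists2 C : R, 0 < C & forall E F x,
  nondecr0 F -> (esstail E w F x <= C%:E * Ktail E w F x)%E /\
    (Ktail E w F x <= C%:E * esstail E w F x)%E.
Proof.
move=> hw; have [C C0 hC] := wesstail_equiv hw.
exists (1 + C) => [|E F x hF]; first by rewrite addr_gt0.
have m1 : mpos (cut `]x, +oo[ (fun y => wesssup w F `]y, +oo[)).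
  by apply: mpos_cutT => //; exact: mpos_wesstail hw hF.
have m2 : mpos (cut `]x, +oo[ (wtail w F)).
  by apply: mpos_cutT => //; exact: mpos_wtail hw hF.
have C10 : 0 <= 1 + C by rewrite addr_ge0// ltW.
split; apply: ri_cut_equiv => // y y0 _; have [h1 h2] := hC F y hF y0.
  apply: (le_trans h1); rewrite -[leLHS]mul1e lee_wpmul2r ?lee_fin ?lerDl ?(ltW C0)//.
  exact: wtail_ge0 hw hF (ltW y0).
apply: (le_trans h2); rewrite lee_wpmul2r ?lee_fin ?lerDr//.
exact: (wesssup_ge0 hw hF).
Qed.

Lemma esshead_equiv k w : regvar k w -> exists2 C : R, 0 < C & forall E F x,
  nondecr0 F -> (esshead E w F x <= C%:E * Khead E w F x)%E /\
    (Khead E w F x <= C%:E * esshead E w F x)%E.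
Proof.
move=> hw; have [C C0 hC] := wesshead_equiv hw.
exists (1 + C) => [|E F x hF]; first by rewrite addr_gt0.
have m1 : mpos (cut `]0, x[ (fun y => wesssup w F `]y, x[)).
  by apply: mpos_cutT => //; exact: mpos_wesshead hw hF.
have m2 : mpos (cut `]0, x[ (fun y => wsup w F `]y, x[)).
  by apply: (@mpos_Khead_fun _ w (- k)) => //; rewrite opprK.
have C10 : 0 <= 1 + C by rewrite addr_ge0// ltW.
split; apply: ri_cut_equiv => // y y0; rewrite /= in_itv/= y0 /= => yx;
  have [h1 h2] := hC F x y hF y0 yx.
  apply: (le_trans h1); rewrite -[leLHS]mul1e lee_wpmul2r ?lee_fin ?lerDl ?(ltW C0)//.
  apply: le_trans h1; exact: (wesssup_ge0 hw hF).
apply: (le_trans h2); rewrite lee_wpmul2r ?lee_fin ?lerDr//.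
exact: (wesssup_ge0 hw hF).
Qed.

Lemma mpos_esstail k E w F : regvar k w -> nondecr0 F -> mpos (esstail E w F).
Proof.
move=> hw hF; have m := mpos_wesstail hw hF.
apply: mpos_nonincreasing => [x y _ xy|x _].
  by apply: ri_cut_sub => // z /=; rewrite !in_itv/= !andbT; exact: le_lt_trans.
by apply: ri_nneg; exact: mpos_cutT.
Qed.

Lemma mpos_esshead k E w F : regvar k w -> nondecr0 F -> mpos (esshead E w F).
Proof.
move=> hw hF; have m x := mpos_wesshead x hw hF.
have mc x : mpos (cut `]0, x[ (fun y => wesssup w F `]y, x[)) by exact: mpos_cutT.
apply: mpos_nondecreasing => [x y _ xy|x _]; last exact: ri_nneg.
apply: ri_le_pt => // z z0; rewrite [leLHS]/cut; case: ifPn => [|_].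
  rewrite inE /= in_itv/= => /andP[_ zx].
  rewrite /cut mem_set; last by rewrite /= in_itv/= z0 (lt_le_trans zx).
  apply: (wesssup_sub hw hF) => // t /=; rewrite !in_itv/= => /andP[-> tx] /=.
  exact: lt_le_trans xy.
by apply: (mc y).2; rewrite pos_itvE.
Qed.

End iterated_norms.

(** * Identification of the interpolation spaces *)

Section identification.
Context {R : realType} (E0 E1 : riSpace R) (p0 p1 al be : R) (b : R -> R).
Hypotheses (hp0 : 1 < p0) (hp01 : p0 < p1) (hb : SV b).
Implicit Types (f : R -> R) (E : riSpace R).

Notation mf1 f := (measurable_fun (unit_itv : set R) f).
Notation w0 := (logweight p0 al).
Notation w1 := (logweight p1 be).
Notation k := (p0^-1 - p1^-1).
Notation d th := (dweight E0 E1 p0 p1 al be b th).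

Notation phi0 := (fun u : R => fundamental E0 (ell u)).
Notation phi1 := (fun u : R => fundamental E1 (ell u)).
Notation rho := (fun u : R => u `^ k *
  ((ellp (al - 1) u * phi0 u) / (ellp (be - 1) u * phi1 u))).
Notation b_rho := (fun u : R => sv_ext b (rho u)).

Let hw0 : regvar (- p0^-1) w0. Proof. exact: regvar_logweight. Qed.
Let hw1 : regvar (- p1^-1) w1. Proof. exact: regvar_logweight. Qed.
Let hd th : regvar (th * k) (d th). Proof. exact: regvar_dweight. Qed.
Let hF f : nondecr0 (logstar f). Proof. exact: nondecr0_logstar. Qed.

Lemma rho_expRN x : 0 < x -> rho (expR (- x)) = rhow E0 E1 w0 w1 x.
Proof.
move=> x0; rewrite /rhow /logweight ell_expRN//.
rewrite powRB; last by apply/implyP => _; rewrite gt_eqF ?expR_gt0.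
by rewrite -!mulrA; congr (_ * _); rewrite !invfM; ring.
Qed.

Lemma b_rho_expRN x : 0 < x -> b_rho (expR (- x)) = brho E0 E1 p0 p1 al be b x.
Proof. by move=> x0; rewrite /brho /= -rho_expRN. Qed.

Lemma dweight0 x : d 0 x = brho E0 E1 p0 p1 al be b x.
Proof. by rewrite /dweight oppr0 powRr0 mul1r. Qed.

Lemma dweight1 x : 0 < x ->
  d 1 x * rhow E0 E1 w0 w1 x = brho E0 E1 p0 p1 al be b x.
Proof.
move=> x0; have r0 : 0 < rhow E0 E1 w0 w1 x by exact: rhow_gt0 hw0 hw1 _ x0.
by rewrite /dweight powR_inv1 ?ltW// mulrAC mulVf ?mul1r// gt_eqF.
Qed.

(** The weight in part (a) is that of the core: with [A] and [B] for the two
    logarithmic factors, both sides are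
    [u `^ p^-1 * A `^ (1 - th) * B `^ th * b_rho u] at [u = expR (- x)]. *)
Lemma core_weight th p x : 0 < x -> p^-1 = (1 - th) / p0 + th / p1 ->
  expR (- x) `^ p^-1 * ((ellp (al - 1) (expR (- x)) * phi0 (expR (- x))) `^ (1 - th) *
    (ellp (be - 1) (expR (- x)) * phi1 (expR (- x))) `^ th * b_rho (expR (- x))) =
  d th x * fundamental E0 (1 + x) * w0 x.
Proof.
move=> x0 hp; have eb := b_rho_expRN x0; have er := rho_expRN x0.
cbv beta in eb, er |- *; rewrite eb /dweight -er /logweight ell_expRN//.
have l0 s : 0 < ellp s (expR (- x)) by rewrite powR_gt0// ell_expRN// addr_gt0.
have f0 E : 0 < fundamental E (1 + x) by apply: fundamental_gt0; rewrite addr_gt0.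
have ex y : 0 < y -> exists A : R, y = expR A by exists (ln y); rewrite lnK ?posrE.
have [A ->] := ex _ (l0 (al - 1)); have [B ->] := ex _ (l0 (be - 1)).
have [P ->] := ex _ (f0 E0); have [Q ->] := ex _ (f0 E1).
rewrite -!expRD -!expRN -!expRD -!expRM -!expRD -!expRM mulrA -expRD.
rewrite -!mulrA -!expRD [RHS]mulrCA -!expRD [RHS]mulrC hp.
by congr (expR _ * _); ring.
Qed.


Lemma tilde_wstar_left p a f x : 0 < x ->
  tilde_norm (Linf R) `]0, expR (- x)[ (wstar p (ellp (a - 1)) f) =
  wesssup (logweight p a) (logstar f) `]x, +oo[.
Proof.
move=> x0; apply: tilde_norm_left => //.
exact: mpos_wF (regvar_logweight p a) (hF f).
Qed.

Lemma tilde_wstar_mid p a f x y : 0 < x -> 0 < y ->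
  tilde_norm (Linf R) `]expR (- x), expR (- y)[ (wstar p (ellp (a - 1)) f) =
  wesssup (logweight p a) (logstar f) `]y, x[.
Proof.
move=> x0 y0; apply: tilde_norm_mid => //.
exact: mpos_wF (regvar_logweight p a) (hF f).
Qed.

Lemma Lspc_norm E th p f : p^-1 = (1 - th) / p0 + th / p1 ->
  fnorm (Lspc p (fun u => (ellp (al - 1) u * phi0 u) `^ (1 - th) *
                          (ellp (be - 1) u * phi1 u) `^ th * b_rho u) E) f =
  E (corepart E0 w0 (d th) (logstar f)).
Proof.
move=> hp; apply: tilde_norm_unit => [|x x0].
  exact: (mpos_core E0 hw0 (hd th) (hF f)).
by rewrite /corepart -(core_weight x0 hp).
Qed.

Definition essmid E F := E (fun x =>
  (d 0 x * fundamental E0 (1 + x))%:E * wesssup w0 F `]x, +oo[)%E.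

Definition esstails E F := E (fun x => (d 0 x)%:E * esstail E0 w0 F x)%E.

Definition essheads E F := E (fun x =>
  (d 1 x * rhow E0 E1 w0 w1 x)%:E * esshead E1 w1 F x)%E.

Lemma mpos_essmid F : nondecr0 F -> mpos (fun x =>
  (d 0 x * fundamental E0 (1 + x))%:E * wesssup w0 F `]x, +oo[)%E.
Proof.
move=> h; apply: mposM (mpos_wesstail hw0 h).
exact: regvar_mpos (regvar_dphi0 E0 (hd 0)).
Qed.

Lemma mpos_esstails F : nondecr0 F -> mpos (fun x =>
  (d 0 x)%:E * esstail E0 w0 F x)%E.
Proof. by move=> h; apply: mposM (regvar_mpos (hd 0)) (mpos_esstail E0 hw0 h). Qed.

Lemma mpos_essheads F : nondecr0 F -> mpos (fun x =>
  (d 1 x * rhow E0 E1 w0 w1 x)%:E * esshead E1 w1 F x)%E.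
Proof.
move=> h; apply: mposM (mpos_esshead E1 hw1 h).
exact: regvar_mpos (regvar_drho E0 E1 hw0 hw1 (hd 1)).
Qed.

Lemma LspcL_norm E f :
  fnorm (LspcL p0 (fun u => phi0 u * b_rho u) E (ellp (al - 1)) (Linf R)) f =
  essmid E (logstar f).
Proof.
apply: tilde_norm_unit => [|x x0]; first exact: mpos_essmid.
have eb := b_rho_expRN x0; cbv beta in eb |- *.
by rewrite tilde_wstar_left// eb ell_expRN// dweight0 mulrC.
Qed.

Lemma LspcLL_norm E f :
  fnorm (LspcLL p0 b_rho E (fun=> 1) E0 (ellp (al - 1)) (Linf R)) f =
  esstails E (logstar f).
Proof.
apply: tilde_norm_unit => [|x x0]; first exact: mpos_esstails.
have eb := b_rho_expRN x0; cbv beta in eb |- *; rewrite eb dweight0.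
congr (_ * _)%E; apply: tilde_norm_left => // [|y y0].
  exact: mpos_wesstail hw0 (hF f).
by rewrite mul1e tilde_wstar_left.
Qed.

Lemma LspcLR_norm E f :
  fnorm (LspcLR p1 b_rho E (fun=> 1) E1 (ellp (be - 1)) (Linf R)) f =
  essheads E (logstar f).
Proof.
apply: tilde_norm_unit => [|x x0]; first exact: mpos_essheads.
have eb := b_rho_expRN x0; cbv beta in eb |- *; rewrite eb dweight1//.
congr (_ * _)%E; apply: tilde_norm_right => // [|y y0].
  exact: mpos_wesshead hw1 (hF f).
by rewrite mul1e tilde_wstar_mid.
Qed.

Definition dominated (N Z : (R -> \bar R) -> \bar R) : Prop :=
  exists2 C : R, 0 < C & forall F, nondecr0 F -> (N F <= C%:E * Z F)%E.

Lemma dominated_trans N P Z : dominated N P -> dominated P Z -> dominated N Z.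
Proof.
move=> [C C0 h1] [D D0 h2]; exists (C * D) => [|F h]; first by rewrite mulr_gt0.
by apply: (le_trans (h1 F h)); rewrite EFinM -muleA lee_pmul2l// h2.
Qed.

Lemma dominated_le (N Z : (R -> \bar R) -> \bar R) :
  (forall F, nondecr0 F -> (N F <= Z F)%E) -> dominated N Z.
Proof. by move=> h; exists 1 => // F hF0; rewrite mul1e h. Qed.

Lemma dominatedD N P Z : dominated N Z -> dominated P Z ->
  dominated (fun F => N F + P F)%E Z.
Proof.
move=> [C C0 h1] [D D0 h2]; exists (C + D) => [|F h]; first by rewrite addr_gt0.
rewrite EFinD ge0_muleDl ?lee_fin ?(ltW C0) ?(ltW D0)//.
by apply: leeD; [exact: h1|exact: h2].
Qed.

Lemma dominated_max N P Z : (forall F, nondecr0 F -> (0 <= Z F)%E) ->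
  dominated N Z -> dominated P Z -> dominated (fun F => maxe (N F) (P F)) Z.
Proof.
move=> Z0 [C C0 h1] [D D0 h2]; exists (C + D) => [|F h]; first by rewrite addr_gt0.
rewrite ge_max (le_trans (h1 F h)) ?(le_trans (h2 F h))//;
  by rewrite lee_wpmul2r ?Z0// lee_fin ?lerDl ?lerDr ltW.
Qed.

Lemma same_space_dominated th E (Z : fspace R) (N : (R -> \bar R) -> \bar R) :
  (forall f, carrier Z f <-> mf1 f /\ (fnorm Z f < +oo)%E) ->
  (forall f, fnorm Z f = N (logstar f)) ->
  (forall F, nondecr0 F -> (0 <= N F)%E) ->
  dominated (fun F => E (Kpart E0 E1 w0 w1 (d th) F)) N ->
  dominated N (fun F => E (Kpart E0 E1 w0 w1 (d th) F)) ->
  same_space (interp (Bspc p0 al E0) (Bspc p1 be E1) th b E) Z.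
Proof.
move=> hZ ZN N0 [C C0 hC] [D D0 hD]; apply: same_space_interp => //.
exists (C + D) => [|f mf M]; first by rewrite addr_gt0.
have h := hF f; have M0 : (0 <= M)%E.
  by apply: ri_nneg; exact: (mpos_Kpart E0 E1 hw0 hw1 (hd th) h).
rewrite ZN; split.
  by apply: (le_trans (hC _ h)); rewrite lee_wpmul2r ?N0// lee_fin lerDl ltW.
by apply: (le_trans (hD _ h)); rewrite lee_wpmul2r// lee_fin lerDr ltW.
Qed.

Section comparisons.
Context (th : R) (E : riSpace R).
Let TP F := E (tailpart E0 w0 (d th) F).
Let MP F := E (midpart E0 w0 (d th) F).
Let HP F := E (headpart E0 E1 w0 w1 (d th) F).
Let CP F := E (corepart E0 w0 (d th) F).
Let KP F := E (Kpart E0 E1 w0 w1 (d th) F).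

Lemma KP_dominated N : dominated TP N -> dominated MP N -> dominated HP N ->
  dominated KP N.
Proof.
move=> h1 h2 h3; apply: dominated_trans (dominatedD (dominatedD h1 h2) h3).
by apply: dominated_le => F h; exact: ri_Kpart_le hw0 hw1 (hd th) F h.
Qed.

Lemma dominated_KP : [/\ dominated TP KP, dominated MP KP & dominated HP KP].
Proof.
by split; apply: dominated_le => F h; case: (ri_Kpart_ge E E0 E1 hw0 hw1 (hd th) h).
Qed.


Lemma core_dominated : dominated CP MP.
Proof. exact: ri_core_mid hw0 (hd th). Qed.

Lemma tail_dominated : 0 < th -> dominated TP MP.
Proof.
move=> th0; apply: ri_tailpart_le hw0 (hd th) _.
by rewrite mulr_gt0// subr_gt0 (invp1_lt_invp0 hp0).
Qed.

Lemma mid_dominated : 0 < th -> dominated MP CP.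
Proof.
move=> th0; apply: ri_midpart_le hw0 (hd th) _.
by rewrite mulr_gt0// subr_gt0 (invp1_lt_invp0 hp0).
Qed.

Lemma head_dominated : th < 1 -> dominated HP CP.
Proof.
move=> th1; apply: (ri_headpart_le E E0 E1 hw0 hw1 (hd th)).
by rewrite gtr_pMl// subr_gt0 (invp1_lt_invp0 hp0).
Qed.

Lemma core_dominated_head : dominated CP HP.
Proof. exact: (ri_core_head E E0 E1 hw0 hw1 (hd th)). Qed.

End comparisons.

Lemma ri_weight_le E mu v P Q C : regvar mu v -> 0 <= C -> mpos P -> mpos Q ->
  (forall x, 0 < x -> (P x <= C%:E * Q x)%E) ->
  (E (fun x => (v x)%:E * P x) <= C%:E * E (fun x => (v x)%:E * Q x))%E.
Proof.
move=> hv C0 mP mQ PQ; have mv := regvar_mpos hv.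
apply: ri_le_scale => //; [exact: (mposM mv mP)|exact: (mposM mv mQ)|] => x x0.
by rewrite muleCA lee_wpmul2l ?PQ// lee_fin (regvar_ge0 hv).
Qed.

Lemma essmid_equiv E : let MP F := E (midpart E0 w0 (d 0) F) in
  dominated MP (essmid E) /\ dominated (essmid E) MP.
Proof.
have hv := regvar_dphi0 E0 (hd 0); have [C C0 hC] := wesstail_equiv hw0.
split; [exists C|exists 1] => // F h; have mW := mpos_wtail hw0 h;
  have mV := mpos_wesstail hw0 h; apply: (ri_weight_le E hv) => //.
- exact: ltW.
- by move=> x x0; exact: (hC F x h x0).2.
- by move=> x x0; rewrite mul1e; exact: (hC F x h x0).1.
Qed.

Lemma esstails_equiv E : let TP F := E (tailpart E0 w0 (d 0) F) in
  dominated TP (esstails E) /\ dominated (esstails E) TP.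
Proof.
have [C C0 hC] := esstail_equiv hw0.
split; exists C => // F h; have mT := mpos_Ktail E0 hw0 h;
  have mV := mpos_esstail E0 hw0 h;
  apply: (ri_weight_le E (hd 0)) => //; try exact: ltW.
- by move=> x _; exact: (hC E0 F x h).2.
- by move=> x _; exact: (hC E0 F x h).1.
Qed.

Lemma essheads_equiv E : let HP F := E (headpart E0 E1 w0 w1 (d 1) F) in
  dominated HP (essheads E) /\ dominated (essheads E) HP.
Proof.
have hv := regvar_drho E0 E1 hw0 hw1 (hd 1); have [C C0 hC] := esshead_equiv hw1.
split; exists C => // F h; have mT := mpos_Khead E1 hw1 h;
  have mV := mpos_esshead E1 hw1 h;
  apply: (ri_weight_le E hv) => //; try exact: ltW.
- by move=> x _; exact: (hC E1 F x h).2.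
- by move=> x _; exact: (hC E1 F x h).1.
Qed.

(** For an index of the weight strictly between 0 and [k], all three terms of
    the model are equivalent to the core. *)
Lemma interp_theta E th p : 0 < th -> th < 1 -> p^-1 = (1 - th) / p0 + th / p1 ->
  same_space (interp (Bspc p0 al E0) (Bspc p1 be E1) th b E)
    (Lspc p (fun u => (ellp (al - 1) u * phi0 u) `^ (1 - th) *
                      (ellp (be - 1) u * phi1 u) `^ th * b_rho u) E).
Proof.
move=> th0 th1 hp.
apply: (@same_space_dominated th E _ (fun F => E (corepart E0 w0 (d th) F))).
- by [].
- by move=> f; exact: Lspc_norm.
- by move=> F h; apply: ri_nneg; exact: (mpos_core E0 hw0 (hd th) h).
- have hm := mid_dominated E th0; have ht := tail_dominated E th0.
  apply: KP_dominated => //; last exact: head_dominated.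
  exact: dominated_trans ht hm.
- have [_ hm _] := dominated_KP th E.
  exact: dominated_trans (core_dominated th E) hm.
Qed.

Lemma carrier_space_ofI (N P : (R -> R) -> \bar R) f :
  carrier (fspaceI (space_of N) (space_of P)) f <->
  mf1 f /\ (fnorm (fspaceI (space_of N) (space_of P)) f < +oo)%E.
Proof.
split; first by move=> [[mf h1] [_ h2]]; split => //=; rewrite gt_max; exact/andP.
by move=> [mf] /=; rewrite gt_max => /andP[].
Qed.

(** For the index 0 the head is still dominated by the core, hence by the
    middle term, but the tail and the middle term both remain. *)
Lemma interp_theta0 E :
  same_space (interp (Bspc p0 al E0) (Bspc p1 be E1) 0 b E)
    (fspaceI
      (LspcL p0 (fun u => phi0 u * b_rho u) E (ellp (al - 1)) (Linf R))
      (LspcLL p0 b_rho E (fun=> 1) E0 (ellp (al - 1)) (Linf R))).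
Proof.
have [m1 m2] := essmid_equiv E; have [t1 t2] := esstails_equiv E.
have [ht hm _] := dominated_KP 0 E.
apply: (@same_space_dominated 0 E _ (fun F => maxe (essmid E F) (esstails E F))).
- exact: carrier_space_ofI.
- by move=> f; rewrite -LspcL_norm -LspcLL_norm.
- move=> F h; rewrite le_max; apply/orP; left; apply: ri_nneg; exact: mpos_essmid.
- have dm : dominated (essmid E) (fun F => maxe (essmid E F) (esstails E F)).
    by apply: dominated_le => F _; rewrite le_max lexx.
  have dt : dominated (esstails E) (fun F => maxe (essmid E F) (esstails E F)).
    by apply: dominated_le => F _; rewrite le_max lexx orbT.
  apply: KP_dominated; [exact: dominated_trans t1 dt|exact: dominated_trans m1 dm|].
  apply: dominated_trans (head_dominated E ltr01) _.
  apply: dominated_trans (core_dominated 0 E) _.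
  exact: dominated_trans m1 dm.
- apply: dominated_max; [|exact: dominated_trans m2 hm|exact: dominated_trans t2 ht].
  by move=> F h; apply: ri_nneg; exact: (mpos_Kpart E0 E1 hw0 hw1 (hd 0) h).
Qed.

(** For the index [k] the tail and the middle term are still dominated by the
    core, hence by the head, which alone remains. *)
Lemma interp_theta1 E :
  same_space (interp (Bspc p0 al E0) (Bspc p1 be E1) 1 b E)
    (LspcLR p1 b_rho E (fun=> 1) E1 (ellp (be - 1)) (Linf R)).
Proof.
have [h1 h2] := essheads_equiv E; have [_ _ hh] := dominated_KP 1 E.
have c1 := dominated_trans (core_dominated_head 1 E) h1.
have m1 := dominated_trans (mid_dominated E ltr01) c1.
apply: (@same_space_dominated 1 E _ (essheads E)).
- by [].
- by move=> f; exact: LspcLR_norm.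
- by move=> F h; apply: ri_nneg; exact: mpos_essheads.
- apply: KP_dominated => //; exact: dominated_trans (tail_dominated E ltr01) m1.
- exact: dominated_trans h2 hh.
Qed.

End identification.

Theorem corollary5p16 (R : realType) (E E0 E1 : riSpace R) (b : R -> R)
    (p0 p1 alpha beta : R) (hb : SV b) (hp0 : 1 < p0) (hp01 : p0 < p1)
    (halpha : alpha < 1) (hbeta : beta < 1) :
  let phi0 := fun u : R => fundamental E0 (ell u) in
  let phi1 := fun u : R => fundamental E1 (ell u) in
  let rho := fun u : R =>
    u `^ (p0^-1 - p1^-1) *
      ((ellp (alpha - 1) u * phi0 u) / (ellp (beta - 1) u * phi1 u)) in
  let b_rho := fun u : R => sv_ext b (rho u) in
  [/\ (* (a) *)
      forall theta p : R, 0 < theta -> theta < 1 ->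
        p^-1 = (1 - theta) / p0 + theta / p1 ->
        same_space
          (interp (Bspc p0 alpha E0) (Bspc p1 beta E1) theta b E)
          (Lspc p (fun u => (ellp (alpha - 1) u * phi0 u) `^ (1 - theta) *
                            (ellp (beta - 1) u * phi1 u) `^ theta *
                            b_rho u) E),
      (* (b) *)
      same_space
        (interp (Bspc p0 alpha E0) (Bspc p1 beta E1) 0 b E)
        (fspaceI
           (LspcL p0 (fun u => phi0 u * b_rho u) E
                  (ellp (alpha - 1)) (Linf R))
           (LspcLL p0 b_rho E (fun=> 1) E0 (ellp (alpha - 1)) (Linf R))) &
      (* (c) *)
      (tilde_norm E unit_itv (EFin \o b) < +oo)%E ->
      same_space
        (interp (Bspc p0 alpha E0) (Bspc p1 beta E1) 1 b E)
        (LspcLR p1 b_rho E (fun=> 1) E1 (ellp (beta - 1)) (Linf R))].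
Proof.
split=> [theta p|| _].
- exact: interp_theta.
- exact: interp_theta0.
- exact: interp_theta1.
Qed.
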